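(* Let $G=(V,E)$ be a graph with nonnegative edge weights $w$, $n=|V|$, and let $\mathcal{M}=(V,\mathcal{I})$ be a matroid of rank $k$ on $V$. For every $\varepsilon>0$, one can compute in polynomial time a set $V'\subseteq V$ (an approximate kernel) such that $V'$ contains a set $S\in\mathcal{I}$ with $E_G(S)\ge (1-\varepsilon)\max_{X\in\mathcal{I}}E_G(X)$, where the size of $V'$ satisfies: (i) $|V'|\le \frac{k}{\varepsilon}$ when $\mathcal{M}$ is a partition matroid; (ii) $|V'|\le \frac{2k}{\varepsilon}$ when $\mathcal{M}$ is a laminar matroid; (iii) $|V'|\le \frac{k}{\varepsilon}+k(k-1)$ when $\mathcal{M}$ is a transversal matroid. Furthermore, a set $S\in\mathcal{I}$ with $E_G(S)\ge(1-\varepsilon)\max_{X\in\mathcal{I}}E_G(X)$ can be found in $\left(\frac{1}{\varepsilon}\right)^{O(k)}n^{O(1)}$ time for partition and laminar matroids and in $\left(\frac{1}{\varepsilon}+k\right)^{O(k)}n^{O(1)}$ time for transversal matroids.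
   Context: For $S\subseteq V$, $E_G(S)$ denotes the total weight of the edges of $G$ having at least one endpoint in $S$. The Matroid-Constrained Vertex Cover problem asks for $S\in\mathcal{I}$ maximizing $E_G(S)$. A partition matroid is given by a partition $V_1,\dots,V_r$ of $V$ and bounds $k_1,\dots,k_r$, with $S$ independent iff $|S\cap V_i|\le k_i$ for all $i$. A laminar matroid is given by a laminar family $V_1,\dots,V_r$ of subsets of $V$ (any two members are disjoint or one contains the other) and bounds $k_1,\dots,k_r$, with $S$ independent iff $|S\cap V_i|\le k_i$ for all $i$. A transversal matroid is given by a family $V_1,\dots,V_k\subseteq V$ (not necessarily disjoint), with $S=\{u_1,\dots,u_t\}$ independent iff there are distinct indices $\phi(1),\dots,\phi(t)$ with $u_i\in V_{\phi(i)}$. The rank $k$ is the maximum size of an independent set. *)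

(* Defs.v *)
From mathcomp Require Import all_boot all_order all_algebra.

Set Implicit Arguments.
Unset Strict Implicit.
Unset Printing Implicit Defensive.

Import Order.TTheory GRing.Theory Num.Theory.
Local Open Scope ring_scope.

(* The value of [weight] outside [edges] is irrelevant. *)
Record wgraph (R : realFieldType) (n : nat) := WGraph {
  edges : {set {set 'I_n}};
  weight : {set 'I_n} -> R;
  edges_card2 : forall e, e \in edges -> #|e| = 2%N;
  weight_ge0 : forall e, e \in edges -> 0 <= weight e }.

Definition covered (R : realFieldType) n (G : wgraph R n) (S : {set 'I_n}) : R :=
  \sum_(e in edges G | e :&: S != set0) weight G e.

Record matroid (n : nat) := Matroid {
  indep : {set {set 'I_n}};
  indep0 : set0 \in indep;
  indep_sub : forall A B : {set 'I_n}, A \subset B -> B \in indep -> A \in indep;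
  indep_aug : forall A B : {set 'I_n}, A \in indep -> B \in indep -> (#|A| < #|B|)%N ->
    exists2 x, x \in B :\: A & x |: A \in indep }.

Definition mrank n (M : matroid n) : nat := (\max_(S in indep M) #|S|)%N.

(* The default value 0 never exceeds the true maximum, since [set0] is
   independent and weights are nonnegative. *)
Definition opt (R : realFieldType) n (G : wgraph R n) (M : matroid n) : R :=
  \big[Num.max/0]_(X in indep M) covered G X.

Definition approx_solution (R : realFieldType) n (G : wgraph R n)
    (M : matroid n) (eps : R) (S : {set 'I_n}) : Prop :=
  S \in indep M /\ (1 - eps) * opt G M <= covered G S.

Definition approx_kernel (R : realFieldType) n (G : wgraph R n)
    (M : matroid n) (eps : R) (V' : {set 'I_n}) : Prop :=
  exists S : {set 'I_n}, S \subset V' /\ approx_solution G M eps S.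

Definition bounded_indep n r (F : 'I_r -> {set 'I_n}) (b : 'I_r -> nat)
    (S : {set 'I_n}) : Prop :=
  forall i, (#|S :&: F i| <= b i)%N.

(* MathComp's [partition] requires nonempty blocks; together with injectivity
   of [F] this makes the sets [F i] pairwise disjoint. *)
Definition partition_matroid n r (M : matroid n) (F : 'I_r -> {set 'I_n})
    (b : 'I_r -> nat) : Prop :=
  [/\ injective F,
      partition [set F i | i in 'I_r] [set: 'I_n]
    & forall S, S \in indep M <-> bounded_indep F b S].

(* The members of the family are distinct, so that [r <= 2 * n + 1]. *)
Definition laminar_matroid n r (M : matroid n) (F : 'I_r -> {set 'I_n})
    (b : 'I_r -> nat) : Prop :=
  [/\ injective F,
      forall i j, [\/ [disjoint F i & F j], F i \subset F j | F j \subset F i]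
    & forall S, S \in indep M <-> bounded_indep F b S].

Definition transversal_matroid n k (M : matroid n)
    (F : 'I_k -> {set 'I_n}) : Prop :=
  forall S, S \in indep M <->
    exists2 phi : {u : 'I_n | u \in S} -> 'I_k,
      injective phi & forall u, val u \in F (phi u).

(* Model of computation: a unit-cost random access machine executing
   structured programs.  Its memory consists of tables of natural numbers and
   tables of weights; a table has a fixed name, and its cells are addressed by
   a pair of computed natural numbers.  The only arithmetic is addition and
   subtraction (truncated on natural numbers), so the bit length of the
   numbers grows by at most O(1) per step and unit cost is not abused.  A
   program is a finite object independent of the input and of the field of
   weights; the only weight constants are 0 and 1. *)
Inductive nexp : Type :=
| NCst of nat
| NGet of nat & nexp & nexp
| NAdd of nexp & nexp
| NSub of nexp & nexp.

Inductive wexp : Type :=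
| WZero
| WOne
| WGet of nat & nexp & nexp
| WAdd of wexp & wexp
| WSub of wexp & wexp.

Inductive test : Type :=
| NLe of nexp & nexp
| WLe of wexp & wexp
| TNot of test
| TAnd of test & test.

Inductive prog : Type :=
| Skip
| NSet of nat & nexp & nexp & nexp
| WSet of nat & nexp & nexp & wexp
| Seq of prog & prog
| If of test & prog & prog
| While of test & prog.

Record state (R : realFieldType) := State {
  ntab : nat -> nat -> nat -> nat;
  wtab : nat -> nat -> nat -> R }.

Definition upd (T : Type) (m : nat -> nat -> nat -> T) (x i j : nat) (a : T) :=
  fun x' i' j' => if [&& x' == x, i' == i & j' == j] then a else m x' i' j'.

Section Semantics.
Variable R : realFieldType.
Implicit Type s : state R.

Fixpoint neval s (e : nexp) : nat :=
  match e with
  | NCst c => c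
  | NGet x e1 e2 => ntab s x (neval s e1) (neval s e2)
  | NAdd e1 e2 => (neval s e1 + neval s e2)%N
  | NSub e1 e2 => (neval s e1 - neval s e2)%N
  end.

Fixpoint weval s (e : wexp) : R :=
  match e with
  | WZero => 0
  | WOne => 1
  | WGet x e1 e2 => wtab s x (neval s e1) (neval s e2)
  | WAdd e1 e2 => weval s e1 + weval s e2
  | WSub e1 e2 => weval s e1 - weval s e2
  end.

Fixpoint teval s (c : test) : bool :=
  match c with
  | NLe e1 e2 => (neval s e1 <= neval s e2)%N
  | WLe e1 e2 => weval s e1 <= weval s e2
  | TNot c1 => ~~ teval s c1
  | TAnd c1 c2 => teval s c1 && teval s c2
  end.

(* [runs p s t s']: started in state s, p halts in state s' after t steps;
   every assignment and every evaluation of a test is one step.  Evaluating an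
   expression takes a number of operations bounded by the length of p. *)
Inductive runs : prog -> state R -> nat -> state R -> Prop :=
| RunSkip s : runs Skip s 1%N s
| RunNSet s x i j e :
    runs (NSet x i j e) s 1%N
      (State (upd (ntab s) x (neval s i) (neval s j) (neval s e)) (wtab s))
| RunWSet s x i j e :
    runs (WSet x i j e) s 1%N
      (State (ntab s) (upd (wtab s) x (neval s i) (neval s j) (weval s e)))
| RunSeq p1 p2 s1 s2 s3 t1 t2 :
    runs p1 s1 t1 s2 -> runs p2 s2 t2 s3 -> runs (Seq p1 p2) s1 (t1 + t2)%N s3
| RunIf c p1 p2 s t s' :
    runs (if teval s c then p1 else p2) s t s' -> runs (If c p1 p2) s t.+1 s'
| RunWhileF c p s : ~~ teval s c -> runs (While c p) s 1%N s
| RunWhileT c p s1 s2 s3 t1 t2 :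
    teval s1 c -> runs p s1 t1 s2 -> runs (While c p) s2 t2 s3 ->
    runs (While c p) s1 (t1 + t2)%N.+1 s3.

End Semantics.

Definition table_of (T : Type) m n (d : T) (f : 'I_m -> 'I_n -> T)
    (i j : nat) : T :=
  match insub i, insub j with
  | Some u, Some v => f u v
  | _, _ => d
  end.

(* Initial memory; every cell not listed below holds 0.
   Natural numbers: table 0 holds n in cell (0, 0) and the number r of sets of
   the family in cell (0, 1); table 1 is the adjacency matrix of the graph;
   table 2 is the r x n incidence matrix of the family; table 3 holds the
   bound of the i-th set in cell (i, 0).
   Weights: table 0 holds eps in cell (0, 0); table 1 is the matrix of edge
   weights. *)
Definition input (R : realFieldType) n r (G : wgraph R n) (eps : R)
    (F : 'I_r -> {set 'I_n}) (b : 'I_r -> nat) : state R :=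
  State
    (fun x => match x with
     | 0 => fun i j => if (i, j) == (0, 0)%N then n
                       else if (i, j) == (0, 1)%N then r else 0%N
     | 1 => table_of 0%N (fun u v : 'I_n => nat_of_bool ([set u; v] \in edges G))
     | 2 => table_of 0%N (fun i v => nat_of_bool (v \in F i))
     | 3 => table_of 0%N (fun i (j : 'I_1) => b i)
     | _ => fun _ _ => 0%N
     end)
    (fun x => match x with
     | 0 => fun i j => if (i, j) == (0, 0)%N then eps else 0
     | 1 => table_of 0 (fun u v : 'I_n =>
              if [set u; v] \in edges G then weight G [set u; v] else 0)
     | _ => fun _ _ => 0
     end).

(* The output is the set whose characteristic vector is left in the cells
   (v, 0) of natural number table 4. *)
Definition output (R : realFieldType) n (s : state R) : {set 'I_n} :=
  [set v : 'I_n | ntab s 4%N v 0%N != 0%N].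

Definition computes_within (R : realFieldType) n (p : prog) (s : state R)
    (time : R) (post : {set 'I_n} -> Prop) : Prop :=
  exists t s', [/\ runs p s t s', t%:R <= time & post (output n s')].

(* Main.v *)
Require Import Defs.
From mathcomp Require Import all_boot all_order all_algebra.
From mathcomp Require Import zify ring lra.

(* For every matroid of rank k the following kernel works, with
   m = floor(1/eps).  Scan the vertices by decreasing weighted degree and put
   each of them into the first of m bins in which it keeps the bin
   independent; the kernel V' is the union of the bins, of size at most k m.
   Let O be an optimum, O_in its part in V' and O_out the rest.  A vertex of
   O_out is spanned in each bin by vertices of at least its degree, so by
   exchanges each bin j contains a set I_j, disjoint from O, such that
   O_in + I_j is independent, |I_j| = |O_out| and I_j has at least the total
   degree of O_out.  The average of the indicators of the sets O_in + I_j lies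
   in the matroid polytope, and swap rounding turns it into one independent
   set covering at least m/(m+1) > 1 - eps times what O covers.
   For a transversal matroid an independence oracle would require matchings;
   there the bins are indexed by the sets of the family instead, each bin
   taking up to m + k - 1 elements of its set, which leaves m elements outside
   of O in each full bin for the same rounding argument.
   The best independent subset of V' is found by enumerating words: for bounded
   families, words of length 2k over m + 1 letters that encode the gaps
   between the chosen positions, hence (1/eps)^O(k) words; for m <= 1 the
   kernel is itself independent. *)

Set Implicit Arguments.
Unset Strict Implicit.
Unset Printing Implicit Defensive.

Import Order.TTheory GRing.Theory Num.Theory.
(** * A program logic with syntactic time bounds *)

(** The ratio m/(m+1) comes from the average x of the indicators of the sets O_in + I_j: it is 1 on
    O_in and 1/m on the union U of the I_j. Covered weight extends to 2 deg(x) - w(x,x), where only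
    w(x,x) is a loss; edges inside U lose with factor 1/m^2, and edges between O_in and U are
    charged to what O_in covers. The extension is convex along d = e_j - e_i because -w(d,d) = 2
    w_ij, so symmetric exchanges can round it. Naming k of the k/eps candidates one by one would
    cost (k/eps)^k, which contains k^k; gap words avoid this, since k letters select and at most k
    letters skip. For m = 1 even 2^(2k) words are too many, because the budget max(1, 1/eps)^O(k)
    can be 1. The machine cannot divide and is not told the rank of a bounded family. Thus m is
    found by repeated addition, stopped at n, and the rank is read off as the size of the first bin,
    a greedy basis. *)

(* The number of steps when every loop makes at most [K] iterations. *)
Fixpoint cost (K : nat) (p : prog) : nat :=
  match p with
  | Skip | NSet _ _ _ _ | WSet _ _ _ _ => 1
  | Seq p q => cost K p + cost K q
  | If _ p q => (cost K p + cost K q).+1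
  | While _ p => (cost K p).+1 * K + 1
  end%N.

(** The nesting depth of loops is fixed by the text of [p], and each level multiplies the bound by
    one more polynomial factor; hence [c] is chosen before [n]. A single [c] serves as coefficient
    and exponent. *)
Lemma cost_polynomial p a : exists c, forall n,
  (cost (a * n.+1 ^ a) p <= c * n.+1 ^ c)%N.
Proof.
have mono c d n : (c <= d -> c * n.+1 ^ c <= d * n.+1 ^ d)%N.
  by move=> cd; rewrite leq_mul // leq_pexp2l.
elim: p => [|x i j e|x i j e|p [c1 h1] q [c2 h2]|t p [c1 h1] q [c2 h2]|t p [c h]] /=;
  try by exists 1%N => n; rewrite mul1n expn1.
- exists (c1 + c2)%N => n; rewrite mulnDl; apply: leq_add.
    by apply: leq_trans (h1 n) _; rewrite leq_mul // leq_pexp2l ?leq_addr.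
  by apply: leq_trans (h2 n) _; rewrite leq_mul // leq_pexp2l ?leq_addl.
- exists (c1 + c2).+1 => n; rewrite mulSn -[(cost _ _ + _).+1]add1n.
  apply: leq_add; first by rewrite expn_gt0.
  rewrite mulnDl; apply: leq_add.
    by apply: leq_trans (h1 n) _; rewrite leq_mul // leq_pexp2l //; lia.
  by apply: leq_trans (h2 n) _; rewrite leq_mul // leq_pexp2l //; lia.
(* The coefficient needed is [(c + 1) * a + 1] and the exponent [c + a]; their sum dominates
   both. *)
- exists ((c + 1) * a + 1 + c + a)%N => n.
  set e := (_ + a)%N; set N := n.+1.
  have hN e1 : (0 < N ^ e1)%N by rewrite expn_gt0.
  have h2 : ((cost (a * N ^ a) p).+1 <= (c + 1) * N ^ c)%N.
    rewrite mulnDl mul1n -addn1; apply: leq_add; [exact: h | exact: hN].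
  apply: (@leq_trans (((c + 1) * a + 1) * N ^ e)); last by rewrite leq_mul2r /e; lia.
  rewrite [leqRHS]mulnDl mul1n; apply: leq_add => //.
  apply: (@leq_trans ((c + 1) * N ^ c * (a * N ^ a))); first by rewrite leq_mul2r h2 orbT.
  rewrite mulnACA -expnD leq_mul // leq_pexp2l // /e; lia.
Qed.

Arguments ntab {R} s (_ _ _)%_N.
Arguments wtab {R} s (_ _ _)%_N.

Fixpoint nmods (p : prog) : seq nat :=
  match p with
  | NSet x _ _ _ => [:: x]
  | Seq p q | If _ p q => nmods p ++ nmods q
  | While _ p => nmods p
  | _ => [::]
  end.

Fixpoint wmods (p : prog) : seq nat :=
  match p with
  | WSet x _ _ _ => [:: x]
  | Seq p q | If _ p q => wmods p ++ wmods q
  | While _ p => wmods p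
  | _ => [::]
  end.

Definition sc x := NGet x (NCst 0) (NCst 0).
Definition setn x e := NSet x (NCst 0) (NCst 0) e.
Definition incr x := setn x (NAdd (sc x) (NCst 1)).
Definition TLt a b := NLe (NAdd a (NCst 1)) b.
Definition TNz a := NLe (NCst 1) a.
Definition TOr a b := TNot (TAnd (TNot a) (TNot b)).
Definition TEq a b := TAnd (NLe a b) (NLe b a).

(* The bound is the content of the cell [(0, a)] of table [y]. *)
Definition For x y a p :=
  Seq (setn x (NCst 0))
      (While (TLt (sc x) (NGet y (NCst 0) (NCst a))) (Seq p (incr x))).

Section Logic.
Variables (R : realFieldType) (K : nat).
Implicit Types (s : state R) (p q : prog) (Q : state R -> Prop).

Definition frame p s s' : Prop :=
  (forall x, x \notin nmods p -> ntab s' x = ntab s x) /\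
  (forall x, x \notin wmods p -> wtab s' x = wtab s x).

Lemma runs_frame p s t s' : runs p s t s' -> frame p s s'.
Proof.
elim=> {p s t s'} //=.
- move=> s x i j e; split=> //= y; rewrite inE => /negPf yx.
  by rewrite /upd yx.
- move=> s x i j e; split=> //= y; rewrite inE => /negPf yx.
  by rewrite /upd yx.
- move=> p q s1 s2 s3 t1 t2 _ [h1 h2] _ [h3 h4].
  split=> x /=; rewrite mem_cat negb_or => /andP[xp xq].
    by rewrite h3 ?h1.
  by rewrite h4 ?h2.
- move=> c p q s t s' _; case: teval => -[h1 h2];
  by split=> x /=; rewrite mem_cat negb_or => /andP[xp xq]; rewrite ?h1 ?h2.
- by move=> c p s1 s2 s3 t1 t2 _ _ [h1 h2] _ [h3 h4]; split=> x /= xp;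
    rewrite ?h3 ?h4 ?h1 ?h2.
Qed.

(** Total correctness whose time bound is read off the syntax, so that no specification has to
    mention time. *)
Definition ok p s Q := exists t s', [/\ runs p s t s', (t <= cost K p)%N & Q s'].

Lemma ok_imp p s Q Q' : ok p s Q -> (forall s', frame p s s' -> Q s' -> Q' s') ->
  ok p s Q'.
Proof.
move=> [t [s' [r le h]]] hQ; exists t, s'; split=> //.
by apply: hQ => //; apply: runs_frame r.
Qed.

Lemma ok_skip s Q : Q s -> ok Skip s Q.
Proof. by exists 1%N, s; split=> //; constructor. Qed.

Lemma ok_nset s x i j e Q :
  Q (State (upd (ntab s) x (neval s i) (neval s j) (neval s e)) (wtab s)) ->
  ok (NSet x i j e) s Q.
Proof. by move=> h; do 2!eexists; split; [constructor| |]. Qed.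

Lemma ok_wset s x i j e Q :
  Q (State (ntab s) (upd (wtab s) x (neval s i) (neval s j) (weval s e))) ->
  ok (WSet x i j e) s Q.
Proof. by move=> h; do 2!eexists; split; [constructor| |]. Qed.

Lemma ok_seq p q s Q : ok p s (fun s1 => ok q s1 Q) -> ok (Seq p q) s Q.
Proof.
move=> [t1 [s1 [r1 le1 [t2 [s2 [r2 le2 h]]]]]]; exists (t1 + t2)%N, s2.
by split=> //=; [apply: RunSeq r1 r2 | apply: leq_add].
Qed.

Lemma ok_if c p q s Q : (teval s c -> ok p s Q) -> (~~ teval s c -> ok q s Q) ->
  ok (If c p q) s Q.
Proof.
move=> hp hq; case E: (teval s c).
  have [t [s' [r le h]]] := hp E; exists t.+1, s'.
  split=> //=; first by apply: RunIf; rewrite E.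
  by rewrite ltnS (leq_trans le) // leq_addr.
have [t [s' [r le h]]] := hq (negbT E); exists t.+1, s'.
split=> //=; first by apply: RunIf; rewrite E.
by rewrite ltnS (leq_trans le) // leq_addl.
Qed.

(** The count [N] and the body cost [C] are independent of [K], because the loop over all words
    makes far more than [K] iterations. *)
Lemma runs_while_count c p s0 N (Inv : nat -> state R -> Prop) C :
    Inv 0%N s0 -> (forall i s, (i < N)%N -> Inv i s -> teval s c) ->
    (forall s, Inv N s -> ~~ teval s c) ->
    (forall i s, (i < N)%N -> Inv i s -> exists t s',
       [/\ runs p s t s', (t <= C)%N & Inv i.+1 s']) ->
  exists t s', [/\ runs (While c p) s0 t s', (t <= C.+1 * N + 1)%N & Inv N s'].
Proof.
move=> I0 ht hf hs.
have gen d i s : (i + d = N)%N -> Inv i s -> exists t s',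
    [/\ runs (While c p) s t s', (t <= C.+1 * d + 1)%N & Inv N s'].
  elim: d i s => [|d IH] i s.
    rewrite addn0 => -> IN; exists 1%N, s; split=> //; last by lia.
    by constructor; apply: hf.
  move=> e Ii; have iN : (i < N)%N by lia.
  have [t1 [s1 [r1 le1 I1]]] := hs _ _ iN Ii.
  have [|t2 [s2 [r2 le2 I2]]] := IH i.+1 s1 _ I1; first by lia.
  exists (t1 + t2).+1, s2; split=> //; first by apply: RunWhileT r1 r2; apply: ht Ii.
  by rewrite mulnS; lia.
exact: gen I0.
Qed.

(** The step premise provides the frame of the whole loop, so an invariant only has to describe the
    tables that the loop changes. *)
Lemma ok_for x y a p s Q (Inv : nat -> state R -> Prop) :
    let N := ntab s y 0%N a in
    (N <= K)%N -> x \notin nmods p -> y \notin x :: nmods p ->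
    Inv 0%N (State (upd (ntab s) x 0 0 0) (wtab s)) ->
    (forall i s1, (i < N)%N -> frame (For x y a p) s s1 -> ntab s1 x 0%N 0%N = i ->
       Inv i s1 ->
       ok p s1 (fun s2 => Inv i.+1 (State (upd (ntab s2) x 0 0 i.+1) (wtab s2)))) ->
    (forall s', frame (For x y a p) s s' -> Inv N s' -> Q s') ->
  ok (For x y a p) s Q.
Proof.
move=> N leN xp yp I0 step fin.
pose I i s1 := [/\ frame (For x y a p) s s1, ntab s1 x 0%N 0%N = i & Inv i s1].
have frN s1 : frame (For x y a p) s s1 -> ntab s1 y 0%N a = N.
  move=> [h _]; rewrite h //=; move: yp; rewrite !inE mem_cat !inE !negb_or.
  by case/andP=> -> ->.
pose s0 := @State R (upd (ntab s) x 0 0 0) (wtab s).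
have [||||t [s' [r le [fr _ IN]]]] := @runs_while_count
    (TLt (sc x) (NGet y (NCst 0) (NCst a))) (Seq p (incr x)) s0 N I (cost K (Seq p (incr x))).
- split=> //; last by rewrite /= /upd !eqxx.
  split=> //= z; rewrite inE mem_cat !negb_or => /and3P[zx _ _].
  by rewrite /upd (negPf zx).
- by move=> i s1 iN [fr ei _]; rewrite /= ei (frN _ fr) addn1.
- by move=> s1 [fr ei _]; rewrite /= ei (frN _ fr) addn1 ltnn.
- move=> i s1 iN [fr ei Ii].
  have [t1 [s2 [r1 le1 I2]]] := step i s1 iN fr ei Ii.
  have fr2 := runs_frame r1.
  have ex : ntab s2 x 0%N 0%N = i by rewrite (proj1 fr2).
  exists (t1 + 1)%N, (State (upd (ntab s2) x 0 0 i.+1) (wtab s2)); split.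
  + apply: RunSeq r1 _; have -> : i.+1 = neval s2 (NAdd (sc x) (NCst 1)).
      by rewrite /= ex addn1.
    exact: (RunNSet s2 x (NCst 0) (NCst 0)).
  + by rewrite /= leq_add2r.
  + split=> //=; last by rewrite /upd !eqxx.
    case: fr fr2 => [h1 h2] [h3 h4]; split=> /= z; rewrite ?inE !mem_cat ?inE ?negb_or.
      by case/and3P=> zx zp _; rewrite /upd (negPf zx) h3 // h1 //= inE mem_cat !inE !negb_or zx zp.
    by case/andP=> zp _; rewrite h4 // h2 //= mem_cat (negPf zp).
exists (1 + t)%N, s'; split; last by apply: fin.
  by apply: RunSeq r; apply: (RunNSet s x (NCst 0) (NCst 0) (NCst 0)).
rewrite [cost _ (For _ _ _ _)]/= leq_add2l (leq_trans le) //=.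
by rewrite leq_add2r leq_mul2l leN orbT.
Qed.

End Logic.

Local Open Scope ring_scope.

(** * Matroid exchange and swap rounding *)

Section Exchange.
Variables (n : nat) (M : matroid n).
Implicit Types A B C K O P S X Y : {set 'I_n}.

Lemma indep_extend X Y : X \in indep M -> Y \in indep M -> (#|X| <= #|Y|)%N ->
  exists K, [/\ K \in indep M, X \subset K, K \subset X :|: Y & #|K| = #|Y|].
Proof.
move=> iX iY; have [d] := ubnP (#|Y| - #|X|)%N.
elim: d X iX => // d IH X iX ltd leXY.
have [eqXY | neXY] := eqVneq #|X| #|Y|.
  by exists X; rewrite subxx subsetUl eqXY.
have ltXY : (#|X| < #|Y|)%N by rewrite ltn_neqAle neXY.
have [x xYX ixX] := indep_aug iX iY ltXY.
have [xY xX] : x \in Y /\ x \notin X by move: xYX; rewrite inE => /andP[].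
have cX : #|x |: X| = #|X|.+1 by rewrite cardsU1 xX.
have [||K [iK sK sKU cK]] := IH _ ixX; [by rewrite cX; lia | by rewrite cX|].
exists K; split=> //; first exact: subset_trans (subsetUr _ _) sK.
apply: (subset_trans sKU); rewrite subUset subsetUr andbT subUset subsetUl andbT.
by rewrite sub1set inE xY orbT.
Qed.

(* An element [o] of [C] spanned by the independent set [P] can be traded for
   an element of [P]. *)
Lemma indep_trade C P o : C \in indep M -> P \in indep M -> o \in C ->
    o \notin P -> o |: P \notin indep M ->
  exists z, [/\ z \in P, z \notin C & z |: C :\ o \in indep M].
Proof.
move=> iC iP oC oP niP.
have iC' : C :\ o \in indep M by apply: indep_sub iC; apply: subsetDl.
have ltC : (#|C :\ o| < #|C|)%N by rewrite [in ltnRHS](cardsD1 o) oC.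
(* It is enough to find an independent set inside [P :|: C] that avoids [o] and exceeds [C :\ o]. If
   [P] is too small, an extension of it within [P :|: C] works: it cannot contain [o], since
   [o |: P] is dependent. *)
suff [K [iK sK oK ltK]] : exists K,
    [/\ K \in indep M, K \subset P :|: C, o \notin K & (#|C :\ o| < #|K|)%N].
  have [z zK iz] := indep_aug iC' iK ltK; exists z.
  move: zK; rewrite !inE => /andP[nzC zK].
  have zo : z != o by apply: contraNneq oK => <-.
  rewrite zo /= in nzC; split=> //.
  by have /setUP[|zC] := subsetP sK _ zK; last by rewrite zC in nzC.
have [leCP | ltPC] := leqP #|C| #|P|.
  by exists P; rewrite subsetUl; split=> //; apply: leq_trans leCP.
have [K [iK sPK sK cK]] := indep_extend iP iC (ltnW ltPC).
exists K; rewrite cK; split=> //; apply: contra niP => oK.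
by apply: indep_sub iK; rewrite subUset sub1set oK.
Qed.

Lemma indep_symm_exchange A B i : A \in indep M -> B \in indep M ->
    #|A| = #|B| -> i \in A -> i \notin B ->
  exists j, [/\ j \in B, j \notin A, j |: A :\ i \in indep M
              & i |: B :\ j \in indep M].
Proof.
move=> iA iB cAB iiA niB.
have [iiB | niiB] := boolP (i |: B \in indep M).
  have iA' : A :\ i \in indep M by apply: indep_sub iA; apply: subsetDl.
  have [|j] := indep_aug iA' iB; first by rewrite -cAB [in ltnRHS](cardsD1 i) iiA.
  rewrite !inE => /andP[njA jB] ij; exists j.
  have ji : j != i by apply: contraNneq niB => <-.
  rewrite ji /= in njA; split=> //; apply: indep_sub iiB.
  by apply: setUS; apply: subsetDl.
(* [i |: D] is the fundamental circuit of [i] with respect to [B]. Since [D] spans [i], trading [i]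
   in [A] against [D] gives both halves of the exchange at once. *)
pose D := [set j in B | i |: B :\ j \in indep M].
have sDB : D \subset B by apply/subsetP => j; rewrite inE => /andP[].
have iD : D \in indep M by apply: indep_sub iB.
have niD : i \notin D by apply: contra niB; apply: (subsetP sDB).
have niiD : i |: D \notin indep M.
  apply/negP => iiD.
  have ltDB : (#|D| < #|B|)%N.
    rewrite ltn_neqAle subset_leq_card // andbT; apply: contra niiB => /eqP eqc.
    by have -> : B = D by apply/esym/eqP; rewrite eqEcard sDB eqc leqnn.
  have [|K [iK sK sKU cK]] := indep_extend iiD iB; first by rewrite cardsU1 niD.
  have sKB : K \subset i |: B.
    apply: (subset_trans sKU); rewrite subUset subsetUr andbT.
    by apply: setUS.
  have iiK : i \in K by apply: (subsetP sK); rewrite !inE eqxx.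
  have [j jB njK] : exists2 j, j \in B & j \notin K.
    apply/subsetPn/negP => sBK; have : (#|i |: B| <= #|K|)%N.
      by apply/subset_leq_card; rewrite subUset sub1set iiK.
    by rewrite cardsU1 niB cK /= add1n ltnn.
  have KE : K = i |: B :\ j.
    apply/eqP; rewrite eqEcard cardsU1 !inE (negPf niB) andbF /= cK.
    rewrite (cardsD1 j B) jB leqnn andbT.
    apply/subsetP => x xK; have := subsetP sKB _ xK; rewrite !inE.
    by case/orP => [->//|->]; rewrite (contraNneq _ njK) ?orbT // => <-.
  have jD : j \in D by rewrite inE jB -KE.
  by case/negP: njK; apply: (subsetP sK); apply/setU1P; right.
have [z [zD zA iz]] := indep_trade iA iD iiA niD niiD.
by exists z; move: zD; rewrite inE => /andP[zB iz']; split.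
Qed.

End Exchange.

(** * Covered weight as a quadratic form *)

Section Rounding.
Variables (R : realFieldType) (n : nat) (w : 'I_n -> 'I_n -> R).
Hypothesis w_ge0 : forall u v, 0 <= w u v.
Hypothesis w_sym : forall u v, w u v = w v u.
Hypothesis w_irr : forall u, w u u = 0.

Implicit Types S T U : {set 'I_n}.

Definition wdeg u := \sum_v w u v.
Definition wdegs (S : {set 'I_n}) := \sum_(u in S) wdeg u.
Definition wbetween (S T : {set 'I_n}) := \sum_(u in S) \sum_(v in T) w u v.
(* Every edge is counted twice, once in each direction. *)
Definition cov2 (S : {set 'I_n}) :=
  \sum_u \sum_v (if (u \in S) || (v \in S) then w u v else 0).

Definition mass (x : 'I_n -> R) := \sum_u x u * wdeg u.
Definition bil (x y : 'I_n -> R) := \sum_u \sum_v x u * y v * w u v.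
(* [q N x] is [N ^+ 2] times the multilinear extension of [cov2] at [x / N]. *)
Definition q (N : nat) (x : 'I_n -> R) := 2 * N%:R * mass x - bil x x.
Definition ind (S : {set 'I_n}) u : R := (u \in S)%:R.

Lemma massE S : mass (ind S) = wdegs S.
Proof.
rewrite /mass /wdegs [RHS]big_mkcond /=; apply: eq_bigr => u _; rewrite /ind.
by case: ifP => _; rewrite ?mul1r ?mul0r.
Qed.

Lemma bilE S T : bil (ind S) (ind T) = wbetween S T.
Proof.
rewrite /bil /wbetween [RHS]big_mkcond; apply: eq_bigr => u _ /=.
rewrite /ind; case: ifP => _; last by rewrite big1 // => v _; rewrite !mul0r.
rewrite [RHS]big_mkcond; apply: eq_bigr => v _ /=.
by case: ifP => _; rewrite ?mul1r ?mulr0 ?mul0r.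
Qed.

Lemma bil_sym x y : bil x y = bil y x.
Proof.
rewrite /bil exchange_big /=; apply: eq_bigr => u _; apply: eq_bigr => v _.
by rewrite w_sym; ring.
Qed.

Lemma cov2E S : cov2 S = 2 * wdegs S - wbetween S S.
Proof.
rewrite -massE -bilE /cov2 /mass /bil.
have -> : 2 * (\sum_u ind S u * wdeg u)
    = \sum_u \sum_v (ind S u + ind S v) * w u v.
  under [RHS]eq_bigr do (under eq_bigr do rewrite mulrDl; rewrite big_split).
  rewrite big_split /= [X in _ + X]exchange_big /= mulr_natl mulr2n.
  by congr (_ + _); apply: eq_bigr => u _; rewrite /wdeg mulr_sumr //;
     apply: eq_bigr => v _; rewrite w_sym.
rewrite -sumrB; apply: eq_bigr => u _; rewrite -sumrB; apply: eq_bigr => v _.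
by rewrite /ind; case: (u \in S); case: (v \in S) => /=; ring.
Qed.

Lemma cov2_sub S T : S \subset T -> cov2 S <= cov2 T.
Proof.
move=> sST; apply: ler_sum => u _; apply: ler_sum => v _.
have := subsetP sST u; have := subsetP sST v.
case: (u \in S); case: (v \in S) => //=.
- by move=> _ ->.
- by move=> _ ->.
- by move=> -> //; rewrite orbT.
- by case: ifP.
Qed.

Lemma wbetween_ge0 S T : 0 <= wbetween S T.
Proof. by apply: sumr_ge0 => u _; apply: sumr_ge0. Qed.

Lemma cov2U S T : cov2 (S :|: T) <= cov2 S + 2 * wdegs T.
Proof.
apply: (@le_trans _ _ (cov2 S + cov2 T)); last first.
  by rewrite lerD2l cov2E lerBlDr lerDl wbetween_ge0.
rewrite -big_split; apply: ler_sum => u _ /=.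
rewrite -big_split; apply: ler_sum => v _ /=; rewrite !inE.
by case: (u \in S); case: (v \in S); case: (u \in T); case: (v \in T) => //=;
   rewrite ?addr0 ?add0r ?lerDl.
Qed.

Lemma wbetween_disjoint2 S T : [disjoint S & T] -> 2 * wbetween S T <= cov2 S.
Proof.
move=> dST; rewrite mulr_natl mulr2n {2}/wbetween exchange_big /= -!bilE.
have -> : \sum_(v in T) \sum_(u in S) w u v = bil (ind T) (ind S).
  rewrite bilE; apply: eq_bigr => u _; apply: eq_bigr => v _; exact: w_sym.
rewrite /bil -big_split; apply: ler_sum => u _ /=; rewrite -big_split.
apply: ler_sum => v _ /=; rewrite /ind.
have dF x : ~~ ((x \in S) && (x \in T)).
  by apply/negP => /andP[xS]; rewrite (disjointFr dST).
move: (dF u) (dF v) (w_ge0 u v).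
by case: (u \in S); case: (u \in T) => //; case: (v \in S); case: (v \in T) => //= _ _ h;
   rewrite ?(mulr0, mul0r, mulr1, mul1r, addr0, add0r) //.
Qed.

Lemma wbetween_le_wdegs S T U : [disjoint S & T] ->
  wbetween S U + wbetween T U <= wdegs U.
Proof.
move=> dST.
rewrite -!bilE -massE bil_sym (bil_sym _ (ind U)) /mass /bil -big_split /=.
apply: ler_sum => u _; rewrite /wdeg mulr_sumr -big_split.
apply: ler_sum => v _ /=; rewrite /ind.
have := disjointFr dST (x := v); move: (w_ge0 u v).
by case: (v \in S) => [h /(_ isT) -> | h _]; case: (u \in U); case: (v \in T) => /=;
   rewrite ?(mulr0, mul0r, mulr1, mul1r, addr0, add0r) //.
Qed.

(** The parallelogram identity for a quadratic form. For a swap direction the correction is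
    [4 * w i j], hence nonnegative: of two opposite swaps at least one does not decrease [q]. *)
Lemma q_parallel N (x d : 'I_n -> R) :
  q N (fun u => x u + d u) + q N (fun u => x u - d u) = 2 * q N x - 2 * bil d d.
Proof.
have massD e : mass (fun u => x u + e * d u) = mass x + e * mass d.
  by rewrite /mass mulr_sumr -big_split; apply: eq_bigr => u _ /=; ring.
have E : bil (fun u => x u + d u) (fun u => x u + d u)
       + bil (fun u => x u - d u) (fun u => x u - d u)
       = 2 * bil x x + 2 * bil d d.
  rewrite /bil -big_split !mulr_sumr -big_split; apply: eq_bigr => u _ /=.
  rewrite -big_split !mulr_sumr -big_split; apply: eq_bigr => v _ /=; ring.
have E1 : mass (fun u => x u + d u) = mass x + mass d.
  by rewrite -[mass d]mul1r -massD; apply: eq_bigr => u _; rewrite mul1r.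
have E2 : mass (fun u => x u - d u) = mass x - mass d.
  by rewrite -mulN1r -massD; apply: eq_bigr => u _; rewrite mulN1r.
rewrite /q E1 E2; move: E; lra.
Qed.

Lemma bil_swap (i j : 'I_n) : i != j ->
  bil (fun u => (u == j)%:R - (u == i)%:R) (fun u => (u == j)%:R - (u == i)%:R)
    = - 2 * w i j.
Proof.
move=> nij; rewrite /bil.
have E (f : 'I_n -> R) : \sum_u ((u == j)%:R - (u == i)%:R) * f u = f j - f i.
  under eq_bigr do rewrite mulrBl; rewrite sumrB.
  have D a : \sum_(u < n) (u == a)%:R * f u = f a.
    rewrite (bigD1 a) //= eqxx mul1r big1 ?addr0 // => u /negPf ->.
    by rewrite mul0r.
  by rewrite !D.
under eq_bigr => u _.
  under eq_bigr do rewrite -mulrA.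
  rewrite -mulr_sumr E; over.
by rewrite E !w_irr (w_sym j i); ring.
Qed.

Definition multiplicity N (J : 'I_N -> {set 'I_n}) u : R := \sum_a ind (J a) u.

Lemma eq_q N x y : x =1 y -> q N x = q N y.
Proof.
move=> e; rewrite /q /mass /bil; congr (_ * _ - _).
  by apply: eq_bigr => u _; rewrite e.
by apply: eq_bigr => u _; apply: eq_bigr => v _; rewrite !e.
Qed.

End Rounding.

Section SwapRounding.
Variables (R : realFieldType) (n : nat) (w : 'I_n -> 'I_n -> R) (M : matroid n).
Hypothesis w_ge0 : forall u v, 0 <= w u v.
Hypothesis w_sym : forall u v, w u v = w v u.
Hypothesis w_irr : forall u, w u u = 0.

(* Swap rounding: among the families maximizing [q], which is convex in the
   directions [e_j - e_i], one that maximizes the sum of the squared counts is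
   constant, since a symmetric exchange between two of its members would
   increase that sum. *)
Lemma swap_rounding N (J : 'I_N -> {set 'I_n}) s (W : {set 'I_n}) : (0 < N)%N ->
    (forall a, [/\ J a \in indep M, #|J a| = s & J a \subset W]) ->
  exists S, [/\ S \in indep M, S \subset W
    & q w N (multiplicity R J) <= N%:R ^+ 2 * cov2 w S].
Proof.
move=> N0 hJ.
pose ok (f : {ffun 'I_N -> {set 'I_n}}) :=
  [forall a, [&& f a \in indep M, #|f a| == s & f a \subset W]].
pose Q (f : {ffun 'I_N -> {set 'I_n}}) := q w N (multiplicity R f).
pose sq (f : {ffun 'I_N -> {set 'I_n}}) := \sum_u multiplicity R f u ^+ 2.
have ok0 : ok [ffun a => J a].
  by apply/forallP => a; rewrite ffunE; case: (hJ a) => -> -> ->; rewrite eqxx.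
case: (@arg_maxP _ _ _ _ ok Q ok0) => f1 okf1 max1.
have ok1 : ok f1 && (Q f1 <= Q f1) by rewrite okf1 lexx.
case: (@arg_maxP _ _ _ _ (fun f => ok f && (Q f1 <= Q f)) sq ok1) => f /andP[okf leQ] maxf.
have {}maxQ g : ok g -> Q g <= Q f by move=> /max1 h; apply: le_trans leQ.
have {}maxf g : ok g -> Q f <= Q g -> sq g <= sq f.
  by move=> og lg; apply: maxf; rewrite og (le_trans leQ).
have fP a : [/\ f a \in indep M, #|f a| = s & f a \subset W].
  by have /forallP/(_ a)/and3P[? /eqP ? ?] := okf.
have same a b : f a = f b.
  apply/eqP; rewrite eqEcard; case: (fP a) (fP b) => [ia ca sa] [ib cb sb].
  rewrite ca cb leqnn andbT; apply/subsetP => i iA; apply/negPn/negP => niB.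
  have [|j [jB njA iA' iB']] := indep_symm_exchange ia ib _ iA niB.
    by rewrite ca cb.
  have nij : i != j by apply: contraNneq njA => <-.
  have nab : a != b by apply: contraNneq niB => <-.
  pose fa := [ffun c => if c == a then j |: f a :\ i else f c].
  pose fb := [ffun c => if c == b then i |: f b :\ j else f c].
  have swapP (x y : 'I_n) (A : {set 'I_n}) : x \in A -> y \notin A -> A \subset W ->
      y \in W -> #|A| = s -> (#|y |: A :\ x| == s) && (y |: A :\ x \subset W).
    move=> xA yA sA yW cA; rewrite cardsU1 !inE (negPf yA) andbF /= -cA.
    rewrite (cardsD1 x A) xA eqxx /= subUset sub1set yW.
    by apply: subset_trans sA; apply: subsetDl.
  have okfa : ok fa.
    apply/forallP => c; rewrite ffunE; case: eqVneq => _; last by move/forallP: okf.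
    by rewrite iA' /= swapP // (subsetP sb).
  have okfb : ok fb.
    apply/forallP => c; rewrite ffunE; case: eqVneq => _; last by move/forallP: okf.
    by rewrite iB' /= swapP // (subsetP sa).
  pose d u : R := (u == j)%:R - (u == i)%:R.
  have cE g c (x y : 'I_n) : x \in f c -> y \notin f c ->
      g =1 (fun c' => if c' == c then y |: f c :\ x else f c') ->
    multiplicity R g =1 (fun u => multiplicity R f u + ((u == y)%:R - (u == x)%:R)).
    move=> xf yf gE u; rewrite /multiplicity (bigD1 c) // [in RHS](bigD1 c) //= gE eqxx.
    have -> : \sum_(k < N | k != c) ind R (g k) u = \sum_(k < N | k != c) ind R (f k) u.
      by apply: eq_bigr => k /negPf kc; rewrite gE kc.
    rewrite /ind !inE; have nyx : y != x by apply: contraNneq yf => ->. set SS := \sum_(_ < _ | _) _.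
    case: (eqVneq u y) => [->|uy]; first by rewrite (negPf nyx) (negPf yf) /=; ring.
    by case: (eqVneq u x) => [->|ux]; rewrite ?xf /=; ring.
  have cfa : multiplicity R fa =1 (fun u => multiplicity R f u + d u).
    by apply: cE iA njA _ => c; rewrite ffunE.
  have cfb : multiplicity R fb =1 (fun u => multiplicity R f u - d u).
    move=> u; rewrite (cE fb b j i) //; first by rewrite /d; ring.
    by move=> c; rewrite ffunE.
  have par : Q fa + Q fb = 2 * Q f + 4 * w i j.
    rewrite /Q (eq_q w N cfa) (eq_q w N cfb) (q_parallel w N) bil_swap //; ring.
  have sqpar : sq fa + sq fb = 2 * sq f + 2 * \sum_u d u ^+ 2.
    rewrite /sq -big_split !mulr_sumr -big_split /=; apply: eq_bigr => u _.
    by rewrite cfa cfb; ring.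
  have dpos : 0 < \sum_u d u ^+ 2.
    rewrite (bigD1 i) //= ltr_pwDl ?sumr_ge0 // => [|u _]; last exact: sqr_ge0.
    by rewrite /d eqxx (negPf nij) exprn_even_gt0 //= subr_eq0 eq_sym oner_eq0.
  (* Neither swap exceeds the maximum of [Q], and together they reach at least twice that maximum;
     so both attain it and may be compared with [f] in [sq]. There they sum to more than [2 * sq f],
     a contradiction. *)
  have := maxQ _ okfa; have := maxQ _ okfb; have := w_ge0 i j => wij Qb Qa.
  have sa' := maxf _ okfa ltac:(lra); have sb' := maxf _ okfb ltac:(lra); lra.
have a0 := Ordinal N0; exists (f a0); case: (fP a0) => iS _ sS; split=> //.
have le0 : q w N (multiplicity R J) <= Q f.
  apply: le_trans (maxQ _ ok0); rewrite le_eqVlt; apply/orP; left; apply/eqP.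
  by apply: eq_q => u; apply: eq_bigr => a _; rewrite ffunE.
apply: (le_trans le0); rewrite /Q.
have -> : q w N (multiplicity R f) = q w N (fun u => N%:R * ind R (f a0) u).
  apply: eq_q => u; rewrite /multiplicity (eq_bigr (fun=> ind R (f a0) u)).
    by rewrite sumr_const card_ord mulr_natl.
  by move=> a _; rewrite (same a a0).
rewrite /q cov2E // -massE -bilE.
have -> : mass w (fun u => N%:R * ind R (f a0) u) = N%:R * mass w (ind R (f a0)).
  by rewrite /mass mulr_sumr; apply: eq_bigr => u _; ring.
have -> : bil w (fun u => N%:R * ind R (f a0) u) (fun u => N%:R * ind R (f a0) u)
    = N%:R ^+ 2 * bil w (ind R (f a0)) (ind R (f a0)).
  rewrite /bil mulr_sumr; apply: eq_bigr => u _; rewrite mulr_sumr.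
  by apply: eq_bigr => v _; ring.
rewrite le_eqVlt; apply/orP; left; apply/eqP; ring.
Qed.

End SwapRounding.

(** * Kernels from bins in an arbitrary matroid *)

Section Kernel.
Variables (R : realFieldType) (n : nat) (w : 'I_n -> 'I_n -> R) (M : matroid n).
Hypothesis w_ge0 : forall u v, 0 <= w u v.
Hypothesis w_sym : forall u v, w u v = w v u.
Hypothesis w_irr : forall u, w u u = 0.

Lemma ind_bigcup N (I : 'I_N -> {set 'I_n}) u :
    (forall a b, a != b -> [disjoint I a & I b]) ->
  \sum_a ind R (I a) u = ind R (\bigcup_a I a) u.
Proof.
move=> dI; rewrite /ind; case: bigcupP => [[a _ ua]|nu].
  rewrite (bigD1 a) //= ua big1 ?addr0 // => b ba.
  rewrite eq_sym in ba; by rewrite (disjointFr (dI a b ba) ua).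
by rewrite big1 // => a _; case: (boolP (u \in I a)) => // ua; case: nu; exists a.
Qed.

(** Swap rounding is applied to the sets [Oin :|: I a], whose multiplicity is [N] on [Oin] and 1 on
    the union [U] of the [I a]. What remains is to compare [q] at this vector with [cov2 w O]. *)
Lemma rounding_bound N (O Oin : {set 'I_n}) (I : 'I_N -> {set 'I_n}) :
    (0 < N)%N -> Oin \subset O -> (forall a, Oin :|: I a \in indep M) ->
    (forall a, #|I a| = #|O :\: Oin|) -> (forall a, [disjoint Oin & I a]) ->
    (forall a b, a != b -> [disjoint I a & I b]) ->
    (forall a, wdegs w (O :\: Oin) <= wdegs w (I a)) ->
  exists S, [/\ S \in indep M, S \subset Oin :|: \bigcup_a I a
    & N%:R * cov2 w O <= N.+1%:R * cov2 w S].
Proof.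
move=> N0 sO iJ cI dOI dI degI; set U := \bigcup_a I a.
have [||S [iS sS qS]] := @swap_rounding R n w M w_ge0 w_sym w_irr N
    (fun a => Oin :|: I a) #|O| (Oin :|: U) => //.
  move=> a; split=> //; last by apply: setUS; apply: bigcup_sup.
  rewrite cardsU disjoint_setI0 // cards0 subn0 cI cardsD (setIidPr sO).
  by rewrite subnKC // subset_leq_card.
exists S; split=> //; have dOU : [disjoint Oin & U].
  by apply/bigcup_disjointP => a _; exact: dOI.
pose c u := N%:R * ind R Oin u + ind R U u.
have cE : multiplicity R (fun a => Oin :|: I a) =1 c.
  move=> u; rewrite /c -(ind_bigcup u dI) /multiplicity.
  have E a : ind R (Oin :|: I a) u = ind R Oin u + ind R (I a) u.
    rewrite /ind inE; case: (boolP (u \in Oin)) => [uO|_]; last by rewrite add0r.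
    by rewrite (disjointFr (dOI a)) // addr0.
  by under eq_bigr do rewrite E; rewrite big_split /= sumr_const card_ord mulr_natl.
have mc : mass w c = N%:R * wdegs w Oin + wdegs w U.
  by rewrite -!massE /mass mulr_sumr -big_split; apply: eq_bigr => u _ /=; rewrite /c; ring.
have bc : bil w c c = N%:R ^+ 2 * wbetween w Oin Oin + 2 * N%:R * wbetween w Oin U
    + wbetween w U U.
  have -> : 2 * N%:R * wbetween w Oin U
      = N%:R * wbetween w Oin U + N%:R * wbetween w U Oin.
    by rewrite -!bilE [X in _ = _ + _ * X]bil_sym //; ring.
  rewrite -!bilE /bil !mulr_sumr -!big_split; apply: eq_bigr => u _ /=.
  rewrite !mulr_sumr -!big_split; apply: eq_bigr => v _ /=; rewrite /c; ring.
have dU : N%:R * wdegs w (O :\: Oin) <= wdegs w U.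
  apply: (@le_trans _ _ (\sum_a wdegs w (I a))).
    rewrite mulr_natl -[N in leLHS]card_ord -sumr_const; exact: ler_sum.
  have -> : wdegs w U = \sum_a wdegs w (I a); last by [].
  rewrite -massE /mass; under eq_bigr do rewrite -ind_bigcup // mulr_suml.
  by rewrite exchange_big; apply: eq_bigr => a _; rewrite -massE.
have covO : cov2 w O <= cov2 w Oin + 2 * wdegs w (O :\: Oin).
  by apply: le_trans (cov2U w_ge0 w_sym _ _); apply: cov2_sub => //;
     rewrite setDE setUIr setUCr setIT subsetUr.
have := wbetween_le_wdegs w_ge0 w_sym U dOU.
have := wbetween_disjoint2 w_ge0 w_sym dOU.
have := cov2E w_sym Oin; have := wbetween_ge0 w_ge0 U U.
have := wbetween_ge0 w_ge0 Oin U.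
move: qS; rewrite (eq_q w N cE) /q mc bc -[N.+1]addn1 natrD.
move: (cov2 w Oin) (cov2 w O) (cov2 w S) (wdegs w Oin) (wdegs w U)
  (wbetween w Oin Oin) (wbetween w Oin U) (wbetween w U U)
  (wdegs w (O :\: Oin)) covO dU.
have : 1 <= N%:R :> R by rewrite ler1n.
move: N%:R => k k1 A cO cS dO d wOO x y dD covO dU qS x0 y0 AE Ax xyd.
(* Inserting [y <= d - x] and [k * dD <= d], the claim becomes [0 <= k ^+ 2 * (A - 2 * x) + (k - 1)
   * (d - x)]. The first term is nonnegative because [A] counts each edge between [Oin] and [U]
   twice, the second because [0 <= y <= d - x]. *)
have k2 : 0 < k ^+ 2 by rewrite exprn_gt0 //; lra.
rewrite -(ler_pM2l k2).
have H1 : (k + 1) * (k ^+ 2 * A + 2 * k * d - 2 * k * x - y) <= (k + 1) * (k ^+ 2 * cS).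
  rewrite ler_pM2l; last lra.
  by apply: le_trans qS; rewrite AE; lra.
have H2 : k ^+ 3 * cO <= k ^+ 3 * A + 2 * k ^+ 2 * d.
  have : k ^+ 3 * cO <= k ^+ 3 * (A + 2 * dD).
    by rewrite ler_pM2l // exprn_gt0 //; lra.
  have : k ^+ 2 * (k * dD) <= k ^+ 2 * d by rewrite ler_pM2l.
  rewrite !exprS expr0; lra.
have H3 : (k + 1) * y <= (k + 1) * (d - x) by rewrite ler_pM2l; lra.
have H4 : k ^+ 2 * (2 * x) <= k ^+ 2 * A by rewrite ler_pM2l.
have H5 : (k - 1) * x <= (k - 1) * d by apply: ler_wpM2l; lra.
move: H1 H2 H3 H4 H5; rewrite !exprS expr0; lra.
Qed.

(** The hypothesis on vertices outside the bins is what first fit leaves behind: such a vertex is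
    spanned in every bin by members of at least its own degree. *)
Lemma kernel_of_bins m (B : 'I_m -> {set 'I_n}) (O : {set 'I_n}) :
    (0 < m)%N -> (forall j, B j \in indep M) ->
    (forall i j, i != j -> [disjoint B i & B j]) ->
    (forall j v, v \notin \bigcup_j B j ->
       v |: [set u in B j | wdeg w v <= wdeg w u] \notin indep M) ->
    O \in indep M ->
  exists S, [/\ S \in indep M, S \subset \bigcup_j B j
    & m%:R * cov2 w O <= m.+1%:R * cov2 w S].
Proof.
move=> m0 iB dB nB iO; set V := \bigcup_j B j.
(* Induction on [X]: one more vertex [o] of [X] is traded for some [z] in bin [j] of at least its
   degree. The replacements for different [j] are disjoint because the bins are. *)
have step j (X : {set 'I_n}) : X \subset O :\: V -> exists I : {set 'I_n},
    [/\ I \subset B j :\: O, #|I| = #|X|, (O :\: X) :|: I \in indep M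
      & wdegs w X <= wdegs w I].
  have [k] := ubnP #|X|; elim: k X => // k IH X; rewrite ltnS => leX sX.
  have [->|[o oX]] := set_0Vmem X.
    by exists set0; rewrite setD0 setU0 sub0set.
  have cX := cardsD1 o X; rewrite oX /= add1n in cX.
  have [||I [sI cI iI dI]] := IH (X :\ o); first by rewrite -cX.
    by apply: subset_trans sX; apply: subsetDl.
  have [oV oO] : o \notin V /\ o \in O.
    by have := subsetP sX _ oX; rewrite inE => /andP[].
  set C := O :\: (X :\ o) :|: I.
  set P := [set u in B j | wdeg w o <= wdeg w u].
  have sPB : P \subset B j by apply/subsetP => u; rewrite inE => /andP[].
  have sBV : B j \subset V by apply: bigcup_sup.
  have iP : P \in indep M by apply: indep_sub (iB j).
  have oC : o \in C by rewrite !inE eqxx oO.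
  have oP : o \notin P by apply: contra oV => /(subsetP sPB)/(subsetP sBV).
  have [z [zP zC iz]] := indep_trade iI iP oC oP (nB j o oV).
  have [zB dz] : z \in B j /\ wdeg w o <= wdeg w z.
    by move: zP; rewrite inE => /andP.
  have zV := subsetP sBV _ zB.
  have zX : z \notin X by apply: contraTN zV => /(subsetP sX); rewrite inE => /andP[].
  have [zO zI] : z \notin O /\ z \notin I.
    by move: zC; rewrite !inE negb_or (negPf zX) andbF /= => /andP.
  have oI : o \notin I by apply/negP => /(subsetP sI); rewrite inE oO.
  exists (z |: I); split.
  - by rewrite subUset sI sub1set inE zO zB.
  - by rewrite cardsU1 zI cI cX.
  - apply: indep_sub iz; rewrite subUset; apply/andP; split; apply/subsetP => x.
      rewrite !inE => /andP[xX xO]; rewrite xO (negPf xX) !andbF /=.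
      by rewrite (contraNneq _ xX) ?orbT // => ->.
    rewrite !inE => /orP[->//|xI]; rewrite xI !orbT andbT.
    by rewrite (contraNneq _ oI) ?orbT // => <-.
  - rewrite /wdegs (big_setD1 o) //= [leRHS](big_setD1 z) ?inE ?eqxx //=.
    rewrite (_ : (z |: I) :\ z = I); first exact: lerD.
    by rewrite setU1K.
have /fin_all_exists [I hI] : forall j : 'I_m, exists I : {set 'I_n},
    [/\ I \subset B j :\: O, #|I| = #|O :\: V|, (O :\: (O :\: V)) :|: I \in indep M
      & wdegs w (O :\: V) <= wdegs w I].
  by move=> j; apply: step.
have sI j : I j \subset B j by have [s _ _ _] := hI j; apply: subset_trans s (subsetDl _ _).
have [||||||S [iS sS cS]] := @rounding_bound m O (O :&: V) I m0.
- exact: subsetIl.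
- by move=> j; have [_ _ + _] := hI j; rewrite setDDr setDv set0U.
- by move=> j; have [_ -> _ _] := hI j; rewrite setDIr setDv set0U.
- move=> j; have [s _ _ _] := hI j; rewrite -setI_eq0; apply/eqP/setP => x.
  rewrite !inE; apply/negP => /andP[/andP[xO _] /(subsetP s)].
  by rewrite inE xO.
- move=> i j nij; apply: disjointWl (sI i) _; apply: disjointWr (sI j) _; exact: dB.
- by move=> j; have [_ _ _] := hI j; rewrite setDIr setDv set0U.
exists S; split=> //; apply: subset_trans sS _; rewrite subUset subsetIr.
by apply/bigcupsP => j _; apply: subset_trans (sI j) (bigcup_sup _ _).
Qed.

End Kernel.

(** * Kernels from groups in a transversal matroid *)

Section Transversal.
Variables (R : realFieldType) (n : nat) (w : 'I_n -> 'I_n -> R) (M : matroid n).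
Hypothesis w_ge0 : forall u v, 0 <= w u v.
Hypothesis w_sym : forall u v, w u v = w v u.
Hypothesis w_irr : forall u, w u u = 0.
Variables (k : nat) (F : 'I_k -> {set 'I_n}).
Hypothesis tM : transversal_matroid M F.

(** A matching as a partial function on all vertices can be restricted and patched, unlike an
    injection from the subtype of [S]. *)
Lemma transversal_indepP (S : {set 'I_n}) :
  S \in indep M <-> exists f : 'I_n -> option 'I_k,
    {in S &, injective f} /\
    {in S, forall u, exists2 i, f u = Some i & u \in F i}.
Proof.
split=> [/tM[phi injphi phiF]|[f [injf fF]]].
  exists (fun u => omap phi (insub u)); split=> [u v uS vS|u uS].
    by rewrite !insubT => -[/injphi/(congr1 val)].
  by rewrite insubT; exists (phi (Sub u uS)) => //; have := phiF (Sub u uS).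
apply/tM.
have /fin_all_exists [phi hphi] : forall u : {u | u \in S}, exists i,
    f (val u) = Some i /\ val u \in F i.
  by move=> [u uS] /=; have [i ? ?] := fF u uS; exists i.
exists phi => [u v euv|u]; last by have [] := hphi u.
apply: val_inj; apply: injf; rewrite ?(valP u) ?(valP v) //.
by have [-> _] := hphi u; have [-> _] := hphi v; rewrite euv.
Qed.

(** Let [o] in [O] be outside the groups and matched to [i]. Then [T i] misses [o], hence meets [O]
    in at most [k - 1] elements, so [m] of its [m + k - 1] elements lie outside [O]. Any of these
    can take over the index [i], and no matching has to be recomputed. *)
Lemma kernel_of_groups m (T : 'I_k -> {set 'I_n}) (O : {set 'I_n}) :
    (0 < m)%N -> (#|O| <= k)%N -> (forall i, T i \subset F i) ->
    (forall i j, i != j -> [disjoint T i & T j]) ->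
    (forall i v, v \notin \bigcup_j T j -> v \in F i ->
       (m + k - 1 <= #|T i|)%N /\ forall u, u \in T i -> wdeg w v <= wdeg w u) ->
    O \in indep M ->
  exists S, [/\ S \in indep M, S \subset \bigcup_j T j
    & m%:R * cov2 w O <= m.+1%:R * cov2 w S].
Proof.
move=> m0 leOk sTF dT nT iO; set V := \bigcup_j T j.
have [f [injf fF]] := (transversal_indepP O).1 iO.
pose grp o := if f o is Some i then T i :\: O else set0.
have grpP o : o \in O :\: V -> exists i,
    [/\ f o = Some i, grp o = T i :\: O, (m <= #|grp o|)%N
      & forall u, u \in T i -> wdeg w o <= wdeg w u].
  rewrite inE => /andP[oV oO]; have [i fo oF] := fF o oO; exists i.
  have [cT dTo] := nT i o oV oF; rewrite /grp fo; split=> //.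
  have oT : o \notin T i by apply: contra oV => oT; apply/bigcupP; exists i.
  have := subset_leq_card (_ : T i :&: O \subset O :\ o).
  have cO := cardsD1 o O; rewrite oO in cO.
  move/(_ _)/wrap => [|h]; last by rewrite cardsD; lia.
  apply/subsetP => x; rewrite !inE => /andP[xT ->]; rewrite andbT.
  by apply: contraNneq oT => <-.
(* The [a]-th element of the group of [o] replaces [o] in the [a]-th set. Distinct [o] have distinct
   matched indices, hence disjoint groups, so all these picks are distinct. *)
pose pick_ a o := nth o (enum (grp o)) a.
have pick_grp (a : 'I_m) o : o \in O :\: V -> pick_ a o \in grp o.
  by move=> /grpP[i [_ _ lem _]]; rewrite -mem_enum mem_nth // -cardE (leq_trans _ lem).
have pickT (a : 'I_m) o : o \in O :\: V ->
    exists i, [/\ f o = Some i, pick_ a o \in T i, pick_ a o \notin O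
                & wdeg w o <= wdeg w (pick_ a o)].
  move=> oV; have := pick_grp a _ oV; have [i [fo -> _ dTo]] := grpP o oV.
  by rewrite inE => /andP[pO pT]; exists i; rewrite dTo.
have Tuniq i j u : u \in T i -> u \in T j -> i = j.
  move=> ui uj; apply/eqP/negPn/negP => /dT d.
  by rewrite (disjointFr d) in uj.
have pick_inj (a b : 'I_m) o o' : o \in O :\: V -> o' \in O :\: V ->
    pick_ a o = pick_ b o' -> o = o'.
  move=> oV oV' e; have [i [fo pi _ _]] := pickT a o oV.
  have [j [fo' pj _ _]] := pickT b o' oV'; rewrite e in pi.
  move: oV oV'; rewrite !inE => /andP[_ oO] /andP[_ oO'].
  by apply: injf => //; rewrite fo fo' (Tuniq _ _ _ pi pj).
pose I (a : 'I_m) := [set pick_ a o | o in O :\: V].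
have IP a x : x \in I a -> exists2 o, o \in O :\: V & x = pick_ a o.
  by case/imsetP => o; exists o.
have sIV a : I a \subset V.
  apply/subsetP => _ /IP[o oV ->]; have [i [_ pT _ _]] := pickT a o oV.
  by apply/bigcupP; exists i.
have [||||||S [iS sS cS]] :=
  @rounding_bound R n w M w_ge0 w_sym w_irr m O (O :&: V) I m0.
- exact: subsetIl.
- move=> a; apply/transversal_indepP.
  (* Vertices of [O] keep their index; a replacement gets the index of its group, which is the one
     that the replaced vertex has freed. *)
  pose g x := if x \in O then f x else [pick i | x \in T i].
  have gI o : o \in O :\: V -> g (pick_ a o) = f o /\ pick_ a o \notin O.
    move=> oV; have [i [fo pT pO _]] := pickT a o oV.
    rewrite /g (negPf pO) fo; case: pickP => [j pj|/(_ i)]; last by rewrite pT.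
    by rewrite (Tuniq _ _ _ pT pj).
  exists g; split=> [x y|x].
    rewrite !in_setU => hx hy.
    have hU z : (z \in O :&: V) || (z \in I a) ->
       (z \in O /\ z \in V) \/ exists2 o, o \in O :\: V & z = pick_ a o.
      by case/orP => [/setIP|/IP]; [left|right].
    case: (hU _ hx) => [[xO xV]|[o oV ex]]; case: (hU _ hy) => [[yO yV]|[o' oV' ey]].
    - by rewrite /g xO yO; apply: injf.
    - rewrite ey; have [-> _] := gI o' oV'; rewrite /g xO => e.
      move: oV'; rewrite inE => /andP[nV oO].
      by move: nV; rewrite -(injf _ _ xO oO e) xV.
    - rewrite ex; have [-> _] := gI o oV; rewrite /g yO => e.
      move: oV; rewrite inE => /andP[nV oO].
      by move: nV; rewrite (injf _ _ oO yO e) yV.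
    - rewrite ex ey; have [-> _] := gI o oV; have [-> _] := gI o' oV' => e.
      move: (oV) (oV') hx hy; rewrite !inE => /andP[oVn oO] /andP[oVn' oO'] hx hy.
      by have eo := injf _ _ oO oO' e; rewrite eo.
  case/setUP => [/setIP[xO _]|/IP[o oV ->]]; first by rewrite /g xO; apply: fF.
  have [-> _] := gI o oV; have [i [fo pT _ _]] := pickT a o oV.
  by exists i => //; apply: subsetP pT.
- move=> a; rewrite setDIr setDv set0U card_in_imset //.
  by move=> o o' oV oV'; apply: pick_inj.
- move=> a; rewrite -setI_eq0; apply/eqP/setP => x; rewrite !inE.
  apply/negP => /andP[/andP[xO _] /IP[o oV ex]].
  by have [i [_ _ ]] := pickT a o oV; rewrite -ex xO.
- move=> a b nab; rewrite -setI_eq0; apply/eqP/setP => x; rewrite !inE.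
  apply/negP => /andP[/IP[o oV ex] /IP[o' oV' ex']].
  have eo : o = o' by apply: (pick_inj a b) => //; rewrite -ex.
  move: ex'; rewrite ex -eo /pick_ => /eqP.
  have [i [_ _ lem _]] := grpP o oV.
  rewrite nth_uniq ?enum_uniq -?cardE ?(leq_trans _ lem) //.
  by move=> /eqP/val_inj ab; rewrite ab eqxx in nab.
- move=> a; rewrite setDIr setDv set0U /wdegs big_imset /=.
    by apply: ler_sum => o oV; have [i []] := pickT a o oV.
  by move=> o o' oV oV'; apply: pick_inj.
exists S; split=> //; apply: subset_trans sS _; rewrite subUset subsetIr.
by apply/bigcupsP => a _.
Qed.

End Transversal.

(** * From degree sums to covered weight *)

Section Graph.
Variables (R : realFieldType) (n : nat) (G : wgraph R n).

Definition wmx (u v : 'I_n) : R :=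
  if [set u; v] \in edges G then weight G [set u; v] else 0.

Lemma wmx_ge0 u v : 0 <= wmx u v.
Proof. by rewrite /wmx; case: ifP => // /weight_ge0. Qed.

Lemma wmx_sym u v : wmx u v = wmx v u.
Proof. by rewrite /wmx setUC. Qed.

Lemma wmx_irr u : wmx u u = 0.
Proof.
by rewrite /wmx setUid; case: ifP => // /(edges_card2); rewrite cards1.
Qed.

Lemma cov2_covered S : cov2 wmx S = 2 * covered G S.
Proof.
rewrite /cov2 pair_big /=.
under eq_bigr => p _.
  rewrite (_ : (if _ then _ else _) =
    if ([set p.1; p.2] \in edges G) && ([set p.1; p.2] :&: S != set0)
      then weight G [set p.1; p.2] else 0); last first.
    rewrite /wmx andbC; have -> : ([set p.1; p.2] :&: S != set0)
      = (p.1 \in S) || (p.2 \in S).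
      rewrite setIUl setU_eq0 negb_and.
      have E x : ([set x] :&: S != set0) = (x \in S).
        by rewrite setI_eq0 disjoints1 negbK.
      by rewrite !E.
    by case: ifP => // ->; rewrite ?andbF.
  over.
rewrite -big_mkcond /=.
rewrite (partition_big (fun p : 'I_n * 'I_n => [set p.1; p.2])
  [pred e | (e \in edges G) && (e :&: S != set0)]) //=.
rewrite /covered mulr_sumr; apply: eq_bigr => e /andP[eG eS].
have /eqP/cards2P[a [b [nab eE]]] := edges_card2 eG.
(* Exactly the two orientations of the edge have [e] as their set of endpoints. *)
rewrite (eq_bigl (fun p => (p == (a, b)) || (p == (b, a)))); last first.
  move=> [x y] /=; rewrite !xpair_eqE; apply/andP/orP => [[_ /eqP e2]|].
    have hx : x \in e by rewrite -e2 !inE eqxx.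
    have hy : y \in e by rewrite -e2 !inE eqxx orbT.
    have ha : a \in [set x; y] by rewrite e2 eE !inE eqxx.
    have hb : b \in [set x; y] by rewrite e2 eE !inE eqxx orbT.
    move: hx hy ha hb; rewrite eE !inE.
    move=> /orP[]/eqP-> /orP[]/eqP->; rewrite ?eqxx ?orbT; auto.
      by rewrite [b == a]eq_sym (negPf nab) => _ /orP[].
    by rewrite (negPf nab) => /orP[].
  by case=> /andP[/eqP-> /eqP->]; rewrite ?[[set b; a]]setUC -eE eG eS eqxx.
rewrite (bigD1 (a, b)) ?eqxx //= (bigD1 (b, a)) /=; last first.
  by rewrite eqxx orbT xpair_eqE eq_sym (negPf nab).
rewrite big1 => [|[x y] /andP[/andP[]]]; last by move=> /orP[->|->]; rewrite ?andbF.
by rewrite [[set b; a]]setUC -eE addr0 mulr_natl mulr2n.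
Qed.

Lemma covered_ge0 S : 0 <= covered G S.
Proof. by apply: sumr_ge0 => e /andP[/weight_ge0]. Qed.

Lemma opt_attained (M : matroid n) : exists2 O, O \in indep M & opt G M = covered G O.
Proof.
rewrite /opt; elim/big_ind: _ => [|x y [A iA ->] [B iB ->]|O iO].
- exists set0; first exact: indep0.
  by rewrite /covered big1 // => e; rewrite setI0 eqxx andbF.
- by rewrite /Num.max; case: ifP => _; [exists B|exists A].
- by exists O.
Qed.

Lemma opt_ge0 (M : matroid n) : 0 <= opt G M.
Proof. by have [O _ ->] := opt_attained M; exact: covered_ge0. Qed.

(* The ratio [m / (m + 1)], sharper than [1 - 1 / m], makes it harmless to
   round [1 / eps] down to [m]. *)
Lemma approx_of_ratio (M : matroid n) eps m S O :
    S \in indep M -> opt G M = covered G O -> 1 < m.+1%:R * eps ->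
    m%:R * cov2 wmx O <= m.+1%:R * cov2 wmx S ->
  approx_solution G M eps S.
Proof.
move=> iS optO m1; rewrite !cov2_covered -optO => h; split=> //.
have := opt_ge0 M; move: (opt G M) h => o h o0.
have mp : 0 < m.+1%:R :> R by rewrite ltr0n.
rewrite -(ler_pM2l mp); move: h m1 mp; rewrite -[m.+1]addn1 natrD.
move: (m%:R : R) (covered G S) => a c h m1 mp.
have : 0 <= ((a + 1) * eps - 1) * o by rewrite mulr_ge0 // subr_ge0 ltW.
lra.
Qed.

End Graph.

Local Close Scope ring_scope.

(** * The kernel programs *)

(* Natural number tables: 4 bin + 1 of each vertex (0 if unplaced), 10 m,
   12 degree ranks, 13 the current set, 14 its feasibility, 15 counter,
   16 number of bins, 17 bin capacity, 18 and 19 list of the kernel and its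
   length, 20-24 loop variables, 30 digits of the current word, 31 base,
   32 word length, 33 carry, 34 position, 35 best set.
   Weight tables: 10 m * eps, 11 degrees, 12 weight of the current set,
   13 best weight. *)
Definition p_m : prog :=
  Seq (setn 10 (NCst 0)) (Seq (WSet 10 (NCst 0) (NCst 0) WZero)
  (For 20 0 0 (If (WLe (WAdd (WGet 10 (NCst 0) (NCst 0)) (WGet 0 (NCst 0) (NCst 0))) WOne)
    (Seq (WSet 10 (NCst 0) (NCst 0) (WAdd (WGet 10 (NCst 0) (NCst 0)) (WGet 0 (NCst 0) (NCst 0))))
         (incr 10)) Skip))).

Definition p_deg : prog :=
  For 20 0 0 (Seq (WSet 11 (sc 20) (NCst 0) WZero)
   (For 21 0 0 (WSet 11 (sc 20) (NCst 0)
      (WAdd (WGet 11 (sc 20) (NCst 0)) (WGet 1 (sc 20) (sc 21)))))).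

Definition p_rank : prog :=
  For 20 0 0 (Seq (NSet 12 (sc 20) (NCst 0) (NCst 0))
   (For 21 0 0 (If (WLe (WGet 11 (sc 21) (NCst 0)) (WGet 11 (sc 20) (NCst 0))) Skip
      (NSet 12 (sc 20) (NCst 0) (NAdd (NGet 12 (sc 20) (NCst 0)) (NCst 1)))))).

Definition p_chkL : prog :=
  Seq (setn 14 (NCst 1))
  (For 23 0 1 (Seq (setn 15 (NCst 0)) (Seq
    (For 24 0 0 (If (TAnd (TNz (NGet 13 (sc 24) (NCst 0))) (TNz (NGet 2 (sc 23) (sc 24))))
       (incr 15) Skip))
    (If (NLe (sc 15) (NGet 3 (sc 23) (NCst 0))) Skip (setn 14 (NCst 0)))))).

Definition p_chkT : prog :=
  Seq (setn 14 (NCst 1)) (Seq (setn 15 (NCst 0)) (Seq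
  (For 24 0 0 (If (TNz (NGet 13 (sc 24) (NCst 0)))
     (Seq (incr 15) (If (TNz (NGet 2 (sc 22) (sc 24))) Skip (setn 14 (NCst 0)))) Skip))
  (If (NLe (sc 15) (sc 17)) Skip (setn 14 (NCst 0))))).

Definition p_fill : prog :=
  For 24 0 0 (If (TOr (TEq (NGet 4 (sc 24) (NCst 0)) (NAdd (sc 22) (NCst 1)))
                      (TEq (sc 24) (sc 21)))
    (NSet 13 (sc 24) (NCst 0) (NCst 1)) (NSet 13 (sc 24) (NCst 0) (NCst 0))).

Definition p_chk (lam : bool) := if lam then p_chkL else p_chkT.

Definition p_place lam : prog :=
  For 22 16 0 (If (TNz (NGet 4 (sc 21) (NCst 0))) Skip
    (Seq p_fill (Seq (p_chk lam) (If (TNz (sc 14))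
       (NSet 4 (sc 21) (NCst 0) (NAdd (sc 22) (NCst 1))) Skip)))).

Definition p_ff lam : prog :=
  For 20 0 0 (For 21 0 0
    (If (TEq (NGet 12 (sc 21) (NCst 0)) (sc 20)) (p_place lam) Skip)).

Ltac nrm := rewrite /sc /setn /incr /TNz /TLt /TOr /TEq /upd /=.
Ltac st := repeat lazymatch goal with
  | |- ok _ (Seq _ _) _ _ => apply: ok_seq
  | |- ok _ (NSet _ _ _ _) _ _ => apply: ok_nset
  | |- ok _ (setn _ _) _ _ => apply: ok_nset
  | |- ok _ (incr _) _ _ => apply: ok_nset
  | |- ok _ (WSet _ _ _ _) _ _ => apply: ok_wset
  | |- ok _ Skip _ _ => apply: ok_skip
  end.

Lemma table_ofE T m n (d : T) f (u : 'I_m) (v : 'I_n) : table_of d f u v = f u v.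
Proof. by rewrite /table_of !valK. Qed.

Lemma sum_nat_card n (P : nat -> bool) (A : {set 'I_n}) :
  (forall u : 'I_n, (u \in A) = P u) -> (\sum_(0 <= u < n) P u = #|A|)%N.
Proof.
move=> h; rewrite big_mkord -sum1_card [RHS]big_mkcond /=.
by apply: eq_bigr => u _; rewrite h; case: (P u).
Qed.

Local Open Scope ring_scope.

Section Spec.
Variables (R : realFieldType) (n r : nat) (G : wgraph R n).
Variables (F : 'I_r -> {set 'I_n}) (b : 'I_r -> nat) (eps : R) (K : nat).
Hypothesis nK : (n <= K)%N.
Hypothesis rK : (r <= K)%N.
Implicit Types s : state R.

Definition has_input s :=
  (forall x, (x < 4)%N -> ntab s x = ntab (input G eps F b) x) /\
  (forall x, (x < 2)%N -> wtab s x = wtab (input G eps F b) x).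

Lemma has_input_frame p s s' : frame p s s' ->
  all (leq 4) (nmods p) && all (leq 2) (wmods p) -> has_input s -> has_input s'.
Proof.
move=> [fn fw] /andP[/allP hn /allP hw] [in1 in2]; split=> x lx.
  by rewrite fn ?in1 //; apply: contraL lx => /hn; rewrite -leqNgt.
by rewrite fw ?in2 //; apply: contraL lx => /hw; rewrite -leqNgt.
Qed.

Lemma in_n s : has_input s -> ntab s 0 0 0 = n.
Proof. by case=> -> // _. Qed.

Lemma in_r s : has_input s -> ntab s 0 0 1 = r.
Proof. by case=> -> // _. Qed.

Lemma in_F s (i : 'I_r) (u : 'I_n) : has_input s -> ntab s 2 i u = (u \in F i).
Proof. by case=> -> // _; rewrite /= table_ofE. Qed.

Lemma in_b s (i : 'I_r) : has_input s -> ntab s 3 i 0 = b i.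
Proof. by case=> -> // _; rewrite /= -[0%N]/(val (@ord0 0)) table_ofE. Qed.

Lemma in_w s (u v : 'I_n) : has_input s -> wtab s 1 u v = wmx G u v.
Proof. by case=> _ -> //; rewrite /= table_ofE. Qed.

Lemma in_eps s : has_input s -> wtab s 0 0 0 = eps.
Proof. by case=> _ -> //. Qed.

(** The loop computing [m] stops after [n] rounds, so [m] is only known to be the floor of [1 / eps]
    when [m < n]. The cap is harmless: a vertex left outside the kernel forces [m < n]. *)
Definition is_floor m := [/\ (m <= n)%N, m%:R * eps <= 1 & (m < n)%N -> 1 < m.+1%:R * eps].

Lemma p_mP s : has_input s -> ok K p_m s (fun s' => is_floor (ntab s' 10 0 0)).
Proof.
move=> hi; rewrite /p_m; st.
apply: (ok_for (Inv := fun i s' => [/\ wtab s' 10 0 0 = (ntab s' 10 0 0)%:R * eps,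
   (ntab s' 10 0 0 <= i)%N, (ntab s' 10 0 0)%:R * eps <= 1 &
   (ntab s' 10 0 0 < i)%N -> 1 < (ntab s' 10 0 0).+1%:R * eps])) => //=.
- by rewrite /upd /= (in_n hi).
- by nrm; rewrite mul0r; split=> //; rewrite ler01.
- move=> i s1 iN [fn fw] ei [hw hm h1 hlt].
  have e0 : wtab s1 0 0 0 = eps by rewrite fw // /upd /= in_eps.
  apply: ok_if => /=; rewrite e0 hw => hle; st; nrm.
    have E : (ntab s1 10 0 0).+1%:R * eps = (ntab s1 10 0 0)%:R * eps + eps.
      by rewrite -[_.+1]addn1 natrD mulrDl mul1r.
    rewrite e0 hw addn1 E; split=> //.
    have mi : ntab s1 10 0 0 = i.
      apply/eqP; rewrite eqn_leq hm leqNgt; apply/negP => /hlt; rewrite E; lra.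
    by rewrite mi ltnn.
  rewrite hw; split=> //; first exact: leqW.
  move=> _; rewrite -[_.+1]addn1 natrD mulrDl mul1r; lra.
- rewrite /upd /= (in_n hi) => s' _ [_ h2 h3 h4]; split=> //.
Qed.

Definition dg (u : 'I_n) : R := wdeg (wmx G) u.

Lemma p_degP s : has_input s -> ok K p_deg s (fun s' => forall u : 'I_n, wtab s' 11 u 0 = dg u).
Proof.
move=> hi; rewrite /p_deg; apply: (ok_for (Inv := fun i s' =>
   forall u : 'I_n, (u < i)%N -> wtab s' 11 u 0 = dg u)) => //=.
- by rewrite (in_n hi).
- rewrite (in_n hi) => i s1 iN fr ei hw; st.
  have hi1 : has_input s1 by apply: has_input_frame fr _ hi.
  set s2 := State _ _.
  have e20 : ntab s2 20 0 0 = i by [].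
  apply: (ok_for (Inv := fun j s' => (forall u : 'I_n, (u < i)%N -> wtab s' 11 u 0 = dg u) /\
     wtab s' 11 i 0 = \sum_(0 <= v < j) wtab s2 1 i v)) => //=.
  + by rewrite (in_n hi1).
  + by rewrite big_geq //; split=> [u ui|]; rewrite /s2 /upd /= ?ei ?eqxx // (ltn_eqF ui) hw.
  + move=> j s3 jN [fn fw] ej [h1 h2]; st; rewrite /= /upd /=.
    have -> : ntab s3 20 0 0 = i by rewrite fn.
    rewrite ej; split=> [u ui|]; first by rewrite (ltn_eqF ui) /= h1.
    by rewrite eqxx /= h2 big_nat_recr //= fw.
  + move=> s3 [fn fw] [h1 h2] u; rewrite ltnS leq_eqVlt => /orP[/eqP ui|]; last exact: h1.
    rewrite ui h2 (in_n hi1) big_mkord; apply: eq_bigr => v _.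
    by rewrite -ui; exact: (in_w u v hi1).
- by rewrite (in_n hi) => s' fr h u; apply: h.
Qed.

(** Counting replaces sorting. Vertices of equal degree share a rank, and the scan makes one sweep
    over all vertices for each possible rank. *)
Definition rk (u : 'I_n) : nat := #|[set x | dg u < dg x]|.

Lemma rk_lt u : (rk u < n)%N.
Proof.
rewrite -[ltnRHS]card_ord -cardsT; apply/proper_card/properP.
by split; [apply: subsetT | exists u; rewrite ?inE ?ltxx].
Qed.

Lemma rk_le u v : (rk u <= rk v)%N -> dg v <= dg u.
Proof.
rewrite leNgt; apply: contraTN => ltuv; rewrite -ltnNge.
apply/proper_card/properP; split; last by exists v; rewrite !inE ?ltxx.
by apply/subsetP => x; rewrite !inE; apply: lt_trans.
Qed.

Lemma p_rankP s : has_input s -> (forall u : 'I_n, wtab s 11 u 0 = dg u) ->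
  ok K p_rank s (fun s' => forall u : 'I_n, ntab s' 12 u 0 = rk u).
Proof.
move=> hi hdeg; rewrite /p_rank; apply: (ok_for (Inv := fun i s' =>
   forall u : 'I_n, (u < i)%N -> ntab s' 12 u 0 = rk u)) => //=.
- by rewrite (in_n hi).
- rewrite (in_n hi) => i s1 iN fr ei hw; st.
  set s2 := State _ _.
  have e0 : ntab s2 0 0 0 = n by rewrite -(in_n hi) -(proj1 fr).
  have e20 : ntab s2 20 0 0 = i by [].
  apply: (ok_for (Inv := fun j s' => (forall u : 'I_n, (u < i)%N -> ntab s' 12 u 0 = rk u) /\
     ntab s' 12 i 0 = (\sum_(0 <= v < j) (wtab s 11 i 0 < wtab s 11 v 0)%R)%N)) => //=.
  + exact: leq_trans (eq_leq e0) nK.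
  + by rewrite big_geq //; split=> [u ui|]; rewrite /s2 /upd /= ?ei ?eqxx // (ltn_eqF ui) hw.
  + move=> j s3 jN [fn fw] ej [h1 h2].
    have e3 : ntab s3 20 0 0 = i by rewrite fn.
    have ew : wtab s3 11 = wtab s 11 by rewrite fw //= (proj2 fr).
    apply: ok_if => /=; rewrite ew ej e3 => hle; st; rewrite /= /upd /=.
      by split=> //; rewrite h2 big_nat_recr //= ltNge hle addn0.
    rewrite e3 eqxx /=; split=> [u ui|]; first by rewrite (ltn_eqF ui) /= h1.
    by rewrite eqxx /= h2 big_nat_recr //= ltNge hle.
  + move=> s3 [fn fw] [h1 h2] u; rewrite ltnS leq_eqVlt => /orP[/eqP ui|]; last exact: h1.
    rewrite /upd /= ui h2 (_ : upd _ _ _ _ _ _ _ _ = n); last exact: e0.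
    by rewrite -ui; apply: sum_nat_card => v; rewrite inE !hdeg.
- by rewrite (in_n hi) => s' fr h u; apply: h.
Qed.


Lemma has_input_upd s x i j a : has_input s -> (4 <= x)%N ->
  has_input (State (upd (ntab s) x i j a) (wtab s)).
Proof.
move=> [h1 h2] lx; split=> // y ly; rewrite -h1 //= /upd.
by rewrite (ltn_eqF (leq_trans ly lx)).
Qed.

Lemma has_input_wupd s x i j a : has_input s -> (2 <= x)%N ->
  has_input (State (ntab s) (upd (wtab s) x i j a)).
Proof.
move=> [h1 h2] lx; split=> // y ly; rewrite -h2 //= /upd.
by rewrite (ltn_eqF (leq_trans ly lx)).
Qed.

Definition tset x s : {set 'I_n} := [set u : 'I_n | ntab s x u 0 != 0%N].

Definition goodL (B : {set 'I_n}) := [forall i, #|B :&: F i| <= b i]%N.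

Lemma p_chkLP s : has_input s ->
  ok K p_chkL s (fun s' => (ntab s' 14 0 0 != 0%N) = goodL (tset 13 s)).
Proof.
move=> hi; rewrite /p_chkL; st; set s2 := State _ _.
have hi2 : has_input s2 by apply: has_input_upd.
have fl2 : ntab s2 14 0 0 = 1%N by [].
have e13 : ntab s2 13 = ntab s 13 by [].
clearbody s2; pose B := tset 13 s.
apply: (ok_for (Inv := fun i s' => (ntab s' 14 0 0 != 0%N) =
   [forall i' : 'I_r, (i' < i)%N ==> (#|B :&: F i'| <= b i')%N])).
- by rewrite (in_r hi2).
- by [].
- by [].
- by rewrite /= /upd /= fl2; apply/esym/forallP.
- rewrite (in_r hi2) => i s3 iN fr ei hI; st; set s4 := State _ _.
  have hi3 : has_input s3 by apply: has_input_frame fr _ hi2.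
  have hi4 : has_input s4 by apply: has_input_upd.
  have e14 : ntab s4 14 = ntab s3 14 by [].
  have e23 : ntab s4 23 0 0 = i by [].
  have e413 : ntab s4 13 = ntab s 13 by rewrite -e13 -(proj1 fr 13).
  have e15 : ntab s4 15 0 0 = 0%N by [].
  clearbody s4.
  apply: (ok_for (Inv := fun u s' => ntab s' 15 0 0 =
    (\sum_(0 <= x < u) ((ntab s 13 x 0 != 0) && (ntab s4 2 i x != 0)))%N)).
  + by rewrite (in_n hi4).
  + by [].
  + by [].
  + by rewrite big_geq //= /upd /= e15.
  + rewrite (in_n hi4) => u s5 uN [fn fw] eu h15.
    apply: ok_if => /=; rewrite !lt0n eu !fn // e413 e23 => hc; st; nrm.
      by rewrite h15 big_nat_recr //= hc.
    by rewrite h15 big_nat_recr //= (negPf hc) addn0.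
  + rewrite (in_n hi4) => s6 [fn fw] h15.
    pose io := Ordinal iN.
    have cE : ntab s6 15 0 0 = #|B :&: F io|.
      rewrite h15; apply: sum_nat_card => u; rewrite !inE.
      by rewrite (in_F io u hi4); case: (u \in F io).
    have bE : ntab s6 3 i 0 = b io by rewrite fn // (in_b io hi4).
    have step : [forall i' : 'I_r, (i' < i.+1)%N ==> (#|B :&: F i'| <= b i')%N] =
      (ntab s3 14 0 0 != 0%N) && (#|B :&: F io| <= b io)%N.
      rewrite hI; apply/forallP/andP => [h|[/forallP h1 h2] i'].
        split; last by have := h io; rewrite ltnSn.
        by apply/forallP => i'; apply/implyP => li; have := h i'; rewrite ltnS ltnW.
      apply/implyP; rewrite ltnS leq_eqVlt => /orP[/eqP e|li].
        by have -> : i' = io by apply: val_inj.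
      by have := h1 i'; rewrite li.
    have e14' : ntab s6 14 0 0 = ntab s3 14 0 0 by rewrite fn // e14.
    have e23' : ntab s6 23 0 0 = i by rewrite fn.
    apply: ok_if => /=; rewrite e23' bE cE => hc; st; nrm; rewrite step.
      by rewrite e14' hc andbT.
    by rewrite (negPf hc) andbF.
- rewrite (in_r hi2) => s' _ ->; apply: eq_forallb => i.
  by rewrite ltn_ord.
Qed.

Definition goodT cap (j : nat) (B : {set 'I_n}) :=
  (#|B| <= cap)%N && [forall u in B, [forall i : 'I_r, (val i == j) ==> (u \in F i)]].

Lemma p_chkTP s : has_input s -> (ntab s 22 0 0 < r)%N ->
  ok K p_chkT s (fun s' => (ntab s' 14 0 0 != 0%N)
    = goodT (ntab s 17 0 0) (ntab s 22 0 0) (tset 13 s)).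
Proof.
move=> hi; set j := ntab s 22 0 0; set cap := ntab s 17 0 0 => jr.
rewrite /p_chkT; st; set s2 := State _ _.
have hi2 : has_input s2 by apply: has_input_upd => //; apply: has_input_upd.
have fl2 : ntab s2 14 0 0 = 1%N by [].
have c2 : ntab s2 15 0 0 = 0%N by [].
have e13 : ntab s2 13 = ntab s 13 by [].
have ej : ntab s2 22 0 0 = j by [].
have ecap : ntab s2 17 0 0 = cap by [].
clearbody s2; pose jo := Ordinal jr.
apply: (ok_for (Inv := fun u s' =>
   ntab s' 15 0 0 = (\sum_(0 <= x < u) (ntab s 13 x 0 != 0))%N /\
   (ntab s' 14 0 0 != 0%N) =
   [forall x : 'I_n, (x < u)%N ==> (ntab s 13 x 0 != 0%N) ==> (x \in F jo)])).
- by rewrite (in_n hi2).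
- by [].
- by [].
- rewrite /= /upd /= fl2 big_geq // c2; split=> //; exact/esym/forallP.
- rewrite (in_n hi2) => u s3 uN [fn fw] eu [h15 h14]; pose uo := Ordinal uN.
  have step : [forall x : 'I_n, (x < u.+1)%N ==> (ntab s 13 x 0 != 0%N) ==> (x \in F jo)]
    = (ntab s3 14 0 0 != 0%N) && ((ntab s 13 u 0 != 0%N) ==> (uo \in F jo)).
    rewrite h14; apply/forallP/andP => [h|[/forallP h1 h2] x].
      split; last by have := h uo; rewrite ltnSn.
      by apply/forallP => x; apply/implyP => lx; have := h x; rewrite ltnS ltnW.
    apply/implyP; rewrite ltnS leq_eqVlt => /orP[/eqP e|lx].
      by have -> : x = uo by apply: val_inj.
    by have := h1 x; rewrite lx.
  apply: ok_if => /=; rewrite !lt0n eu fn // e13 => hc; st.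
    apply: ok_if; nrm; rewrite eu fn // fn // ej (in_F jo uo hi2) => hF; st; nrm;
      rewrite step h15 big_nat_recr //= hc /=; split=> //.
      by move: hF; case: (uo \in F jo) => //; rewrite andbT.
    by move: hF; case: (uo \in F jo) => //; rewrite andbF.
  nrm; rewrite step h15 big_nat_recr //= (negPf hc) addn0 /= andbT; split=> //.
- rewrite (in_n hi2) => s' [fn fw] [h15 h14].
  have cE : ntab s' 15 0 0 = #|tset 13 s|.
    by rewrite h15; apply: sum_nat_card => u; rewrite inE.
  have E : goodT cap j (tset 13 s) = (#|tset 13 s| <= cap)%N && (ntab s' 14 0 0 != 0%N).
    congr (_ && _); rewrite h14; apply/forallP/forallP => h x.
      rewrite ltn_ord /=; apply/implyP => hx; have := h x; rewrite inE hx /=.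
      by move=> /forallP/(_ jo); rewrite eqxx.
    apply/implyP; rewrite inE => hx; apply/forallP => i; apply/implyP => /eqP ei.
    have -> : i = jo by apply: val_inj.
    by have := h x; rewrite ltn_ord hx.
  rewrite E; apply: ok_if => /=; rewrite (fn 17) // ecap cE => hc; st; nrm; first by rewrite hc.
  by rewrite (negPf hc).
Qed.

Definition bin s j : {set 'I_n} := [set u : 'I_n | ntab s 4 u 0 == j.+1].

Lemma p_fillP s (v : 'I_n) j : has_input s -> ntab s 22 0 0 = j ->
    ntab s 21 0 0 = v ->
  ok K p_fill s (fun s' => tset 13 s' = v |: bin s j).
Proof.
move=> hi ej ev; rewrite /p_fill.
apply: (ok_for (Inv := fun i s' => forall u : 'I_n, (u < i)%N ->
   (ntab s' 13 u 0 != 0%N) = (u \in v |: bin s j))) => //.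
- by rewrite (in_n hi).
- rewrite (in_n hi) => i s1 iN [fn fw] ei h.
  apply: ok_if => /=; rewrite ei !fn // ej ev addn1 -!eqn_leq => hc; st; nrm;
    rewrite ei => u; rewrite ltnS leq_eqVlt => /orP[/eqP ui|ui];
    try by rewrite (ltn_eqF ui) /= h.
    rewrite ui eqxx /= !inE -val_eqE /= ui orbC.
    by rewrite negb_and !negbK in hc; rewrite hc.
  rewrite ui eqxx /= !inE -val_eqE /= ui orbC.
  by rewrite negbK -negb_or in hc; rewrite (negPf hc).
- by rewrite (in_n hi) => s' _ h; apply/setP => u; rewrite inE h.
Qed.

(** The analysis of first fit uses only that these feasible sets are closed under subsets and
    include the empty set, so it covers both kinds of bins. *)
Definition good (lam : bool) cap j B := if lam then goodL B else goodT cap j B.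

Lemma good_sub lam cap j (A B : {set 'I_n}) : A \subset B -> good lam cap j B -> good lam cap j A.
Proof.
move=> sAB; rewrite /good; case: lam.
  move=> /forallP h; apply/forallP => i; apply: leq_trans (h i).
  by apply/subset_leq_card/setSI.
move=> /andP[h1 /forall_inP h2]; apply/andP; split.
  by apply: leq_trans h1; apply: subset_leq_card.
by apply/forall_inP => u /(subsetP sAB); apply: h2.
Qed.

Lemma good0 lam cap j : good lam cap j set0.
Proof.
rewrite /good; case: lam; first by apply/forallP => i; rewrite set0I cards0.
by rewrite /goodT cards0 /=; apply/forall_inP => u; rewrite inE.
Qed.

Lemma p_chkP lam s : has_input s -> (~~ lam -> ntab s 22 0 0 < r)%N ->
  ok K (p_chk lam) s (fun s' => (ntab s' 14 0 0 != 0%N)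
    = good lam (ntab s 17 0 0) (ntab s 22 0 0) (tset 13 s)).
Proof. by case: lam => hi hr; [apply: p_chkLP | apply: p_chkTP => //; apply: hr]. Qed.

(** * First fit by decreasing degree *)

Section FirstFit.
Variables (lam : bool) (cap NB : nat).
Implicit Types (proc : pred 'I_n) (part : 'I_n -> nat).
Let gd := good lam cap.

Definition bins part j : {set 'I_n} := [set u | part u == j.+1].

(** Either [u] already sits in a bin of index at most [j], or the members of bin [j] of at least its
    degree refuse it. Since bins only grow and feasibility is hereditary, a refusal is never
    revoked. *)
Definition rejects part (u : 'I_n) j :=
  (0 < part u <= j.+1)%N
  || ~~ gd j (u |: [set x in bins part j | dg u <= dg x]).

Definition ffinv proc part :=
  [/\ forall u, (part u <= NB)%N, forall u, ~~ proc u -> part u = 0%N,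
      forall j, (j < NB)%N -> gd j (bins part j)
    & forall u j, proc u -> (j < NB)%N -> rejects part u j].

(* The vertex [v] is being processed and its fate in the first [j0] bins is
   settled. *)
Definition ffinv_at proc v j0 part :=
  [/\ forall u, (part u <= NB)%N, forall u, ~~ proc u -> u != v -> part u = 0%N,
      (part v <= j0)%N,
      forall j, (j < NB)%N -> gd j (bins part j)
    & (forall u j, proc u -> (j < NB)%N -> rejects part u j) /\
      forall j, (j < j0)%N -> rejects part v j].

Lemma bins_ext part part' : part =1 part' -> bins part =1 bins part'.
Proof. by move=> e j; apply/setP => u; rewrite !inE e. Qed.

Lemma rejects_ext part part' u j : part =1 part' -> rejects part u j = rejects part' u j.
Proof. by move=> e; rewrite /rejects e (bins_ext e). Qed.

Lemma ffinv_ext proc proc' part part' : proc =1 proc' -> part =1 part' ->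
  ffinv proc part -> ffinv proc' part'.
Proof.
move=> ep e [h1 h2 h3 h4]; split=> [u|u|j|u j].
- by rewrite -e.
- by rewrite -e -ep; apply: h2.
- by rewrite -(bins_ext e); apply: h3.
- by rewrite -(rejects_ext u j e) -ep; apply: h4.
Qed.

Lemma ffinv_at_ext proc v j0 part part' : part =1 part' ->
  ffinv_at proc v j0 part -> ffinv_at proc v j0 part'.
Proof.
move=> e [h1 h2 h3 h4 [h5 h6]]; split=> [u|u||j|]; first by rewrite -e.
- by rewrite -e; apply: h2.
- by rewrite -e.
- by rewrite -(bins_ext e); apply: h4.
- by split=> [u j|j]; rewrite -(rejects_ext _ _ e); [apply: h5 | apply: h6].
Qed.

Lemma ffinv_at_start proc v part : ~~ proc v -> ffinv proc part -> ffinv_at proc v 0 part.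
Proof.
by move=> nv [h1 h2 h3 h4]; split=> // [u nu _|]; [apply: h2 | rewrite h2].
Qed.

Lemma ffinv_at_end proc v part : ffinv_at proc v NB part ->
  ffinv [predU1 v & proc] part.
Proof.
move=> [h1 h2 h3 h4 [h5 h6]]; split=> // [u|u j].
  by rewrite /= negb_or => /andP[uv pu]; apply: h2.
by case/orP => [/eqP->|pu] jN; [apply: h6 | apply: h5].
Qed.

Lemma ffinv_at_keep proc v j part : part v != 0%N ->
  ffinv_at proc v j part -> ffinv_at proc v j.+1 part.
Proof.
move=> pv [h1 h2 h3 h4 [h5 h6]]; split=> //; first exact: leqW.
split=> // j'; rewrite ltnS leq_eqVlt => /orP[/eqP ->|]; last exact: h6.
by rewrite /rejects lt0n pv (leqW h3).
Qed.

Lemma ffinv_at_fit proc v j part : part v = 0%N -> ~~ proc v -> (j < NB)%N ->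
  gd j (v |: bins part j) -> ffinv_at proc v j part ->
  ffinv_at proc v j.+1 (fun u => if u == v then j.+1 else part u).
Proof.
move=> pv nv jN hg [h1 h2 h3 h4 [h5 h6]].
set part' := fun _ => _.
have bE j' : bins part' j' = if j' == j then v |: bins part j else bins part j'.
  apply/setP => u; rewrite /bins /part' !inE.
  case: (eqVneq j' j) => [->|nj]; rewrite !inE; case: (eqVneq u v) => [->|_] //=.
    by rewrite eqxx.
  by rewrite pv eqSS eq_sym (negPf nj).
have bS j' : bins part j' \subset bins part' j'.
  by rewrite bE; case: eqP => // ->; apply: subsetUr.
have rej u j' : ~~ gd j' (u |: [set x in bins part j' | dg u <= dg x]) ->
    ~~ gd j' (u |: [set x in bins part' j' | dg u <= dg x]).
  apply: contra; apply: good_sub; apply: setUS; apply/subsetP => x.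
  by rewrite !in_set => /andP[xb ->]; rewrite andbT; have := subsetP (bS j') x; rewrite !in_set; apply.
split=> [u|u nu uv||j' j'N|].
- by rewrite /part'; case: ifP.
- by rewrite /part' (negPf uv) h2.
- by rewrite /part' eqxx.
- by rewrite bE; case: eqP => [->//|_]; apply: h4.
- split=> [u j' pu j'N|j'].
    have uv : u != v by apply: contraNneq nv => <-.
    have pE : part' u = part u by rewrite /part' (negPf uv).
    by have := h5 u j' pu j'N; rewrite /rejects pE => /orP[->//|/rej ->]; rewrite orbT.
  rewrite ltnS leq_eqVlt => /orP[/eqP ->|lj].
    by rewrite /rejects (_ : part' v = j.+1) ?ltnS ?leqnn // /part' eqxx.
  have := h6 j' lj; rewrite {1}/rejects pv /= => /rej h.
  by rewrite /rejects h orbT.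
Qed.

(** All members of the bins were processed before [v] and have at least its degree, so the
    restriction to heavier members in [rejects] removes nothing. *)
Lemma ffinv_at_nofit proc v j part : part v = 0%N -> ~~ gd j (v |: bins part j) ->
  (forall x, proc x -> dg v <= dg x) -> ffinv_at proc v j part ->
  ffinv_at proc v j.+1 part.
Proof.
move=> pv ng le [h1 h2 h3 h4 [h5 h6]]; split=> //; first exact: leqW.
split=> // j'; rewrite ltnS leq_eqVlt => /orP[/eqP ->|]; last exact: h6.
rewrite /rejects; apply/orP; right; rewrite (_ : [set x in _ | _] = bins part j) //.
apply/setP => x; rewrite !inE; case: eqP => //= px; apply: le.
apply/negPn/negP => nx; have := h2 x nx; rewrite px.
by case: (eqVneq x v) => [xv|_ /(_ isT)] //; rewrite xv pv in px.
Qed.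

Hypothesis NBK : (NB <= K)%N.
Hypothesis NBr : (~~ lam -> NB <= r)%N.

Definition partf s (u : 'I_n) := ntab s 4 u 0.

Lemma p_placeP s (v : 'I_n) proc : has_input s ->
    ntab s 16 0 0 = NB -> ntab s 17 0 0 = cap -> ntab s 21 0 0 = v ->
    ~~ proc v -> (forall x, proc x -> dg v <= dg x) -> ffinv proc (partf s) ->
  ok K (p_place lam) s (fun s' => ffinv [predU1 v & proc] (partf s')).
Proof.
move=> hi eNB ecap ev nv le inv; rewrite /p_place.
apply: (ok_for (Inv := fun j s' => ffinv_at proc v j (partf s'))).
- by rewrite eNB.
- by case: lam.
- by case: lam.
- exact: ffinv_at_start.
- rewrite eNB => j s1 jN fr ej h.
  have hi1 : has_input s1 by apply: has_input_frame fr _ hi; case: lam.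
  have ev1 : ntab s1 21 0 0 = v by rewrite (proj1 fr) //; case: lam.
  have ec1 : ntab s1 17 0 0 = cap by rewrite (proj1 fr) //; case: lam.
  apply: ok_if => /=; rewrite ev1 lt0n => pv.
    by st; apply: ffinv_at_keep.
  have {}pv : partf s1 v = 0%N by apply/eqP; rewrite -[_ == _]negbK.
  apply: ok_seq; apply: ok_imp (p_fillP hi1 ej ev1) _ => s2 fr2 hX.
  have hi2 : has_input s2 by apply: has_input_frame fr2 _ hi1.
  have ej2 : ntab s2 22 0 0 = j by rewrite (proj1 fr2).
  have ev2 : ntab s2 21 0 0 = v by rewrite (proj1 fr2).
  have ec2 : ntab s2 17 0 0 = cap by rewrite (proj1 fr2).
  have e42 : ntab s2 4 = ntab s1 4 by rewrite (proj1 fr2).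
  apply: ok_seq; apply: ok_imp (p_chkP (lam := lam) hi2 _) _.
    by rewrite ej2 => /NBr; apply: leq_trans.
  rewrite ej2 ec2 hX => s3 fr3 hfl.
  have ej3 : ntab s3 22 0 0 = j by rewrite (proj1 fr3) //; case: lam.
  have ev3 : ntab s3 21 0 0 = v by rewrite (proj1 fr3) //; case: lam.
  have e43 : ntab s3 4 = ntab s1 4 by rewrite -e42 (proj1 fr3) //; case: lam.
  have bE : bin s1 j = bins (partf s1) j by [].
  apply: ok_if => /=; rewrite lt0n hfl bE => hg; st; nrm.
    apply: (ffinv_at_ext _ (ffinv_at_fit pv nv jN hg h)) => u.
    by rewrite /partf /= ev3 ej3 e43 addn1 andbT.
  apply: (@ffinv_at_ext _ _ _ (partf s1)); first by move=> u; rewrite /partf /= e43.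
  exact: ffinv_at_nofit.
- by rewrite eNB => s' _ h; apply: ffinv_at_end.
Qed.

Lemma p_ffP s : has_input s -> (forall u : 'I_n, ntab s 12 u 0 = rk u) ->
    ntab s 16 0 0 = NB -> ntab s 17 0 0 = cap -> (forall u : 'I_n, ntab s 4 u 0 = 0%N) ->
  ok K (p_ff lam) s (fun s' => ffinv xpredT (partf s')).
Proof.
move=> hi hrk eNB ecap h0; rewrite /p_ff.
apply: (ok_for (Inv := fun t s' => ffinv (fun u => rk u < t)%N (partf s'))).
- by rewrite (in_n hi).
- by case: lam.
- by case: lam.
- have pE : (fun=> 0%N) =1 partf s by move=> u; rewrite /partf h0.
  apply: (@ffinv_ext (fun u => rk u < 0)%N _ (fun=> 0%N)) => //.
  split=> // j jN; rewrite (_ : bins _ _ = set0); first exact: good0.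
  by apply/setP => u; rewrite !inE.
- rewrite (in_n hi) => t s1 tN fr et hinv.
  have hi1 : has_input s1 by apply: has_input_frame fr _ hi; case: lam.
  have e12 : ntab s1 12 = ntab s 12 by rewrite (proj1 fr) //; case: lam.
  have e16 : ntab s1 16 0 0 = NB by rewrite (proj1 fr) //; case: lam.
  have e17 : ntab s1 17 0 0 = cap by rewrite (proj1 fr) //; case: lam.
  (* During sweep [t] the processed vertices are those preceding [(t, v)] in the lexicographic order
     of rank and index. *)
  apply: (ok_for (Inv := fun v s' =>
     ffinv (fun u => (rk u < t) || (rk u == t) && (u < v))%N (partf s'))).
  + by rewrite (in_n hi1).
  + by case: lam.
  + by case: lam.
  + by apply: ffinv_ext hinv => // u; rewrite ltn0 andbF orbF.
  + rewrite (in_n hi1) => v s2 vN fr2 ev h2; pose vo := Ordinal vN.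
    have hi2 : has_input s2 by apply: has_input_frame fr2 _ hi1; case: lam.
    have f12 : ntab s2 12 = ntab s 12 by rewrite (proj1 fr2) ?e12 //; case: lam.
    have f16 : ntab s2 16 0 0 = NB by rewrite (proj1 fr2) //; case: lam.
    have f17 : ntab s2 17 0 0 = cap by rewrite (proj1 fr2) //; case: lam.
    have f20 : ntab s2 20 0 0 = t by rewrite (proj1 fr2) //; case: lam.
    apply: ok_if => /=; rewrite ev f12 f20 (hrk vo) -eqn_leq => hc.
      apply: ok_imp (p_placeP (v := vo) hi2 f16 f17 ev _ _ h2) _.
      * by rewrite (eqP hc) ltnn eqxx ltnn.
      * by move=> x hx; apply: rk_le; case/orP: hx => [|/andP[/eqP-> _]]; rewrite (eqP hc) // => /ltnW.
      move=> s3 _; apply: ffinv_ext => // u /=.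
      rewrite ltnS [(u <= v)%N]leq_eqVlt -val_eqE /=.
      by case: (eqVneq (u : nat) v) => [uv|_] //=; rewrite (_ : u = vo) ?hc ?orbT //; apply: val_inj.
    st; apply: ffinv_ext h2 => // u; rewrite ltnS [(u <= v)%N]leq_eqVlt.
    case: (eqVneq (u : nat) v) => [uv|_] //=.
    by have -> : u = vo by [apply: val_inj]; rewrite (negPf hc).
  + rewrite (in_n hi1) => s' _; apply: ffinv_ext => // u.
    by rewrite ltn_ord andbT [RHS]ltnS [RHS]leq_eqVlt orbC.
- rewrite (in_n hi) => s' _; apply: ffinv_ext => // u; exact: rk_lt.
Qed.

End FirstFit.
End Spec.

Local Close Scope ring_scope.

Definition p_kernel lam : prog :=
  Seq p_m (Seq p_deg (Seq p_rank
  (Seq (setn 16 (if lam then sc 10 else NGet 0 (NCst 0) (NCst 1)))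
  (Seq (setn 17 (NSub (NAdd (sc 10) (NGet 0 (NCst 0) (NCst 1))) (NCst 1)))
  (p_ff lam))))).

Local Open Scope ring_scope.

Section KernelProgram.
Variables (R : realFieldType) (n r : nat) (G : wgraph R n).
Variables (F : 'I_r -> {set 'I_n}) (b : 'I_r -> nat) (eps : R) (K : nat).
Hypothesis nK : (n <= K)%N.
Hypothesis rK : (r <= K)%N.
Implicit Types s : state R.

Lemma p_kernelP lam s : has_input G F b eps s -> (forall u : 'I_n, ntab s 4 u 0 = 0%N) ->
  ok K (p_kernel lam) s (fun s' => let m := ntab s' 10 0 0 in
    is_floor n eps m /\
    ffinv G F b lam (m + r - 1) (if lam then m else r) xpredT (partf s')).
Proof.
move=> hi h4; rewrite /p_kernel.
apply: ok_seq; apply: ok_imp (p_mP nK hi) _ => s1 fr1 hm.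
have hi1 : has_input G F b eps s1 by apply: has_input_frame fr1 _ hi.
apply: ok_seq; apply: ok_imp (p_degP nK hi1) _ => s2 fr2 hd.
have hi2 : has_input G F b eps s2 by apply: has_input_frame fr2 _ hi1.
apply: ok_seq; apply: ok_imp (p_rankP nK hi2 hd) _ => s3 fr3 hr.
have hi3 : has_input G F b eps s3 by apply: has_input_frame fr3 _ hi2.
have e10 : ntab s3 10 0 0 = ntab s1 10 0 0 by rewrite (proj1 fr3) // (proj1 fr2).
have e4 : ntab s3 4 = ntab s 4.
  by rewrite (proj1 fr3) // (proj1 fr2) // (proj1 fr1).
move: hm; set m := ntab s1 10 0 0 in e10 *; clearbody m => hm.
st; match goal with |- ok _ _ ?s _ => set s4 := s end.
have hi4 : has_input G F b eps s4 by apply: has_input_upd => //; apply: has_input_upd.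
have m4 : ntab s4 10 0 0 = m by [].
have c4 : ntab s4 17 0 0 = (m + r - 1)%N.
  by rewrite /s4 /= /upd /= e10 (in_r hi3).
have N4 : ntab s4 16 0 0 = if lam then m else r.
  by rewrite /s4 /upd /=; case: (lam); rewrite /= ?e10 ?(in_r hi3).
have r4 : forall u : 'I_n, ntab s4 12 u 0 = rk G u by [].
have p4 : forall u : 'I_n, ntab s4 4 u 0 = 0%N.
  by move=> u; rewrite (_ : ntab s4 4 = ntab s3 4) // e4 h4.
clearbody s4.
have NK : ((if lam then m else r) <= K)%N.
  by case: (lam) => //; apply: leq_trans nK; case: hm.
have Nr : (~~ lam -> (if lam then m else r) <= r)%N by case: (lam).
apply: ok_imp (p_ffP nK rK NK Nr hi4 r4 N4 c4 p4) _ => s5 fr5 hff.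
by rewrite (proj1 fr5) ?m4 //; case: (lam).
Qed.

End KernelProgram.

(** * Quality and size of the computed kernels *)

Section KernelSpec.
Variables (R : realFieldType) (n r : nat) (G : wgraph R n) (M : matroid n).
Variables (F : 'I_r -> {set 'I_n}) (b : 'I_r -> nat) (eps : R).
Hypothesis eps0 : 0 < eps.
Variables (cap m : nat) (part : 'I_n -> nat).
Hypothesis floor_m : is_floor n eps m.

Definition placed : {set 'I_n} := [set v | part v != 0%N].

Lemma mrank_ge (S : {set 'I_n}) : S \in indep M -> (#|S| <= mrank M)%N.
Proof. by move=> iS; rewrite /mrank (bigD1 S) //= leq_maxl. Qed.

Lemma bins_disjoint i j : i != j -> [disjoint bins part i & bins part j].
Proof.
move=> nij; rewrite -setI_eq0; apply/eqP/setP => x; rewrite !inE.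
by apply/negP => /andP[/eqP-> ]; rewrite eqSS (negPf nij).
Qed.

Lemma placedE NB : (forall u, (part u <= NB)%N) ->
  placed = \bigcup_(j < NB) bins part j.
Proof.
move=> leN; apply/setP => v; rewrite inE; apply/idP/bigcupP => [|[j _]].
  case E: (part v) => [//|j] _; have jN : (j < NB)%N by rewrite -E.
  by exists (Ordinal jN) => //; rewrite inE E.
by rewrite inE => /eqP->.
Qed.

Lemma card_placed NB : (forall u, (part u <= NB)%N) ->
  #|placed| = (\sum_(j < NB) #|bins part j|)%N.
Proof.
move=> leN; rewrite (placedE leN) -sum1_card (partition_disjoint_bigcup) //=.
  by apply: eq_bigr => j _; rewrite sum1_card.
by move=> i j nij; apply: bins_disjoint.
Qed.

Lemma approx_of_opt (S : {set 'I_n}) :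
  S \in indep M -> opt G M <= covered G S -> approx_solution G M eps S.
Proof.
move=> iS h; split=> //; apply: le_trans h.
by apply: ler_piMl; [exact: opt_ge0 | rewrite gerBl ltW].
Qed.

(** If the kernel contains an optimum, nothing is lost. Otherwise some vertex of the optimum was
    left out; this is what guarantees that [m] is the true floor, hence that [m / (m + 1)] exceeds
    [1 - eps]. *)
Lemma kernel_cases : (forall (O : {set 'I_n}) o, O \in indep M -> o \in O -> o \notin placed ->
     (m < n)%N /\ ((0 < m)%N -> exists S, [/\ S \in indep M, S \subset placed
       & m%:R * cov2 (wmx G) O <= m.+1%:R * cov2 (wmx G) S])) ->
  approx_kernel G M eps placed.
Proof.
move=> h; have [O iO optO] := opt_attained G M.
have [sO|/subsetPn[o oO oV]] := boolP (O \subset placed).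
  by exists O; split=> //; apply: approx_of_opt; rewrite ?optO.
have [mn hS] := h O o iO oO oV; have [_ _ /(_ mn) m1] := floor_m.
(* When [m = 0], [eps] exceeds 1, the target value is not positive, and the empty set suffices. *)
have [m0|m0] := posnP m.
  exists set0; split; first exact: sub0set.
  split; first exact: indep0.
  apply: le_trans (covered_ge0 G _); rewrite mulr_le0_ge0 ?opt_ge0 //.
  by move: m1; rewrite m0; lra.
have [S [iS sS cS]] := hS m0.
by exists S; split=> //; apply: approx_of_ratio cS.
Qed.

Lemma size_bound k c : (#|placed| <= k * (m + c))%N ->
  #|placed|%:R <= k%:R / eps + k%:R * c%:R.
Proof.
move=> le; apply: (@le_trans _ _ (k * (m + c))%:R); first by rewrite ler_nat.
rewrite natrM natrD mulrDr lerD2r ler_wpM2l //.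
by rewrite -[_^-1]mul1r ler_pdivlMr //; case: floor_m.
Qed.

Section Laminar.
Hypothesis indepE : forall S, S \in indep M <-> bounded_indep F b S.
Hypothesis inv : ffinv G F b true cap m xpredT part.

Lemma goodLE (S : {set 'I_n}) : goodL F b S = (S \in indep M).
Proof. by apply/forallP/idP => [h|/indepE//]; apply/indepE. Qed.

Lemma binsL_indep (j : 'I_m) : bins part j \in indep M.
Proof. by have [_ _ h _] := inv; have := h j (ltn_ord j); rewrite /good goodLE. Qed.

Lemma binsL_reject (j : 'I_m) v : v \notin placed ->
  v |: [set u in bins part j | dg G v <= dg G u] \notin indep M.
Proof.
have [_ _ _ h] := inv; rewrite inE negbK => /eqP pv.
by have := h v j isT (ltn_ord j); rewrite /rejects pv /= goodLE.
Qed.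

Lemma part_leL u : (part u <= m)%N. Proof. by case: inv. Qed.

Lemma kernelL : approx_kernel G M eps placed.
Proof.
apply: kernel_cases => O o iO oO oV; split.
  have bne (j : 'I_m) : (1 <= #|bins part j|)%N.
    rewrite card_gt0; apply: contraL (binsL_reject j oV) => /eqP->.
    rewrite negbK; apply: indep_sub iO; apply/subsetP => x; rewrite !inE /=.
    by rewrite orbF => /eqP->.
  have le1 : (m <= #|placed|)%N.
    rewrite (card_placed part_leL) -[leqLHS]card_ord -sum1_card.
    by apply: leq_sum => j _; apply: bne.
  apply: leq_ltn_trans le1 _; rewrite -[ltnRHS]card_ord -cardsT.
  by apply: proper_card; apply/properP; split; [apply: subsetT | exists o].
move=> m0; rewrite (placedE part_leL).
apply: (kernel_of_bins (wmx_ge0 G) (wmx_sym G) (wmx_irr G)) => //.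
- exact: binsL_indep.
- by move=> i j nij; apply: bins_disjoint.
- by move=> j v; rewrite -(placedE part_leL) => vV; apply: binsL_reject.
Qed.

Lemma card_kernelL : (#|placed| <= mrank M * m)%N.
Proof.
rewrite (card_placed part_leL) mulnC -[m in leqRHS]card_ord -sum_nat_const.
by apply: leq_sum => j _; apply/mrank_ge/binsL_indep.
Qed.

(** The first bin refuses a vertex only if it spans it, so it is a basis. Its size therefore tells
    the search program the rank. *)
Lemma bin0_max (S : {set 'I_n}) : (0 < m)%N -> S \in indep M -> (#|S| <= #|bins part 0|)%N.
Proof.
move=> m0 iS; rewrite leqNgt; apply/negP => lt.
have [x] := indep_aug (binsL_indep (Ordinal m0)) iS lt.
rewrite !inE => /andP[/negPf px xS] ix.
have [_ _ _ h] := inv; have := h x 0%N isT m0; rewrite /rejects.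
case: (part x) px => [|[|p]] //= _; rewrite goodLE => /negP; apply;
  apply: indep_sub ix; apply: setUS; apply/subsetP => y; rewrite !inE => /andP[]//.
Qed.

Lemma bin0_solution : (m <= 1)%N -> placed \in indep M.
Proof.
move=> m1; have [V0|[v]] := set_0Vmem placed; first by rewrite V0 indep0.
rewrite (placedE part_leL) => /bigcupP[j _ _].
rewrite (_ : \bigcup_ _ _ = bins part j); first exact: binsL_indep.
apply/setP => x; apply/bigcupP/idP => [[i _]|]; last by exists j.
have val0 (k : 'I_m) : val k = 0%N.
  by apply/eqP; rewrite -leqn0 -ltnS; apply: leq_trans (ltn_ord k) m1.
by rewrite (_ : i = j) //; apply: val_inj; rewrite !val0.
Qed.

End Laminar.

Section Transversal.
Hypothesis tM : transversal_matroid M F.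
Hypothesis rE : mrank M = r.
Hypothesis capE : cap = (m + r - 1)%N.
Hypothesis inv : ffinv G F b false cap r xpredT part.

Lemma part_leT u : (part u <= r)%N. Proof. by case: inv. Qed.

Lemma binsT_sub (i : 'I_r) : bins part i \subset F i.
Proof.
have [_ _ h _] := inv; have /andP[_ /forall_inP h2] := h i (ltn_ord i).
by apply/subsetP => u /h2 /forallP/(_ i); rewrite eqxx.
Qed.

Lemma binsT_le (i : 'I_r) : (#|bins part i| <= cap)%N.
Proof. by have [_ _ h _] := inv; have /andP[] := h i (ltn_ord i). Qed.

(** A vertex of [F i] can only be refused for lack of room. Then the heavier members alone number at
    least [cap], which is also the most a bin holds, so they are the whole bin. *)
Lemma binsT_full (i : 'I_r) v : v \notin placed -> v \in F i ->
  (cap <= #|bins part i|)%N /\ forall u, u \in bins part i -> dg G v <= dg G u.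
Proof.
rewrite inE negbK => /eqP pv vF; have [_ _ _ h] := inv.
have := h v i isT (ltn_ord i); rewrite /rejects pv /= /goodT.
set T := [set u in _ | _]; rewrite negb_and => /orP[|].
  rewrite -ltnNge cardsU1 (_ : v \notin T) /=; last by rewrite !inE pv.
  rewrite add1n ltnS => leT.
  have sT : T \subset bins part i by apply/subsetP => u; rewrite inE => /andP[].
  have TE : T = bins part i.
    by apply/eqP; rewrite eqEcard sT (leq_trans (binsT_le i)).
  by rewrite -TE; split=> // u; rewrite inE => /andP[].
case/negP; apply/forall_inP => u /setU1P[->|].
  by apply/forallP => j; apply/implyP => /eqP/val_inj->.
rewrite inE => /andP[uT _]; apply/forallP => j; apply/implyP => /eqP/val_inj->.
exact: (subsetP (binsT_sub i)).
Qed.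

Lemma kernelT : approx_kernel G M eps placed.
Proof.
apply: kernel_cases => O o iO oO oV; split.
  have [f [_ fF]] := (transversal_indepP tM O).1 iO.
  have [i _ oF] := fF o oO; have [lec _] := binsT_full oV oF.
  have le1 : (#|bins part i| <= #|placed|)%N.
    apply: subset_leq_card; apply/subsetP => x.
    by rewrite !inE => /eqP->.
  have ltn : (#|placed| < n)%N.
    rewrite -[ltnRHS]card_ord -cardsT; apply: proper_card.
    by apply/properP; split; [apply: subsetT | exists o].
  have r0 := leq_ltn_trans (leq0n i) (ltn_ord i).
  by move: (leq_trans lec le1) ltn; rewrite capE; lia.
move=> m0; rewrite (placedE part_leT).
apply: (kernel_of_groups (wmx_ge0 G) (wmx_sym G) (wmx_irr G) tM) => //.
- by rewrite -rE mrank_ge.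
- exact: binsT_sub.
- by move=> i j nij; apply: bins_disjoint.
- by move=> i v; rewrite -(placedE part_leT) -capE; apply: binsT_full.
Qed.

Lemma card_kernelT : (#|placed| <= r * cap)%N.
Proof.
rewrite (card_placed part_leT) -[r in leqRHS]card_ord -sum_nat_const.
by apply: leq_sum => j _; apply: binsT_le.
Qed.

Lemma size_kernelT : #|placed|%:R <= r%:R / eps + r%:R * (r%:R - 1).
Proof.
(* For [r = 0] the subtraction in [m + r - 1] is truncated and differs from the real [r - 1], but
   the kernel is empty. *)
have := card_kernelT; rewrite capE; case: (r) => [|r'].
  rewrite mul0n leqn0 => /eqP ->; rewrite mul0r mul0r addr0; lra.
rewrite -addnBA // subn1 /= => /size_bound; rewrite -[r'.+1%:R - 1]/(r'.+1%:R - 1%:R).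
by rewrite -natrB // subn1.
Qed.

End Transversal.
End KernelSpec.

Local Close Scope ring_scope.

(** * The enumeration programs *)

Definition p_list : prog :=
  Seq (setn 19 (NCst 0)) (For 20 0 0 (If (TNz (NGet 4 (sc 20) (NCst 0)))
    (Seq (NSet 18 (sc 19) (NCst 0) (sc 20)) (incr 19)) Skip)).

Definition p_len : prog :=
  Seq (setn 32 (NCst 0)) (For 20 0 0 (If (TEq (NGet 4 (sc 20) (NCst 0)) (NCst 1))
    (setn 32 (NAdd (sc 32) (NCst 2))) Skip)).

Definition p_clear : prog := For 20 0 0 (NSet 13 (sc 20) (NCst 0) (NCst 0)).

Definition p_digit : nexp := NGet 30 (sc 21) (NCst 0).

(** A letter below [m] skips that many positions and selects the next one; the letter [m] only
    skips. Positions past the end of the list select nothing. A word may spell a dependent set, so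
    independence is tested afterwards. *)
Definition p_decL : prog :=
  Seq p_clear (Seq (setn 34 (NCst 0)) (Seq
  (For 21 32 0 (Seq (setn 34 (NAdd (sc 34) p_digit))
    (If (TLt p_digit (sc 10))
      (Seq (If (TLt (sc 34) (sc 19)) (NSet 13 (NGet 18 (sc 34) (NCst 0)) (NCst 0) (NCst 1)) Skip)
           (incr 34)) Skip)))
  p_chkL)).

(** Letter [i] names the vertex proposed for the [i]-th set of the family and is ignored if that
    vertex lies outside this set. The word is thus itself a matching, every decoded set is
    independent, and the flag can be set without a test. *)
Definition p_decT : prog :=
  Seq p_clear (Seq
  (For 21 32 0 (If (TAnd (TLt p_digit (sc 19)) (TNz (NGet 2 (sc 21) (NGet 18 p_digit (NCst 0)))))
     (NSet 13 (NGet 18 p_digit (NCst 0)) (NCst 0) (NCst 1)) Skip))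
  (setn 14 (NCst 1))).

Definition p_dec (lam : bool) := if lam then p_decL else p_decT.

Definition p_cov : prog :=
  Seq (WSet 12 (NCst 0) (NCst 0) WZero)
  (For 20 0 0 (For 21 0 0 (If (TOr (TNz (NGet 13 (sc 20) (NCst 0))) (TNz (NGet 13 (sc 21) (NCst 0))))
    (WSet 12 (NCst 0) (NCst 0) (WAdd (WGet 12 (NCst 0) (NCst 0)) (WGet 1 (sc 20) (sc 21)))) Skip))).

Definition p_copy x y : prog := For 20 0 0 (NSet x (sc 20) (NCst 0) (NGet y (sc 20) (NCst 0))).

(** Increment in base [B], least significant digit first. The carry that survives the last digit
    signals that all words have been seen and ends the search. *)
Definition p_inc : prog :=
  Seq (setn 33 (NCst 1)) (For 21 32 0 (If (TNz (sc 33))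
    (If (TLt (NAdd p_digit (NCst 1)) (sc 31))
       (Seq (NSet 30 (sc 21) (NCst 0) (NAdd p_digit (NCst 1))) (setn 33 (NCst 0)))
       (NSet 30 (sc 21) (NCst 0) (NCst 0))) Skip)).

(** * Counters in base [B] and words of gaps *)

Definition digit B c i := (c %/ B ^ i) %% B.

(** [B ^ i %| c.+1] says that the carry of the increment reaches digit [i]; the second part is the
    propagation of this carry. *)
Lemma digit_succ B c i : 0 < B ->
  digit B c.+1 i =
    (if B ^ i %| c.+1 then (if (digit B c i).+1 < B then (digit B c i).+1 else 0)
     else digit B c i)
  /\ (B ^ i.+1 %| c.+1) = (B ^ i %| c.+1) && ~~ ((digit B c i).+1 < B).
Proof.
move=> B0; have P0 : 0 < B ^ i by rewrite expn_gt0 B0.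
rewrite /digit divnS //; set q := c %/ B ^ i.
have qE : (B %| q.+1) = ~~ ((q %% B).+1 < B).
  have E := divn_eq q B; rewrite [in LHS]E -addnS dvdn_addr ?dvdn_mull //.
  have ltB : q %% B < B by rewrite ltn_mod.
  rewrite -leqNgt; apply/idP/idP => [|h]; first exact: dvdn_leq.
  by rewrite (_ : _.+1 = B) //; apply/eqP; rewrite eqn_leq ltB h.
have [dP|ndP] := boolP (B ^ i %| c.+1); last first.
  by rewrite add0n /=; split=> //; apply: contraNF ndP; apply: dvdn_trans; rewrite expnS dvdn_mull.
rewrite /= add1n modnS qE; split; first by case: ltnP.
have -> : c.+1 = q.+1 * B ^ i by rewrite -[in LHS](divnK dP) divnS // dP.
by rewrite expnS dvdn_pmul2r // qE.
Qed.

Lemma digit_word B len w : (forall i, w i < B) ->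
  exists2 c, c < B ^ len & forall i, i < len -> digit B c i = w i.
Proof.
elim: len w => [|len IH] w hw; first by exists 0.
have [|c cB hc] := IH (fun i => w i.+1); first by move=> i; apply: hw.
have B0 : 0 < B by apply: leq_ltn_trans (hw 0).
exists (c * B + w 0).
  rewrite expnSr; apply: (@leq_trans (c.+1 * B)); last by rewrite leq_mul2r cB orbT.
  by rewrite mulSnr ltn_add2l.
case=> [_|i]; first by rewrite /digit expn0 divn1 modnMDl modn_small.
rewrite ltnS => li; rewrite /digit expnS divnMA.
have -> : (c * B + w 0) %/ B = c by rewrite divnMDl // divn_small ?addn0.
exact: hc.
Qed.

(** The position in the list reached before letter [i] is read: every letter advances by its value,
    and a selecting letter by one more. *)
Fixpoint pos m (w : nat -> nat) i :=
  if i is i'.+1 then pos m w i' + w i' + (w i' < m) else 0.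

Lemma pos_shift m w w' d i : w 0 = d -> (forall i, w i.+1 = w' i) ->
  pos m w i.+1 = d + (d < m) + pos m w' i.
Proof.
move=> <- h; elim: i => [|i IH]; first by rewrite /= addn0.
by rewrite [LHS]/= -/(pos m w i.+1) IH h /= !addnA.
Qed.

(* A gap [g] between consecutive elements is spelled by [g %/ m] letters [m]
   (skip [m] positions) and one letter [g %% m] (skip, then select), so that
   [size qs + N %/ m] letters of an alphabet of size [m + 1] suffice. *)
Lemma word_of_positions m len N qs p : 0 < m -> sorted ltn qs ->
    all (fun q => p <= q < N) qs -> size qs + (N - p) %/ m <= len ->
  exists2 w, forall i, w i <= m &
    forall q, q \in qs <-> exists i, [/\ i < len, w i < m & p + pos m w i + w i = q].
Proof.
move=> m0; elim: len qs p => [|len IH] qs p srt rng sz.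
  exists (fun=> 0) => // q; case: qs sz {srt rng} => // _.
  by split=> // -[i []].
have cons d w' : d <= m -> (forall i, w' i <= m) ->
    exists2 w, forall i, w i <= m & [/\ w 0 = d, forall i, w i.+1 = w' i
       & forall i, pos m w i.+1 = d + (d < m) + pos m w' i].
  move=> dm hw; exists (fun i => if i is i'.+1 then w' i' else d) => [[|i]|] //.
  by split=> // i; apply: pos_shift.
have skip : all (fun q => p + m <= q < N) qs ->
    size qs + (N - (p + m)) %/ m <= len -> exists2 w, forall i, w i <= m &
    forall q, q \in qs <-> exists i, [/\ i < len.+1, w i < m & p + pos m w i + w i = q].
  move=> rng' sz'; have [w' hw' hq] := IH qs (p + m) srt rng' sz'.
  have [w hw [w0 wS pS]] := cons m w' (leqnn m) hw'; exists w => // q; rewrite hq.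
  rewrite ltnn addn0 in pS; split=> [[i [il wi <-]]|[[|i] [il wi <-]]].
  - by exists i.+1; rewrite ltnS wS pS addnA.
  - by rewrite w0 ltnn in wi.
  - by exists i; rewrite wS in wi *; rewrite pS addnA.
have hdiv : (N - (p + m)) %/ m <= (N - p) %/ m - 1.
  rewrite subnDA; have [lt|le] := ltnP (N - p) m.
    by rewrite (_ : N - p - m = 0) ?div0n //; lia.
  by rewrite -[in leqRHS](subnK le) divnDr ?dvdnn // divnn m0 addnK.
case: qs srt rng sz skip => [|q0 qs] srt rng sz skip.
  by apply: skip => //=; move: sz hdiv; rewrite /= !add0n; lia.
have /andP[/andP[pq0 q0N] rng0] := rng.
(* A next element at distance below [m] is reached by one selecting letter, paid for by [size qs]. A
   farther one costs a skipping letter, which uses up one unit of [(N - p) %/ m]. *)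
have [lt_m|le_m] := ltnP (q0 - p) m; last first.
  apply: skip; last first.
    have : 0 < (N - p) %/ m by rewrite divn_gt0 //; lia.
    by move: sz hdiv => /=; lia.
  rewrite /= q0N (_ : p + m <= q0) /=; last by lia.
  apply/allP => x xq; have /allP/(_ x xq)/andP[_ ->] := rng0.
  have /allP/(_ x xq) := order_path_min ltn_trans srt; lia.
have [|||w' hw' hq] := IH qs q0.+1.
- exact: path_sorted srt.
- apply/allP => x xq; have /allP/(_ x xq)/andP[_ ->] := rng0.
  by have /allP/(_ x xq) := order_path_min ltn_trans srt => /= ->.
- apply: leq_trans (_ : size qs + (N - p) %/ m <= _); last by move: sz => /=; lia.
  by rewrite leq_add2l leq_div2r //; lia.
have [w hw [w0 wS pS]] := cons (q0 - p) w' (ltnW lt_m) hw'; exists w => // q.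
rewrite lt_m in pS; rewrite in_cons; split.
  case/orP => [/eqP->|/hq[i [il wi <-]]].
    by exists 0; rewrite w0 /= addn0 subnKC.
  by exists i.+1; rewrite ltnS wS pS; split=> //; rewrite -addnA addnA; lia.
case=> -[|i] [il wi <-]; first by rewrite w0 /= addn0 subnKC // eqxx.
apply/orP; right; apply/hq; exists i; rewrite wS in wi *; split=> //.
by rewrite pS; lia.
Qed.

Local Open Scope ring_scope.

Section SearchSpec.
Variables (R : realFieldType) (n r : nat) (G : wgraph R n).
Variables (F : 'I_r -> {set 'I_n}) (b : 'I_r -> nat) (eps : R) (K : nat).
Hypothesis nK : (n <= K)%N.
Hypothesis rK : (r <= K)%N.
Implicit Types s : state R.
Notation has_input := (has_input G F b eps).

Definition plist (part : nat -> nat) i := [seq u <- iota 0 i | part u != 0%N].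

Lemma p_listP s : has_input s ->
  ok K p_list s (fun s' => let l := plist (fun u => ntab s 4 u 0) n in
    ntab s' 19 0 0 = size l /\
    forall p, (p < size l)%N -> ntab s' 18 p 0 = nth 0%N l p).
Proof.
move=> hi; rewrite /p_list; st; set s2 := State _ _.
have hi2 : has_input s2 by apply: has_input_upd.
have e4 : ntab s2 4 = ntab s 4 by [].
have e19 : ntab s2 19 0 0 = 0%N by [].
clearbody s2; pose l i := plist (fun u => ntab s 4 u 0) i.
apply: (ok_for (Inv := fun i s' => ntab s' 19 0 0 = size (l i) /\
    forall p, (p < size (l i))%N -> ntab s' 18 p 0 = nth 0%N (l i) p)) => //.
- by rewrite (in_n hi2).
- rewrite (in_n hi2) => i s3 iN [fn fw] ei [h1 h2].
  have lS : l i.+1 = if ntab s 4 i 0 != 0%N then rcons (l i) i else l i.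
    rewrite /l /plist -[i.+1]addn1 iotaD filter_cat /= add0n.
    by case: ifP; rewrite ?cats1 ?cats0.
  apply: ok_if => /=; rewrite ei fn // e4 lt0n => hc; st; nrm.
    rewrite lS hc size_rcons; split=> [|p]; first by rewrite h1 addn1.
    rewrite ltnS nth_rcons leq_eqVlt h1 ei andbT => /orP[/eqP->|lp].
      by rewrite eqxx ltnn.
    by rewrite (ltn_eqF lp) lp h2.
  by rewrite lS (negPf hc).
- by rewrite (in_n hi2).
Qed.

Lemma p_lenP s : has_input s ->
  ok K p_len s (fun s' => ntab s' 32 0 0 = (2 * #|bins (@partf R n s) 0|)%N).
Proof.
move=> hi; rewrite /p_len; st; set s2 := State _ _.
have hi2 : has_input s2 by apply: has_input_upd.
have e4 : ntab s2 4 = ntab s 4 by [].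
have e32 : ntab s2 32 0 0 = 0%N by [].
clearbody s2.
apply: (ok_for (Inv := fun i s' => ntab s' 32 0 0 =
   (2 * \sum_(0 <= u < i) (ntab s 4 u 0 == 1))%N)) => //.
- by rewrite (in_n hi2).
- by rewrite big_geq.
- rewrite (in_n hi2) => i s3 iN [fn fw] ei h1.
  apply: ok_if => /=; rewrite ei fn // e4 -eqn_leq => hc; st; nrm; rewrite big_nat_recr //= h1.
    by rewrite hc /= mulnDr.
  by rewrite (negPf hc) addn0.
- rewrite (in_n hi2) => s' _ ->; congr (_ * _)%N.
  by apply: sum_nat_card => u; rewrite inE.
Qed.

Lemma p_clearP s : has_input s -> ok K p_clear s (fun s' => tset n 13 s' = set0).
Proof.
move=> hi; rewrite /p_clear.
apply: (ok_for (Inv := fun i s' => forall u : 'I_n, (u < i)%N -> ntab s' 13 u 0 = 0%N)) => //.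
- by rewrite (in_n hi).
- rewrite (in_n hi) => i s3 iN [fn fw] ei h1; st; nrm => u; rewrite ltnS ei leq_eqVlt.
  by case/orP => [/eqP->|lu]; rewrite ?eqxx //; case: eqP => // _; rewrite h1.
- by rewrite (in_n hi) => s' _ h; apply/setP => u; rewrite !inE h.
Qed.

Lemma p_copyP x y s : has_input s -> x != 20%N -> y != 20%N -> x != y -> x != 0%N ->
  ok K (p_copy x y) s (fun s' => tset n x s' = tset n y s).
Proof.
move=> hi nx ny nxy x0; rewrite /p_copy.
apply: (ok_for (Inv := fun i s' => forall u : 'I_n, (u < i)%N -> ntab s' x u 0 = ntab s y u 0)) => //.
- by rewrite (in_n hi).
- by rewrite /= inE; rewrite eq_sym in nx.
- by rewrite /= !inE /=; rewrite eq_sym in x0.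
- rewrite (in_n hi) => i s3 iN [fn fw] ei h1; st; rewrite /sc /= ei fn; last first.
    by rewrite !inE !negb_or ny [y == x]eq_sym nxy.
  move=> u; rewrite ltnS leq_eqVlt /upd (negPf nx) /= eqxx /=.
  by case/orP => [/eqP->|lu]; rewrite ?eqxx // (ltn_eqF lu) h1.
- by rewrite (in_n hi) => s' _ h; apply/setP => u; rewrite !inE h.
Qed.

Lemma p_covP s : has_input s ->
  ok K p_cov s (fun s' => wtab s' 12 0 0 = cov2 (wmx G) (tset n 13 s)).
Proof.
move=> hi; rewrite /p_cov; st; set s2 := State _ _.
have hi2 : has_input s2 by apply: has_input_wupd.
have e13 : ntab s2 13 = ntab s 13 by [].
have e12 : wtab s2 12 0 0 = 0 by [].
clearbody s2; pose term u v : R :=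
  if (ntab s 13 u 0 != 0%N) || (ntab s 13 v 0 != 0%N) then wtab s2 1 u v else 0.
apply: (ok_for (Inv := fun i s' => wtab s' 12 0 0 =
   \sum_(0 <= u < i) \sum_(0 <= v < n) term u v)) => //.
- by rewrite (in_n hi2).
- by rewrite big_geq.
- rewrite (in_n hi2) => i s3 iN fr ei h1.
  have hi3 : has_input s3 by apply: has_input_frame fr _ hi2.
  apply: (ok_for (Inv := fun j s' => wtab s' 12 0 0 =
     \sum_(0 <= u < i) \sum_(0 <= v < n) term u v + \sum_(0 <= v < j) term i v)) => //.
  + by rewrite (in_n hi3).
  + by rewrite [X in _ + X]big_geq // addr0.
  + rewrite (in_n hi3) => j s4 jN [fn fw] ej h2.
    have f13 : ntab s4 13 = ntab s 13 by rewrite fn // (proj1 fr).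
    have f1 : wtab s4 1 = wtab s2 1 by rewrite fw // (proj2 fr).
    have f20 : ntab s4 20 0 0 = i by rewrite fn.
    apply: ok_if => /=; rewrite f13 f20 ej !lt0n => hc; st; nrm; rewrite big_nat_recr //= h2.
      rewrite f1 f20 ej addrA; congr (_ + _ + _); rewrite /term; move: hc.
      by rewrite negb_and !negbK => ->.
    by rewrite addrA [term i j](_ : _ = 0) ?addr0 // /term; move: hc; rewrite negbK -negb_or => /negPf ->.
  + by rewrite (in_n hi3) => s5 _ h; rewrite big_nat_recr.
- rewrite (in_n hi2) => s' _ ->; rewrite big_mkord; apply: eq_bigr => u _.
  by rewrite big_mkord; apply: eq_bigr => v _; rewrite /term !inE (in_w u v hi2).
Qed.

Lemma p_incP s B len c : (len <= K)%N -> ntab s 32 0 0 = len -> ntab s 31 0 0 = B ->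
    (0 < B)%N -> (forall i, (i < len)%N -> ntab s 30 i 0 = digit B c i) ->
  ok K p_inc s (fun s' => (forall i, (i < len)%N -> ntab s' 30 i 0 = digit B c.+1 i) /\
    ntab s' 33 0 0 = (B ^ len %| c.+1)%N).
Proof.
move=> lenK elen eB B0 hd; rewrite /p_inc; st; set s2 := State _ _.
have el2 : ntab s2 32 0 0 = len by [].
have eB2 : ntab s2 31 0 0 = B by [].
have ec2 : ntab s2 33 0 0 = 1%N by [].
have hd2 : forall i, (i < len)%N -> ntab s2 30 i 0 = digit B c i by [].
clearbody s2.
apply: (ok_for (Inv := fun i s' =>
  [/\ forall i', (i' < i)%N -> ntab s' 30 i' 0 = digit B c.+1 i',
      forall i', (i <= i' < len)%N -> ntab s' 30 i' 0 = digit B c i'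
    & ntab s' 33 0 0 = (B ^ i %| c.+1)%N])) => //.
- by rewrite el2.
- by split=> //; rewrite /= /upd /= ec2 expn0 dvd1n.
- rewrite el2 => i s3 iN [fn fw] ei [h1 h2 h3].
  have f31 : ntab s3 31 0 0 = B by rewrite fn.
  have di : ntab s3 30 i 0 = digit B c i by rewrite h2 ?leqnn.
  have [dS dvS] := digit_succ c i B0.
  have fin a (f : nat -> nat -> nat -> nat) :
      a = digit B c.+1 i -> (forall i', f 30 i' 0 = if i' == i then a else ntab s3 30 i' 0)%N ->
      (forall i', (i' < i.+1)%N -> f 30 i' 0 = digit B c.+1 i')%N /\
      (forall i', (i.+1 <= i' < len)%N -> f 30 i' 0 = digit B c i')%N.
    move=> -> hf; split=> i'; rewrite hf.
      by rewrite ltnS leq_eqVlt => /orP[/eqP->|li]; rewrite ?eqxx // (ltn_eqF li) h1.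
    case/andP=> li il; rewrite (gtn_eqF li) h2 // (ltnW li) //.
  apply: ok_if => /=; rewrite h3 => hc.
    have {}hc : (B ^ i %| c.+1)%N by move: hc; case: (B ^ i %| c.+1)%N.
    rewrite hc in dS; rewrite hc andTb in dvS.
    apply: ok_if => /=; rewrite ei di f31 !addn1 => hb; st; rewrite /sc /= ei ?di ?addn1.
      rewrite hb in dS; rewrite hb in dvS.
      have [|E1 E2] := fin (digit B c i).+1
        (upd (upd (upd (ntab s3) 30 i 0 (digit B c i).+1) 33 0 0 0) 21 0 0 i.+1)%N (esym dS).
        by move=> i'; rewrite /upd /= andbT.
      by split; [exact: E1 | exact: E2 | rewrite /upd /= dvS].
    rewrite (negPf hb) in dS; rewrite hb in dvS.
    have [|E1 E2] := fin 0%N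
        (upd (upd (ntab s3) 30 i 0 0) 21 0 0 i.+1)%N (esym dS).
      by move=> i'; rewrite /upd /= andbT.
    by split; [exact: E1 | exact: E2 | rewrite /upd /= h3 hc dvS].
  have {}hc : (B ^ i %| c.+1)%N = false by move: hc; case: (B ^ i %| c.+1)%N.
  rewrite hc in dS; rewrite hc andFb in dvS; st.
  have [|E1 E2] := fin (digit B c i) (upd (ntab s3) 21 0 0 i.+1)%N (esym dS).
    by move=> i'; rewrite /upd /=; case: eqP => // ->.
  by split; [exact: E1 | exact: E2 | rewrite /upd /= h3 hc dvS].
- by rewrite el2 => s' _ [h1 _ h3].
Qed.

End SearchSpec.

(** * Decoding words into vertex sets *)

Section Decoding.
Variables (R : realFieldType) (n r : nat) (G : wgraph R n) (M : matroid n).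
Variables (F : 'I_r -> {set 'I_n}) (b : 'I_r -> nat) (eps : R) (K : nat).
Hypothesis nK : (n <= K)%N.
Hypothesis rK : (r <= K)%N.
Implicit Types s : state R.
Notation has_input := (has_input G F b eps).

Definition decodeL m NV (L : nat -> nat) len (w : nat -> nat) : {set 'I_n} :=
  [set v : 'I_n | [exists i : 'I_len,
     [&& w i < m, pos m w i + w i < NV & L (pos m w i + w i) == v]%N]].

Definition decodeT NV (L : nat -> nat) (w : nat -> nat) : {set 'I_n} :=
  [set v : 'I_n | [exists i : 'I_r, [&& w i < NV, L (w i) == v & v \in F i]%N]].

Definition decode lam m NV L len w :=
  if lam then decodeL m NV L len w else decodeT NV L w.

Lemma pos_ext m w w' i : (forall j, (j < i)%N -> w j = w' j) -> pos m w i = pos m w' i.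
Proof.
elim: i => //= i IH h; rewrite IH ?h // => j ji; exact/h/ltnW.
Qed.

Lemma decode_ext lam m NV L len w w' : (~~ lam -> len = r) ->
    (forall i, (i < len)%N -> w i = w' i) ->
  decode lam m NV L len w = decode lam m NV L len w'.
Proof.
move=> hr h; rewrite /decode; case: lam hr => [_|/(_ isT) hr]; apply/setP => v;
  rewrite !inE; apply: eq_existsb => i.
  rewrite h // (@pos_ext m w w') // => j ji.
  by apply: h; apply: ltn_trans ji (ltn_ord i).
by rewrite h // hr.
Qed.

Lemma p_decLP s len (hM : forall S, S \in indep M <-> bounded_indep F b S) :
    has_input s -> (len <= K)%N -> ntab s 32 0 0 = len ->
  ok K p_decL s (fun s' =>
    tset n 13 s' = decodeL (ntab s 10 0 0) (ntab s 19 0 0) (fun p => ntab s 18 p 0) len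
                     (fun i => ntab s 30 i 0) /\
    (ntab s' 14 0 0 != 0%N) = (tset n 13 s' \in indep M)).
Proof.
move=> hi lenK elen; rewrite /p_decL.
apply: ok_seq; apply: ok_imp (p_clearP nK hi) _ => s1 fr1 h0.
have hi1 : has_input s1 by apply: has_input_frame fr1 _ hi.
set m := ntab s 10 0 0; set NV := ntab s 19 0 0.
set L := fun p => ntab s 18 p 0; set w := fun i => ntab s 30 i 0.
st; set s2 := State _ _.
have hi2 : has_input s2 by apply: has_input_upd.
have e34 : ntab s2 34 0 0 = 0%N by [].
have h02 : forall u : 'I_n, ntab s2 13 u 0 = 0%N.
  move=> u; rewrite (_ : ntab s2 13 = ntab s1 13) //.
  by have := in_set0 u; rewrite -h0 inE => /negbFE/eqP.
have el : ntab s2 32 0 0 = len by rewrite -elen -(proj1 fr1 32).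
have em : ntab s2 10 0 0 = m by rewrite /m -(proj1 fr1 10).
have eNV : ntab s2 19 0 0 = NV by rewrite /NV -(proj1 fr1 19).
have eL p : ntab s2 18 p 0 = L p by rewrite /L -(proj1 fr1 18).
have ew i : ntab s2 30 i 0 = w i by rewrite /w -(proj1 fr1 30).
clearbody s2 m NV L w.
apply: (ok_for (Inv := fun i s' => ntab s' 34 0 0 = pos m w i /\
  forall u : 'I_n, (ntab s' 13 u 0 != 0%N) = [exists j : 'I_len,
    [&& j < i, w j < m, pos m w j + w j < NV & L (pos m w j + w j) == u]%N])) => //.
- by rewrite el.
- split=> // u; rewrite /= /upd /= h02 eqxx; by apply/esym/negbTE/existsP => -[j].
- rewrite el => i s3 iN [fn fw] ei [h1 h2]; pose io := Ordinal iN.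
  have f10 : ntab s3 10 0 0 = m by rewrite fn.
  have f19 : ntab s3 19 0 0 = NV by rewrite fn.
  have f30 j : ntab s3 30 j 0 = w j by rewrite fn.
  have f18 p : ntab s3 18 p 0 = L p by rewrite fn.
  (* Here [u] is any natural number, so the equation can be rewritten under coercions; its last
     disjunct is a tautological filler for [u >= n], where the invariant says nothing. *)
  have step u : [exists j : 'I_len,
        [&& j < i.+1, w j < m, pos m w j + w j < NV & L (pos m w j + w j) == u]%N] =
      (ntab s3 13 u 0 != 0%N) && (u < n)%N ||
      [&& (u < n)%N, w i < m, pos m w i + w i < NV & L (pos m w i + w i) == u]%N
      || (n <= u)%N && [exists j : 'I_len,
        [&& j < i.+1, w j < m, pos m w j + w j < NV & L (pos m w j + w j) == u]%N].
    have [un|nu] := ltnP u n; last by rewrite andbF.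
    rewrite andbT orbF andTb (h2 (Ordinal un)).
    apply/existsP/orP => [[j]|[/existsP[j /and4P[ji c1 c2 c3]]|h]].
    - rewrite ltnS leq_eqVlt => /and4P[/orP[/eqP->|ji] c1 c2 c3].
        by right; rewrite c1 c2 c3.
      by left; apply/existsP; exists j; rewrite ji c1 c2 c3.
    - by exists j; rewrite ltnS (ltnW ji) c1 c2 c3.
    - by exists io; rewrite ltnSn.
  st; apply: ok_if; rewrite /p_digit; nrm; rewrite ei f30 f10 addn1 => c1; st; last first.
    nrm; rewrite ?h1 ?ei ?f30 (negPf c1) addn0; split=> // u.
    by rewrite step (negPf c1) ltn_ord /= !andbT orbF leqNgt ltn_ord orbF.
  apply: ok_if; nrm; rewrite ?h1 ?ei ?f30 ?f19 ?addn1 => c2; st; nrm;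
    rewrite ?h1 ?ei ?f30 ?f18 c1 ?addn1; split=> // u.
    rewrite step c1 c2 ltn_ord /= andbT [(n <= u)%N]leqNgt ltn_ord orbF andbT.
    by rewrite [u == _ :> nat]eq_sym; case: (L _ == u) => /=; rewrite ?orbT ?orbF.
  by rewrite step c1 (negPf c2) ltn_ord /= andbT orbF [(n <= u)%N]leqNgt ltn_ord orbF.
- rewrite el => s3 fr3 [_ h].
  have hi3 : has_input s3 by apply: has_input_frame fr3 _ hi2.
  apply: ok_imp (p_chkLP nK rK hi3) _ => s4 fr4 ->.
  have E : tset n 13 s4 = tset n 13 s3.
    by apply/setP => u; rewrite !inE (proj1 fr4).
  rewrite (goodLE hM) E; split=> //; apply/setP => u; rewrite !inE h.
  by apply: eq_existsb => j; rewrite ltn_ord.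
Qed.

(** Matching each selected vertex to some index that selects it is injective, because an index [i]
    selects at most the one vertex [L (w i)]. *)
Lemma decodeT_indep NV L w : transversal_matroid M F -> decodeT NV L w \in indep M.
Proof.
move=> tM; apply/(transversal_indepP tM).
exists (fun v : 'I_n => [pick i : 'I_r | [&& w i < NV, L (w i) == v & v \in F i]%N]).
have P (v : 'I_n) : v \in decodeT NV L w -> exists i : 'I_r,
   [pick i : 'I_r | [&& w i < NV, L (w i) == v & v \in F i]%N] = Some i /\
   L (w i) = v /\ v \in F i.
  rewrite inE => /existsP[i hi]; case: pickP => [j /and3P[_ /eqP e1 e2]|/(_ i)].
    by exists j.
  by rewrite hi.
split=> [u v /P[i [-> [e _]]] /P[j [-> [e' _]]] [eij]|u /P[i [-> [_ ?]]]]; last by exists i.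
by apply: val_inj; rewrite /= -e -e' eij.
Qed.

Lemma p_decTP s : transversal_matroid M F -> has_input s ->
    ntab s 32 0 0 = r ->
  ok K p_decT s (fun s' =>
    tset n 13 s' = decodeT (ntab s 19 0 0) (fun p => ntab s 18 p 0)
                     (fun i => ntab s 30 i 0) /\
    (ntab s' 14 0 0 != 0%N) = (tset n 13 s' \in indep M)).
Proof.
move=> tM hi elen; rewrite /p_decT.
apply: ok_seq; apply: ok_imp (p_clearP nK hi) _ => s1 fr1 h0.
have hi1 : has_input s1 by apply: has_input_frame fr1 _ hi.
set NV := ntab s 19 0 0.
set L := fun p => ntab s 18 p 0; set w := fun i => ntab s 30 i 0.
have h02 : forall u : 'I_n, ntab s1 13 u 0 = 0%N.
  by move=> u; have := in_set0 u; rewrite -h0 inE => /negbFE/eqP.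
have el : ntab s1 32 0 0 = r by rewrite -elen -(proj1 fr1 32).
have eNV : ntab s1 19 0 0 = NV by rewrite /NV -(proj1 fr1 19).
have eL p : ntab s1 18 p 0 = L p by rewrite /L -(proj1 fr1 18).
have ew i : ntab s1 30 i 0 = w i by rewrite /w -(proj1 fr1 30).
clearbody NV L w.
apply: ok_seq; apply: (ok_for (Inv := fun i s' => 
  forall u : 'I_n, (ntab s' 13 u 0 != 0%N) = [exists j : 'I_r,
    [&& j < i, w j < NV, L (w j) == u & u \in F j]%N])) => //.
- by rewrite el.
- move=> u; rewrite /= /upd /= h02 eqxx; by apply/esym/negbTE/existsP => -[j].
- rewrite el => i s3 iN fr ei h2; pose io := Ordinal iN.
  have fn := proj1 fr.
  have hi3 : has_input s3 by apply: has_input_frame fr _ hi1.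
  have f19 : ntab s3 19 0 0 = NV by rewrite fn.
  have f30 j : ntab s3 30 j 0 = w j by rewrite fn.
  have f18 p : ntab s3 18 p 0 = L p by rewrite fn.
  have step (u : 'I_n) : [exists j : 'I_r,
        [&& j < i.+1, w j < NV, L (w j) == u & u \in F j]%N] =
      (ntab s3 13 u 0 != 0%N) || [&& w i < NV, L (w i) == u & u \in F io]%N.
    rewrite h2; apply/existsP/orP => [[j]|[/existsP[j /and4P[ji c1 c2 c3]]|h]].
    - rewrite ltnS leq_eqVlt => /and4P[/orP[/eqP ji|ji] c1 c2 c3].
        by right; rewrite -ji c1 c2 (_ : io = j) //; apply: val_inj.
      by left; apply/existsP; exists j; rewrite ji c1 c2 c3.
    - by exists j; rewrite ltnS (ltnW ji) c1 c2 c3.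
    - by exists io; rewrite ltnSn.
  have FE : (w i < NV)%N -> forall u : 'I_n, L (w i) = u ->
      (0 < ntab s3 2 i (L (w i)))%N = (u \in F io).
    by move=> c1 u ->; rewrite (in_F io u hi3); case: (u \in F io).
  apply: ok_if; rewrite /p_digit; nrm; rewrite ei f30 f19 f18 addn1 => hc; st; nrm => u.
    have /andP[c1 c2] := hc; rewrite step c1 /= ei f30 f18 andbT.
    rewrite [L _ == _]eq_sym; case: (eqVneq (u : nat) (L (w i))) => [e|_] /=;
      last by rewrite orbF.
    by rewrite -(FE c1 u (esym e)) c2 orbT.
  rewrite step; case: ltnP hc => //= c1 c2; last by rewrite orbF.
  case: (eqVneq (L (w i)) u) => [e|_] /=; last by rewrite orbF.
  by rewrite -(FE c1 u e) (negPf c2) orbF.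
- rewrite el => s3 fr3 h; st; nrm.
  have E : tset n 13 s3 = decodeT NV L w.
    by apply/setP => u; rewrite !inE h; apply: eq_existsb => j; rewrite ltn_ord.
  set s4 := State _ _; have -> : tset n 13 s4 = tset n 13 s3 by [].
  by rewrite E decodeT_indep.
Qed.

End Decoding.

Local Close Scope ring_scope.

Definition p_body lam : prog :=
  Seq (p_dec lam) (Seq (If (TNz (sc 14))
    (Seq p_cov (If (WLe (WGet 13 (NCst 0) (NCst 0)) (WGet 12 (NCst 0) (NCst 0)))
       (Seq (WSet 13 (NCst 0) (NCst 0) (WGet 12 (NCst 0) (NCst 0))) (p_copy 35 13)) Skip))
    Skip) p_inc).

Definition p_enum lam : prog := While (NLe (sc 33) (NCst 0)) (p_body lam).

Definition p_search lam : prog :=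
  Seq p_list (Seq (if lam then p_len else setn 32 (NGet 0 (NCst 0) (NCst 1)))
  (Seq (setn 31 (NAdd (if lam then sc 10 else sc 19) (NCst 1)))
  (Seq (p_enum lam) (p_copy 4 35)))).

Definition p_solve lam : prog :=
  Seq (p_kernel lam)
    (if lam then If (NLe (sc 10) (NCst 1)) Skip (p_search true) else p_search false).

Local Open Scope ring_scope.

(** * The loop over all words *)

Section Enumeration.
Variables (R : realFieldType) (n r : nat) (G : wgraph R n) (M : matroid n).
Variables (F : 'I_r -> {set 'I_n}) (b : 'I_r -> nat) (eps : R) (K : nat).
Hypothesis nK : (n <= K)%N.
Hypothesis rK : (r <= K)%N.
Variable lam : bool.
Hypothesis hM : if lam then forall S, S \in indep M <-> bounded_indep F b S
                else transversal_matroid M F.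
Implicit Types s : state R.
Notation has_input := (has_input G F b eps).
Notation cov := (cov2 (wmx G)).

Lemma p_decP s len : has_input s -> (len <= K)%N -> ntab s 32 0 0 = len ->
    (~~ lam -> len = r) ->
  ok K (p_dec lam) s (fun s' =>
    tset n 13 s' = @decode n r F lam (ntab s 10 0 0) (ntab s 19 0 0) (fun p => ntab s 18 p 0) len
                     (fun i => ntab s 30 i 0) /\
    (ntab s' 14 0 0 != 0%N) = (tset n 13 s' \in indep M)).
Proof.
move=> hi lenK elen hr; move: hM hr; rewrite /p_dec /decode; case: lam => [hL _|hT hr].
  by apply: (p_decLP nK rK hL hi lenK elen).
by rewrite hr // in elen; apply: (p_decTP nK rK hT hi elen).
Qed.

Lemma cov2_set0 : cov set0 = 0.
Proof. by rewrite cov2_covered /covered big1 ?mulr0 // => e; rewrite setI0 eqxx andbF. Qed.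

Lemma p_enumP s0 len B : has_input s0 -> (len <= K)%N -> ntab s0 32 0 0 = len ->
    (~~ lam -> len = r) -> ntab s0 31 0 0 = B -> (0 < B)%N ->
    (forall i, ntab s0 30 i 0 = 0%N) -> ntab s0 33 0 0 = 0%N ->
    tset n 35 s0 = set0 -> wtab s0 13 0 0 = 0 ->
  exists t s', [/\ runs (p_enum lam) s0 t s',
     (t <= (cost K (p_body lam)).+1 * B ^ len + 1)%N,
     tset n 35 s' \in indep M &
     forall w, (forall i, w i < B)%N ->
       let D := @decode n r F lam (ntab s0 10 0 0) (ntab s0 19 0 0) (fun p => ntab s0 18 p 0) len w in
       D \in indep M -> cov D <= cov (tset n 35 s')].
Proof.
move=> hi lenK elen hr eB B0 h30 h33 h35 hw.
pose D w := @decode n r F lam (ntab s0 10 0 0) (ntab s0 19 0 0) (fun p => ntab s0 18 p 0) len w.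
pose keep := [:: 10; 18; 19; 31; 32]%N.
have N0 : (0 < B ^ len)%N by rewrite expn_gt0 B0.
(* After [c] rounds the current word is [c] written in base [B], and the stored set is at least as
   good as all earlier independent ones. The conjunct [0 < c] accounts for the start: the flag is 0
   although every power divides 0. *)
pose Inv c s := [/\ has_input s, forall x, x \in keep -> ntab s x = ntab s0 x,
  forall i, (i < len)%N -> ntab s 30 i 0 = digit B c i,
  ntab s 33 0 0 = ((0 < c) && (B ^ len %| c))%N &
  [/\ tset n 35 s \in indep M, wtab s 13 0 0 = cov (tset n 35 s) &
   forall c', (c' < c)%N -> D (digit B c') \in indep M ->
     cov (D (digit B c')) <= cov (tset n 35 s)]].
have kept x : x \in keep -> all (fun y => y \notin nmods (p_body lam)) keep ->
    forall s s', frame (p_body lam) s s' -> ntab s' x = ntab s x.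
  by move=> xk /allP h s s' [fn _]; apply/fn/h.
have kb : all (fun y => y \notin nmods (p_body lam)) keep by case: (lam).
have [||||t [s' [rn le [_ _ _ _ [iT _ hT]]]]] := @runs_while_count R (NLe (sc 33) (NCst 0)) (p_body lam)
    s0 (B ^ len) Inv (cost K (p_body lam)).
- split=> // [i il|]; first by rewrite h30 /digit div0n mod0n.
  by rewrite h35 cov2_set0; split=> //; apply: indep0.
- move=> c s cN [_ _ _ hc _]; rewrite /= hc.
  by case: posnP => //= c0; rewrite gtnNdvd.
- by move=> s [_ _ _ hc _]; rewrite /= hc N0 dvdnn.
- move=> c s cN [his hk hd hc [hI hwt hbest]].
  suff [t1 [s1 [rn1 le1 h1]]] : ok K (p_body lam) s (fun s' => Inv c.+1 s').
    by exists t1, s1.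
  have fin : ok K (p_body lam) s (fun s' =>
     [/\ forall i, (i < len)%N -> ntab s' 30 i 0 = digit B c.+1 i,
         ntab s' 33 0 0 = (B ^ len %| c.+1)%N
       & [/\ tset n 35 s' \in indep M, wtab s' 13 0 0 = cov (tset n 35 s') &
           cov (tset n 35 s) <= cov (tset n 35 s') /\
           (D (digit B c) \in indep M -> cov (D (digit B c)) <= cov (tset n 35 s'))]]).
    rewrite /p_body; have elen' : ntab s 32 0 0 = len by rewrite hk.
    apply: ok_seq; apply: ok_imp (p_decP his lenK elen' hr) _ => s1 fr1 [hX hF].
    have {}hX : tset n 13 s1 = D (digit B c).
      by rewrite hX (hk 10) // (hk 19) // (hk 18) // /D; apply: decode_ext.
    have hi1 : has_input s1 by apply: has_input_frame fr1 _ his; case: (lam).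
    have T1 : tset n 35 s1 = tset n 35 s.
      by apply/setP => u; rewrite !inE (proj1 fr1) //; case: (lam).
    have w1 : wtab s1 13 0 0 = cov (tset n 35 s) by rewrite (proj2 fr1) //; case: (lam).
    have l1 : ntab s1 32 0 0 = len by rewrite (proj1 fr1) //; case: (lam).
    have b1 : ntab s1 31 0 0 = B by rewrite (proj1 fr1) ?hk //; case: (lam).
    have d1 i : (i < len)%N -> ntab s1 30 i 0 = digit B c i.
      by move=> il; rewrite (proj1 fr1) ?hd //; case: (lam).
    apply: ok_seq.
    pose Q s2 := [/\ tset n 35 s2 \in indep M, wtab s2 13 0 0 = cov (tset n 35 s2) &
           cov (tset n 35 s) <= cov (tset n 35 s2) /\
           (D (digit B c) \in indep M -> cov (D (digit B c)) <= cov (tset n 35 s2))].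
    apply: (@ok_imp _ _ _ _ Q); last first.
      move=> s2 fr2 hQ.
      have l2 : ntab s2 32 0 0 = len by rewrite (proj1 fr2).
      have b2 : ntab s2 31 0 0 = B by rewrite (proj1 fr2).
      have d2 i : (i < len)%N -> ntab s2 30 i 0 = digit B c i.
        by rewrite (proj1 fr2) //; apply: d1.
      apply: ok_imp (p_incP lenK l2 b2 B0 d2) _ => s3 fr3 [h1 h2].
      have T3 : tset n 35 s3 = tset n 35 s2.
        by apply/setP => u; rewrite !inE (proj1 fr3).
      by split=> //; rewrite T3 (proj2 fr3).
    apply: ok_if => /=; rewrite lt0n hF hX => hc1; last first.
      by st; rewrite /Q T1 w1; split=> //; split=> // h; case/negP: hc1.
    apply: ok_seq; apply: ok_imp (p_covP nK hi1) _ => s2 fr2; rewrite hX => hcov.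
    have T2 : tset n 35 s2 = tset n 35 s.
      by rewrite -T1; apply/setP => u; rewrite !inE (proj1 fr2).
    have X2 : tset n 13 s2 = D (digit B c).
      by rewrite -hX; apply/setP => u; rewrite !inE (proj1 fr2).
    have w2 : wtab s2 13 0 0 = cov (tset n 35 s) by rewrite (proj2 fr2).
    have hi2 : has_input s2 by apply: has_input_frame fr2 _ hi1.
    apply: ok_if => /=; rewrite hcov w2 => hle; last first.
      by st; rewrite /Q T2 w2; split=> //; split=> // _; apply: ltW; rewrite ltNge.
    st; match goal with |- ok _ _ ?x _ => set s3 := x end.
    have hi3 : has_input s3 by apply: has_input_wupd.
    have X3 : tset n 13 s3 = D (digit B c) by [].
    have w3 : wtab s3 13 0 0 = cov (D (digit B c)) by [].
    apply: ok_imp (p_copyP nK hi3 _ _ _ _) _ => // s4 fr4 T4.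
    by rewrite /Q T4 X3 (proj2 fr4) // w3; split.
  apply: ok_imp fin _ => s1 fr1 [hd1 hc1 [hI1 hwt1 [hm1 hb1]]]; split=> //.
  + by apply: has_input_frame fr1 _ his; case: (lam).
  + by move=> x xk; rewrite (kept x xk kb _ _ fr1) hk.
  + split=> // c'; rewrite ltnS leq_eqVlt => /orP[/eqP->|lc]; first exact: hb1.
    by move=> /(hbest _ lc) h; apply: le_trans h hm1.
exists t, s'; split=> // w wB DE; have [c cN hc] := digit_word len wB.
have -> : DE = D (digit B c) by apply: decode_ext => // i il; rewrite hc.
exact: hT.
Qed.

End Enumeration.

(** * Time bounds scaled by the number of words *)

Section ScaledTime.
Variables (R : realFieldType) (K : nat) (X : R).
Hypothesis X1 : 1 <= X.
Implicit Types s : state R.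

(** The syntactic cost charges [K] iterations per loop, too few for the enumeration. The factor [X],
    an upper bound on the number of words, makes up for it and still composes along the program. *)
Definition okx p s (Q : state R -> Prop) :=
  exists t s', [/\ runs p s t s', t%:R <= (cost K p)%:R * X & Q s'].

Lemma ok_okx p s Q : ok K p s Q -> okx p s Q.
Proof.
move=> [t [s' [rn le h]]]; exists t, s'; split=> //.
by apply: (@le_trans _ _ (cost K p)%:R); rewrite ?ler_nat // ler_peMr.
Qed.

Lemma okx_seq p q s Q : okx p s (fun s' => okx q s' Q) -> okx (Seq p q) s Q.
Proof.
move=> [t1 [s1 [rn1 le1 [t2 [s2 [rn2 le2 h]]]]]]; exists (t1 + t2)%N, s2; split=> //.
  exact: RunSeq rn1 rn2.
by rewrite /= !natrD mulrDl lerD.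
Qed.

Lemma okx_if c p q s Q : (teval s c -> okx p s Q) -> (~~ teval s c -> okx q s Q) ->
  okx (If c p q) s Q.
Proof.
have h0 a : 0 <= (cost K a)%:R * X by rewrite mulr_ge0 // (le_trans ler01).
have E1 : (cost K (If c p q))%:R * X = X + ((cost K p)%:R * X + (cost K q)%:R * X).
  by rewrite /= -addn1 natrD natrD; ring.
move=> hp hq; case E: (teval s c).
  have [t [s' [rn le h]]] := hp E; exists t.+1, s'; split=> //.
    by apply: RunIf; rewrite E.
  by rewrite E1 -add1n natrD lerD // ler_wpDr.
have [t [s' [rn le h]]] := hq (negbT E); exists t.+1, s'; split=> //.
  by apply: RunIf; rewrite E.
by rewrite E1 -add1n natrD lerD // ler_wpDl.
Qed.

Lemma okx_imp p s (Q Q' : state R -> Prop) :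
  okx p s Q -> (forall s', frame p s s' -> Q s' -> Q' s') -> okx p s Q'.
Proof.
move=> [t [s' [rn le h]]] hQ; exists t, s'; split=> //.
by apply: hQ => //; apply: runs_frame rn.
Qed.

End ScaledTime.

Section Search.
Variables (R : realFieldType) (n r : nat) (G : wgraph R n) (M : matroid n).
Variables (F : 'I_r -> {set 'I_n}) (b : 'I_r -> nat) (eps : R) (K : nat) (X : R).
Hypothesis nK : (n <= K)%N.
Hypothesis rK : (r <= K)%N.
Hypothesis K0 : (0 < K)%N.
Hypothesis X1 : 1 <= X.
Implicit Types s : state R.
Notation has_input := (has_input G F b eps).
Notation cov := (cov2 (wmx G)).

Lemma decode_extL lam m NV L L' len w : (forall p, (p < NV)%N -> L p = L' p) ->
  @decode n r F lam m NV L len w = @decode n r F lam m NV L' len w.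
Proof.
move=> h; rewrite /decode; case: lam; apply/setP => v; rewrite !inE;
  apply: eq_existsb => i.
  by case: (w i < m)%N => //=; case: ltnP => //= lt; rewrite h.
by case: ltnP => //= lt; rewrite h.
Qed.

Lemma p_searchP lam s len B :
    (if lam then forall S, S \in indep M <-> bounded_indep F b S
     else transversal_matroid M F) ->
    has_input s -> (len <= K)%N ->
    let l := plist (fun u => ntab s 4 u 0) n in
    len = (if lam then 2 * #|bins (@partf R n s) 0| else r)%N ->
    B = (if lam then ntab s 10 0 0 else size l).+1 ->
    (B ^ len)%:R <= X ->
    (forall i, ntab s 30 i 0 = 0%N) -> ntab s 33 0 0 = 0%N ->
    (forall u, ntab s 35 u 0 = 0%N) -> wtab s 13 0 0 = 0 ->
  okx K X (p_search lam) s (fun s' => let T := tset n 4 s' in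
    T \in indep M /\ forall w, (forall i, w i < B)%N ->
      let D := @decode n r F lam (ntab s 10 0 0) (size l) (nth 0%N l) len w in
      D \in indep M -> cov D <= cov T).
Proof.
move=> hM hi lenK l elen eB BX h30 h33 h35 hw; rewrite /p_search.
apply: okx_seq; apply: ok_okx => //.
apply: ok_imp (p_listP nK hi) _ => s1 fr1 [hNV hL].
have hi1 : has_input s1 by apply: has_input_frame fr1 _ hi.
apply: okx_seq; apply: ok_okx => //.
have hlen : ok K (if lam then p_len else setn 32 (NGet 0 (NCst 0) (NCst 1))) s1
    (fun s' => ntab s' 32 0 0 = len).
  rewrite elen; case: (lam).
    apply: ok_imp (p_lenP nK hi1) _ => s2 fr2 ->.
    by rewrite (_ : bins (@partf R n s1) 0 = bins (@partf R n s) 0) // /bins /partf (proj1 fr1).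
  by st; rewrite /= /upd /= (in_r hi1).
apply: ok_imp hlen _ => s2 fr2 e32.
have f2 x : x \in [:: 4; 10; 18; 19; 30; 33; 35]%N -> ntab s2 x = ntab s1 x.
  by move=> hx; apply: (proj1 fr2); move: hx; case: (lam); rewrite !inE;
     do ?[case/orP]; move=> /eqP->.
have f1 x : x \in [:: 4; 10; 30; 33; 35]%N -> ntab s1 x = ntab s x.
  by rewrite !inE => hx; apply: (proj1 fr1); move: hx; do ?[case/orP]; move=> /eqP->.
have hi2 : has_input s2 by apply: has_input_frame fr2 _ hi1; case: (lam).
have e10 : ntab s2 10 0 0 = ntab s 10 0 0 by rewrite f2 ?f1.
have e19 : ntab s2 19 0 0 = size l by rewrite f2.
have e18 p : (p < size l)%N -> ntab s2 18 p 0 = nth 0%N l p by rewrite f2 //; apply: hL.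
have w2 : wtab s2 13 0 0 = 0.
  by rewrite (proj2 fr2); [rewrite (proj2 fr1) | case: (lam)].
apply: okx_seq; apply: ok_okx => //; apply: ok_nset.
match goal with |- okx _ _ _ ?x _ => set s3 := x end.
have hi3 : has_input s3 by apply: has_input_upd.
have l3 : ntab s3 32 0 0 = len by [].
have B3 : ntab s3 31 0 0 = B.
  by rewrite /s3 /upd /= eB; case: (lam); rewrite /= ?e10 ?e19 addn1.
have h303 : forall i, ntab s3 30 i 0 = 0%N.
  by move=> i; rewrite (_ : ntab s3 30 = ntab s 30) ?h30 // -f1 // -f2.
have h333 : ntab s3 33 0 0 = 0%N.
  by rewrite (_ : ntab s3 33 = ntab s 33) ?h33 // -f1 // -f2.
have h353 : tset n 35 s3 = set0.
  by apply/setP => u; rewrite !inE (_ : ntab s3 35 = ntab s 35) ?h35 // -f1 // -f2.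
have w3 : wtab s3 13 0 0 = 0 by [].
have e310 : ntab s3 10 0 0 = ntab s 10 0 0 by rewrite -e10.
have e319 : ntab s3 19 0 0 = size l by rewrite -e19.
have e318 p : (p < size l)%N -> ntab s3 18 p 0 = nth 0%N l p by move=> hp; rewrite -e18.
clearbody s3.
have B0 : (0 < B)%N by rewrite eB.
have lenr : (~~ lam -> len = r)%N by rewrite elen; case: (lam).
have [t [s4 [rn le iT hT]]] := p_enumP nK rK hM hi3 lenK l3 lenr B3 B0 h303 h333 h353 w3.
apply: okx_seq; exists t, s4; split=> //.
  have N1 : (1 <= B ^ len)%N by rewrite expn_gt0 B0.
  (* Since [K] and the number of words are both positive, charging the loop for [K] iterations and
     then multiplying by the number of words is enough. *)
  apply: (@le_trans _ _ ((cost K (p_enum lam)) * B ^ len)%:R).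
    rewrite ler_nat; apply: leq_trans le _.
    rewrite /= mulnDl mul1n leq_add // -mulnA leq_mul2l orbC.
    by rewrite leq_pmull.
  by rewrite natrM ler_wpM2l.
have hi4 : has_input s4.
  by apply: has_input_frame (runs_frame rn) _ hi3; case: (lam).
apply: ok_okx => //; apply: ok_imp (p_copyP nK hi4 _ _ _ _) _ => // s5 fr5 -> /=.
split=> // w wB; move: (hT w wB) => /=.
by rewrite e310 e319 (@decode_extL _ _ _ _ (nth 0%N l)).
Qed.

Lemma mem_plist part (v : 'I_n) : ((v : nat) \in plist part n) = (part v != 0%N).
Proof. by rewrite mem_filter mem_iota /= add0n ltn_ord andbT. Qed.

Lemma size_plist (part : nat -> nat) : size (plist part n) = #|placed (fun v : 'I_n => part v)|.
Proof.
rewrite size_filter -sum1_count big_mkcond /=.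
rewrite (_ : iota 0 n = index_iota 0 n); last by rewrite /index_iota subn0.
rewrite -(@sum_nat_card n (fun u => part u != 0%N)); last by move=> u; rewrite inE.
by apply: eq_bigr => i _; case: (part i).
Qed.

(** Length [2 * k] is enough: at most [k] letters select, and a list of length at most [k * m]
    leaves room for at most [k] skips of [m] positions. *)
Lemma decodeL_surj (part : nat -> nat) m k (S : {set 'I_n}) :
    (0 < m)%N -> (#|S| <= k)%N -> S \subset placed (fun v : 'I_n => part v) ->
    (size (plist part n) <= k * m)%N ->
  exists2 w, forall i, (w i < m.+1)%N &
    let l := plist part n in decodeL n m (size l) (nth 0%N l) (2 * k) w = S.
Proof.
move=> m0 leS sS szl; set l := plist part n.
pose sel := [seq (val v) | v <- enum S].
pose qs := [seq q <- iota 0 (size l) | nth 0%N l q \in sel].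
have ul : uniq l by rewrite filter_uniq ?iota_uniq.
have sz : (size qs <= k)%N.
  have -> : size qs = size [seq u <- l | u \in sel].
    rewrite /qs -[in RHS](mkseq_nth 0%N l) /mkseq filter_map size_map.
    by congr size; apply: eq_filter.
  apply: leq_trans leS; rewrite cardE -(size_map val) -/sel.
  apply: uniq_leq_size; first exact: filter_uniq.
  by move=> u; rewrite mem_filter => /andP[].
have [|||w hw hq] := @word_of_positions m (2 * k) (size l) qs 0 m0.
- by apply: sorted_filter; [apply: ltn_trans | apply: iota_ltn_sorted].
- by apply/allP => q; rewrite mem_filter mem_iota /= add0n => /andP[].
- rewrite subn0 mul2n -addnn leq_add //.
  by rewrite -(mulnK k m0) leq_div2r.
exists w => // /=; apply/setP => v; rewrite inE; apply/existsP/idP.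
  move=> [i /and3P[wi lt /eqP e]].
  have : (pos m w i + w i)%N \in qs by apply/hq; exists i; split.
  by rewrite mem_filter e => /andP[/mapP[u uS /val_inj->] _]; rewrite -mem_enum.
move=> vS; have vl : (v : nat) \in l.
  by rewrite mem_plist; have := subsetP sS v vS; rewrite inE.
have : index (v : nat) l \in qs.
  rewrite mem_filter nth_index // mem_iota /= add0n index_mem vl andbT.
  by apply/mapP; exists v; rewrite ?mem_enum.
move=> /hq[i [il wi e]]; exists (Ordinal il) => /=; rewrite add0n in e.
by rewrite wi e index_mem vl nth_index /=.
Qed.

(** The word lists, for each index, the list position of the vertex matched to it; the extra letter
    [size l] marks unmatched indices. *)
Lemma decodeT_surj (part : nat -> nat) (S : {set 'I_n}) : transversal_matroid M F ->
    S \in indep M -> S \subset placed (fun v : 'I_n => part v) ->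
  exists2 w, forall i, (w i < (size (plist part n)).+1)%N &
    let l := plist part n in decodeT F (size l) (nth 0%N l) w = S.
Proof.
move=> tM iS sS; have [f [injf fF]] := (transversal_indepP tM S).1 iS.
set l := plist part n.
pose w i := if [pick u : 'I_n | (u \in S) && (omap val (f u) == Some i)] is Some u
  then index (val u) l else size l.
have hl (v : 'I_n) : v \in S -> (v : nat) \in l.
  by move=> vS; rewrite mem_plist; have := subsetP sS v vS; rewrite inE.
exists w => [i|/=].
  by rewrite /w ltnS; case: pickP => // u _; apply: index_size.
apply/setP => v; rewrite inE; apply/existsP/idP.
  move=> [i /and3P[]]; rewrite /w; case: pickP => [u /andP[uS _] _|_]; last by rewrite ltnn.
  by rewrite nth_index ?hl // => /eqP/val_inj <-.
move=> vS; have [i fv vF] := fF v vS; exists i; rewrite vF andbT /w.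
case: pickP => [u /andP[uS fu]|/(_ v)]; last by rewrite vS fv /= eqxx.
have -> : u = v.
  apply: injf => //; rewrite fv; move: fu; case: (f u) => //= j /eqP[/val_inj->] //.
by rewrite index_mem hl //= nth_index ?hl.
Qed.

End Search.

(** * Correctness and running time of the programs *)

Lemma partition_laminar n r (M : matroid n) (F : 'I_r -> {set 'I_n}) b :
  partition_matroid M F b -> laminar_matroid M F b.
Proof.
move=> [injF /and3P[_ /trivIsetP tF _] hM]; split=> // i j.
have [->|nij] := eqVneq i j; first by constructor 2.
constructor 1; apply: tF; rewrite ?imset_f //.
by apply: contraNneq nij => /injF->.
Qed.

(* A member of a laminar family is determined by one of its elements and its
   cardinality, because the members that contain a given element form a
   chain. *)
Lemma laminar_family_size n r (M : matroid n) (F : 'I_r -> {set 'I_n}) b :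
  laminar_matroid M F b -> (r <= 2 * n.+1 ^ 2)%N.
Proof.
move=> [injF lamF _].
(* [None] encodes the empty member. The chosen element depends only on the set, so equal codes mean
   a common element and equal cardinality. *)
pose code i : option ('I_n * 'I_n.+1) :=
  if [pick x in F i] is Some x then Some (x, inord #|F i|) else None.
have injc : injective code.
  move=> i j; rewrite /code; case: pickP => [x xi|Fi0]; case: pickP => [y yj|Fj0] //.
    have le A : (#|(A : {set 'I_n})| < n.+1)%N.
      by rewrite ltnS -[leqRHS]card_ord max_card.
    move=> [exy /(congr1 val)]; rewrite /= !inordK // => ec; apply: injF.
    case: (lamF i j) => [d|s|s]; last by apply/esym/eqP; rewrite eqEcard s ec leqnn.
      by rewrite -exy (disjointFr d) in yj.
    by apply/eqP; rewrite eqEcard s ec leqnn.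
  by move=> _; apply: injF; apply/setP => x; rewrite Fi0 Fj0.
have := leq_card code injc; rewrite card_ord card_option card_prod !card_ord; nia.
Qed.

Section Final.
Variables (R : realFieldType) (n r : nat) (G : wgraph R n) (M : matroid n).
Variables (F : 'I_r -> {set 'I_n}) (b : 'I_r -> nat) (eps : R).
Hypothesis eps0 : 0 < eps.
(** One bound for all counted loops: over vertices, over the family (a laminar one has at most [K]
    members), over the bins, and over the letters of a word, at most [2 * n] for bounded
    families. *)
Let K := (2 * n.+1 ^ 2)%N.
Notation s0 := (input G eps F b).

Let nK : (n <= K)%N. Proof. by rewrite /K; nia. Qed.
Let K0 : (0 < K)%N. Proof. by rewrite /K muln_gt0 expn_gt0. Qed.

Lemma has_input0 : has_input G F b eps s0. Proof. by split. Qed.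

Lemma approx_of_better (S T : {set 'I_n}) : approx_solution G M eps S ->
  T \in indep M -> cov2 (wmx G) S <= cov2 (wmx G) T -> approx_solution G M eps T.
Proof.
move=> [_ hS] iT; rewrite !cov2_covered ler_pM2l // => le; split=> //.
exact: le_trans hS le.
Qed.

Lemma kernelL_run : laminar_matroid M F b -> ok K (p_kernel true) s0 (fun s' =>
  approx_kernel G M eps (output n s') /\ #|output n s'|%:R <= (mrank M)%:R / eps).
Proof.
move=> lam; have rK : (r <= K)%N := laminar_family_size lam; have [_ _ hM] := lam.
apply: ok_imp (p_kernelP nK rK true has_input0 _) _ => // s' _ [hm hff].
have := kernelL eps0 hm hM hff; have := card_kernelL hM hff.
rewrite -[output n s']/(placed (@partf R n s')) => h1 h2; split=> //.
by have := @size_bound R n eps eps0 _ _ hm (mrank M) 0%N; rewrite addn0 mulr0 addr0; apply.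
Qed.

Lemma kernelT_run : transversal_matroid M F -> mrank M = r -> ok K (p_kernel false) s0 (fun s' =>
  approx_kernel G M eps (output n s') /\
  #|output n s'|%:R <= r%:R / eps + r%:R * (r%:R - 1)).
Proof.
move=> tM rE; have rn : (r <= n)%N.
  rewrite -rE /mrank; apply/bigmax_leqP => S _.
  by rewrite -[leqRHS]card_ord max_card.
have rK : (r <= K)%N by apply: leq_trans nK.
apply: ok_imp (p_kernelP nK rK false has_input0 _) _ => // s' _ [hm hff].
have h1 := kernelT eps0 hm tM rE erefl hff.
have h2 := size_kernelT eps0 hm erefl hff.
by split.
Qed.

(** For [m <= 1] the kernel lies in a single bin, so it is independent and can be returned as it is.
    Enumeration only takes place for [m >= 2], where [m + 1] is at most a power of [1 / eps]. *)
Lemma solveL_run (X : R) : laminar_matroid M F b -> X = Num.max 1 (1 / eps) ^+ (4 * mrank M) ->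
  okx K X (p_solve true) s0 (fun s' => approx_solution G M eps (output n s')).
Proof.
move=> lam XE; have rK : (r <= K)%N := laminar_family_size lam; have [_ _ hM] := lam.
have base1 : 1 <= Num.max 1 (1 / eps) :> R by rewrite le_max lexx.
have X1 : 1 <= X by rewrite XE exprn_ege1.
apply: okx_seq; apply: ok_okx => //.
apply: ok_imp (p_kernelP nK rK true has_input0 _) _ => // s1 fr1 [hm hff].
set m := ntab s1 10 0 0 in hm hff.
pose part u := ntab s1 4 u 0.
have [S [sS aS]] := kernelL eps0 hm hM hff.
have hcard := card_kernelL hM hff.
apply: okx_if => //= hm1.
  apply: ok_okx => //; apply: ok_skip.
  have iV := bin0_solution hM hff hm1.
  by apply: approx_of_better aS iV _ => //; apply: cov2_sub sS; apply: wmx_ge0.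
rewrite -ltnNge -/m in hm1; have m0 : (0 < m)%N by apply: ltnW.
have hi1 : has_input G F b eps s1 by apply: has_input_frame fr1 _ has_input0.
set k0 := #|bins (@partf R n s1) 0|.
have k0k : (k0 <= mrank M)%N.
  by apply: mrank_ge; apply: (binsL_indep hM hff (Ordinal m0)).
have kk0 : (mrank M <= k0)%N.
  by rewrite /mrank; apply/bigmax_leqP => A iA; apply: (bin0_max hM hff m0 iA).
have lenK : (2 * k0 <= K)%N.
  apply: (@leq_trans (2 * n)); last by rewrite /K; nia.
  by rewrite leq_mul2l /= -[leqRHS]card_ord max_card.
have BX : (m.+1 ^ (2 * k0))%:R <= X.
  (* This needs [m >= 2] and explains the exponent 4: [(m + 1) ^ (2 k)] is at most [m ^ (4 k)]. *)
  have mm : (m.+1 <= m ^ 2)%N by rewrite -mulnn; nia.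
  apply: (@le_trans _ _ ((m ^ 2) ^ (2 * k0))%:R).
    by rewrite !natrX lerXn2r ?nnegrE ?ler0n ?exprn_ge0 // -natrX ler_nat.
  rewrite -expnM natrX XE; apply: (@le_trans _ _ (m%:R ^+ (4 * mrank M))).
    by rewrite ler_weXn2l ?ler1n //; lia.
  rewrite lerXn2r ?nnegrE ?ler0n //; first by apply: le_trans base1.
  by rewrite le_max ler_pdivlMr //; case: hm => _ -> _; rewrite orbT.
have [fn _] := fr1.
apply: okx_imp (p_searchP (b := b) nK rK K0 X1 (lam := true) hM hi1 lenK erefl erefl BX _ _ _ _) _.
- by move=> i; rewrite fn.
- by rewrite fn.
- by move=> u; rewrite fn.
- by rewrite (proj2 fr1).
move=> s2 _ [iT hT].
have szl : (size (plist part n) <= k0 * m)%N.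
  by rewrite size_plist; apply: leq_trans hcard _; rewrite leq_mul2r kk0 orbT.
have leS : (#|S| <= k0)%N by apply: leq_trans kk0; apply: mrank_ge; case: aS.
have [w wB hw] := @decodeL_surj n part m k0 S m0 leS sS szl.
have := hT w wB; rewrite [decode _ _ _ _ _ _ _]hw => le.
exact: (approx_of_better aS iT (le (proj1 aS))).
Qed.

Lemma solveT_run (X : R) : transversal_matroid M F -> mrank M = r ->
    X = (1 / eps + r%:R) ^+ (2 * r) ->
  okx K X (p_solve false) s0 (fun s' => approx_solution G M eps (output n s')).
Proof.
move=> tM rE XE; have rn : (r <= n)%N.
  rewrite -rE /mrank; apply/bigmax_leqP => S _.
  by rewrite -[leqRHS]card_ord max_card.
have rK : (r <= K)%N by apply: leq_trans nK.
have ei0 : 0 <= 1 / eps by rewrite divr_ge0 // ltW.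
have X1 : 1 <= X.
  (* For [r = 0] the base may be below 1, but the exponent is 0. *)
  rewrite XE; case: (posnP r) => [->|r0]; first by rewrite muln0 expr0.
  by rewrite exprn_ege1 // ler_wpDl // ler1n.
apply: okx_seq; apply: ok_okx => //.
apply: ok_imp (p_kernelP nK rK false has_input0 _) _ => // s1 fr1 [hm hff].
set m := ntab s1 10 0 0 in hm hff.
pose part u := ntab s1 4 u 0.
have [S [sS aS]] := kernelT eps0 hm tM rE erefl hff.
have hcard : (size (plist part n) <= r * (m + r - 1))%N.
  by rewrite size_plist; apply: card_kernelT hff.
have hi1 : has_input G F b eps s1 by apply: has_input_frame fr1 _ has_input0.
have BX : ((size (plist part n)).+1 ^ r)%:R <= X.
  case: (posnP r) => [r0|r0]; first by rewrite {1}r0 expn0.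
  (* The alphabet has at most [r * (m + r - 1) + 1 <= (m + r) ^ 2] letters and the words have length
     [r], whence the exponent [2 * r]. *)
  apply: (@le_trans _ _ (((m + r) ^ 2) ^ r)%:R).
    rewrite ler_nat leq_exp2r //; apply: leq_trans (_ : (r * (m + r - 1)).+1 <= _)%N; first by rewrite ltnS.
    by move: r0; case: (r) => // r' _; nia.
  rewrite -expnM natrX XE lerXn2r ?nnegrE ?addr_ge0 ?ler0n // natrD lerD2r.
  by rewrite ler_pdivlMr //; case: hm.
have [fn _] := fr1.
apply: okx_imp (p_searchP (b := b) nK rK K0 X1 (lam := false) tM hi1 rK erefl erefl BX _ _ _ _) _.
- by move=> i; rewrite fn.
- by rewrite fn.
- by move=> u; rewrite fn.
- by rewrite (proj2 fr1).
move=> s2 _ [iT hT].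
have [w wB hw] := @decodeT_surj n r M F part S tM (proj1 aS) sS.
have := hT w wB; rewrite [decode _ _ _ _ _ _ _]hw => le.
exact: (approx_of_better aS iT (le (proj1 aS))).
Qed.

End Final.

Lemma computes_of_ok (R : realFieldType) n p (s : state R) c Q (post : {set 'I_n} -> Prop) :
    (cost (2 * n.+1 ^ 2) p <= c * n.+1 ^ c)%N -> ok (2 * n.+1 ^ 2) p s Q ->
    (forall s', Q s' -> post (output n s')) ->
  computes_within p s (c%:R * n.+1%:R ^+ c) post.
Proof.
move=> lec [t [s' [rn le q]]] h; exists t, s'; split=> //; last exact: h.
by rewrite -natrX -natrM ler_nat (leq_trans le).
Qed.

(** Raising [c] by 4 makes the same constant cover the polynomial factor and the exponents [4 * k]
    and [2 * k] of the number of words. *)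
Lemma computes_of_okx (R : realFieldType) n p (s : state R) (X Y : R) c Q
    (post : {set 'I_n} -> Prop) : 0 <= X -> X <= Y ->
    (cost (2 * n.+1 ^ 2) p <= c * n.+1 ^ c)%N -> okx (2 * n.+1 ^ 2) X p s Q ->
    (forall s', Q s' -> post (output n s')) ->
  computes_within p s ((c + 4)%:R * Y * n.+1%:R ^+ (c + 4)) post.
Proof.
move=> X0 leXY lec [t [s' [rn le q]]] h; exists t, s'; split=> //; last exact: h.
apply: (le_trans le); rewrite mulrAC ler_pM // -natrX -natrM ler_nat.
by apply: leq_trans lec _; rewrite leq_mul ?leq_addr // leq_pexp2l ?leq_addr.
Qed.

(* The time bounds use n + 1 instead of n so that they make sense for n = 0,
   and max(1, 1/eps) instead of 1/eps so that they make sense for eps > 1.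
   A transversal matroid comes without bounds: its bound table is constant. *)
Theorem theorem1 (R : realFieldType) :
  (* approximate kernels, in polynomial time *)
  [/\ exists (p : prog) (c : nat),
        forall (n r k : nat) (G : wgraph R n) (M : matroid n)
               (F : 'I_r -> {set 'I_n}) (b : 'I_r -> nat) (eps : R),
          0 < eps -> mrank M = k -> partition_matroid M F b ->
          computes_within p (input G eps F b) (c%:R * n.+1%:R ^+ c)
            (fun V' : {set 'I_n} => approx_kernel G M eps V' /\
               #|V'|%:R <= k%:R / eps),
      exists (p : prog) (c : nat),
        forall (n r k : nat) (G : wgraph R n) (M : matroid n)
               (F : 'I_r -> {set 'I_n}) (b : 'I_r -> nat) (eps : R),
          0 < eps -> mrank M = k -> laminar_matroid M F b ->
          computes_within p (input G eps F b) (c%:R * n.+1%:R ^+ c)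
            (fun V' : {set 'I_n} => approx_kernel G M eps V' /\
               #|V'|%:R <= 2 * k%:R / eps)
    & exists (p : prog) (c : nat),
        forall (n k : nat) (G : wgraph R n) (M : matroid n)
               (F : 'I_k -> {set 'I_n}) (eps : R),
          0 < eps -> mrank M = k -> transversal_matroid M F ->
          computes_within p (input G eps F (fun=> 1%N)) (c%:R * n.+1%:R ^+ c)
            (fun V' : {set 'I_n} => approx_kernel G M eps V' /\
               #|V'|%:R <= k%:R / eps + k%:R * (k%:R - 1))]
  /\
  (* approximate solutions *)
  [/\ exists (p : prog) (c : nat),
        forall (n r k : nat) (G : wgraph R n) (M : matroid n)
               (F : 'I_r -> {set 'I_n}) (b : 'I_r -> nat) (eps : R),
          0 < eps -> mrank M = k -> partition_matroid M F b ->
          computes_within p (input G eps F b)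
            (c%:R * Num.max 1 (1 / eps) ^+ (c * k) * n.+1%:R ^+ c)
            (approx_solution G M eps),
      exists (p : prog) (c : nat),
        forall (n r k : nat) (G : wgraph R n) (M : matroid n)
               (F : 'I_r -> {set 'I_n}) (b : 'I_r -> nat) (eps : R),
          0 < eps -> mrank M = k -> laminar_matroid M F b ->
          computes_within p (input G eps F b)
            (c%:R * Num.max 1 (1 / eps) ^+ (c * k) * n.+1%:R ^+ c)
            (approx_solution G M eps)
    & exists (p : prog) (c : nat),
        forall (n k : nat) (G : wgraph R n) (M : matroid n)
               (F : 'I_k -> {set 'I_n}) (eps : R),
          0 < eps -> mrank M = k -> transversal_matroid M F ->
          computes_within p (input G eps F (fun=> 1%N))
            (c%:R * (1 / eps + k%:R) ^+ (c * k) * n.+1%:R ^+ c)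
            (approx_solution G M eps)].
Proof.
have kernelP lam := cost_polynomial (p_kernel lam) 2.
have solveP lam := cost_polynomial (p_solve lam) 2.
have [cL hcL] := kernelP true; have [cT hcT] := kernelP false.
have [dL hdL] := solveP true; have [dT hdT] := solveP false.
have rank_ge0 (k : nat) (eps : R) : 0 < eps -> 0 <= k%:R / eps.
  by move=> e0; rewrite divr_ge0 // ltW.
have solveL n r k (G : wgraph R n) (M : matroid n) (F : 'I_r -> {set 'I_n}) b (eps : R) :
    0 < eps -> mrank M = k -> laminar_matroid M F b ->
    computes_within (p_solve true) (input G eps F b)
      ((dL + 4)%:R * Num.max 1 (1 / eps) ^+ ((dL + 4) * k) * n.+1%:R ^+ (dL + 4))
      (approx_solution G M eps).
  move=> e0 rE lam; apply: computes_of_okx (hdL n) (solveL_run G e0 lam erefl) _ => //.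
    by rewrite exprn_ge0 // le_max ler01.
  by rewrite rE ler_weXn2l ?le_max ?lexx // leq_mul2r leq_addl orbT.
split; split.
- exists (p_kernel true), cL => n r k G M F b eps e0 rE /partition_laminar lam.
  apply: computes_of_ok (hcL n) (kernelL_run G e0 lam) _ => s' [h1 h2].
  by rewrite -rE; split.
- exists (p_kernel true), cL => n r k G M F b eps e0 rE lam.
  apply: computes_of_ok (hcL n) (kernelL_run G e0 lam) _ => s' [h1 h2]; split=> //.
  (* The laminar kernel already meets the bound [k / eps], at most [2 * k / eps]. *)
  apply: (le_trans h2); rewrite rE -mulrA [2 * _]mulr_natl mulr2n lerDl.
  exact: rank_ge0.
- exists (p_kernel false), cT => n k G M F eps e0 rE tM.
  exact: computes_of_ok (hcT n) (kernelT_run G _ e0 tM rE) _.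
- exists (p_solve true), (dL + 4)%N => n r k G M F b eps e0 rE /partition_laminar lam.
  exact: solveL.
- by exists (p_solve true), (dL + 4)%N => n r k G M F b eps; apply: solveL.
- exists (p_solve false), (dT + 4)%N => n k G M F eps e0 rE tM.
  apply: computes_of_okx (hdT n) (solveT_run G _ e0 tM rE erefl) _ => //.
    by rewrite exprn_ge0 // addr_ge0 // -[1 / eps]/(1%:R / eps) rank_ge0.
  have [->|k0] := posnP k; first by rewrite !muln0.
  rewrite ler_weXn2l //; last by rewrite leq_mul2r; lia.
  by rewrite ler_wpDl ?ler1n // -[1 / eps]/(1%:R / eps) rank_ge0.
Qed.
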